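(* Let $G$ be a second countable almost unimodular locally compact group with a 2-cocycle $\omega:G\times G\to\mathbb{T}$, and identify $L_\omega(G)\cong L_\omega(\ker\Delta_G)\rtimes_{(\check\alpha^\omega,u^\omega)}\Delta_G(G)$, where $(\check\alpha^\omega,u^\omega)$ is the cocycle action of the discrete group $\Delta_G(G)$ on $L_\omega(\ker\Delta_G)$ described in the context. Then the following conditions are equivalent. (i) $(\check\alpha^\omega,u^\omega):\Delta_G(G)\curvearrowright L_\omega(\ker\Delta_G)$ is centrally ergodic. (ii) $L_\omega(G)$ is a factor.
   Context: All locally compact groups are Hausdorff. $\mu_G$ is a left Haar measure on $G$, and $\Delta_G: G\to(0,\infty)$ is determined by $\mu_G(Es)=\Delta_G(s)\mu_G(E)$. $G$ is almost unimodular if $\ker\Delta_G$ is open; then $D:=\Delta_G(G)$ is regarded as a countable discrete abelian group. A (Borel) 2-cocycle is a Borel map $\omega:G\times G\to\mathbb{T}$ with $\omega(s,t)\omega(st,r)=\omega(t,r)\omega(s,tr)$. The left regular $\omega$-projective representation on $L^2(G)$ is $[\lambda_G^\omega(s)f](t)=\omega(t^{-1},s)f(s^{-1}t)$, and $L_\omega(G):=\{\lambda^\omega_G(s):s\in G\}''$. $L_\omega(\ker\Delta_G)$ (for the restricted cocycle) is identified with $\{\lambda_G^\omega(s):s\in\ker\Delta_G\}''\le L_\omega(G)$. A cocycle action $(\check\alpha,u)$ of a discrete group $H$ on a von Neumann algebra $M\subset B(\mathcal H)$ is a pair of maps $\check\alpha:H\to\mathrm{Aut}(M)$, $u:H\times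 H\to \{\text{unitaries of }M\}$ with $\check\alpha_s\check\alpha_t=\mathrm{Ad}(u(s,t))\check\alpha_{st}$, $u(s,t)u(st,r)=\check\alpha_s(u(t,r))u(s,tr)$, $u(s,e)=u(e,s)=1$. The twisted crossed product $M\rtimes_{(\check\alpha,u)}H$ is the von Neumann algebra on $L^2(H,\mathcal H)$ generated by $(I^{\check\alpha}(x)\xi)(s)=\check\alpha_{s^{-1}}(x)\xi(s)$, $x\in M$, and $(\lambda_H^u(t)\xi)(s)=u(s^{-1},t)\xi(t^{-1}s)$, $t\in H$. The restriction of $\check\alpha$ to the center $Z(M)$ is a genuine action; $(\check\alpha,u)$ is centrally ergodic if $\{z\in Z(M):\check\alpha_s(z)=z\ \forall s\in H\}=\mathbb{C}1$. The cocycle action $(\check\alpha^\omega,u^\omega)$: fix a section $\sigma:D\to G$ with $\sigma(1)=e$ and $\Delta_G(\sigma(\delta))=\delta$; put $w_1=1$ and $w_\delta=\lambda_G^\omega(\sigma(\delta^{-1})^{-1})$ for $\delta\ne1$. Then $\check\alpha^\omega_\delta=\mathrm{Ad}(w_\delta)|_{L_\omega(\ker\Delta_G)}$ and $u^\omega(\delta_1,\delta_2)=w_{\delta_1}w_{\delta_2}w_{\delta_1\delta_2}^*$, and the isomorphism $L_\omega(\ker\Delta_G)\rtimes_{(\check\alpha^\omega,u^\omega)}D\cong L_\omega(G)$ sends $I^{\check\alpha^\omega}(x)\mapsto x$ and $\lambda_D^{u^\omega}(\delta)\mapsto w_\delta$. *)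

(* Defs.v *)
From HB Require Import structures.
From mathcomp Require Import all_boot all_order all_algebra.
From mathcomp Require Import ring.
From mathcomp Require Import complex.
From mathcomp Require Import all_classical all_reals all_analysis.
From mathcomp Require Import measurable_realfun.

Set Implicit Arguments.
Unset Strict Implicit.
Unset Printing Implicit Defensive.

Import Order.TTheory GRing.Theory Num.Theory.
Import numFieldNormedType.Exports.

Local Open Scope classical_set_scope.
Local Open Scope complex_scope.
Local Open Scope quotient_scope.
Local Open Scope ring_scope.

(* Operators are plain functions on an inner product space H over R[i]; an
   operator algebra is a set of such functions.  Completeness of H is not part
   of the structure because no definition below refers to it; the only instance
   used is L^2(G), which is complete. *)

(* The inner product is linear in its first argument. *)
HB.mixin Record Lmodule_isInnerProduct (R : realType) V
    & GRing.Lmodule R[i] V := {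
  inner : V -> V -> R[i];
  inner_linearl : forall (a : R[i]) (u v w : V),
    inner (a *: u + v) w = a * inner u w + inner v w;
  innerC : forall u v : V, inner u v = (inner v u)^*;
  inner_ge0 : forall u : V, 0 <= inner u u;
  inner_eq0 : forall u : V, inner u u = 0 -> u = 0
}.

#[short(type="innerProductType")]
HB.structure Definition InnerProduct (R : realType) :=
  {V of GRing.Lmodule R[i] V & Lmodule_isInnerProduct R V}.

Section operators.
Context {R : realType} {H : innerProductType R}.
Implicit Types (T U : H -> H) (M : set (H -> H)).

Definition inner_norm (x : H) : R := Num.sqrt (complex.Re (inner x x)).

Definition bounded_operator T :=
  linear T /\ exists C : R, forall x, inner_norm (T x) <= C * inner_norm x.

Definition is_adjoint T U := forall x y, inner (T x) y = inner x (U y).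

(* Unique when it exists, and it exists for bounded operators on a Hilbert space;
   otherwise a junk value. *)
Definition adjoint T : H -> H := xget (fun=> 0) [set U | is_adjoint T U].

Definition unitary_operator T :=
  [/\ bounded_operator T, is_adjoint T (adjoint T),
      T \o adjoint T = id & adjoint T \o T = id].

Definition Ad U T := U \o T \o adjoint U.

Definition scalar_operators : set (H -> H) :=
  [set T | exists c : R[i], T = fun x => c *: x].

(* The commutant in B(H). *)
Definition commutant M : set (H -> H) :=
  [set T | bounded_operator T /\ forall U, M U -> T \o U = U \o T].

Definition bicommutant M := commutant (commutant M).

Definition center M := M `&` commutant M.

Definition is_factor M := center M = scalar_operators.

Definition star_automorphism M (a : (H -> H) -> (H -> H)) :=
  [/\ set_bij M M a,
      forall (c : R[i]) T U, M T -> M U ->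
        a (fun x => c *: T x + U x) = fun x => c *: a T x + a U x,
      forall T U, M T -> M U -> a (T \o U) = a T \o a U
    & forall T U, M T -> M U -> is_adjoint T U -> is_adjoint (a T) (a U)].

(* Meaningful when M is a von Neumann algebra and K a discrete group; the values
   of ca_aut s outside M play no role. *)
Record cocycle_action (K : groupType) M := CocycleAction {
  ca_aut : K -> (H -> H) -> (H -> H);
  ca_coc : K -> K -> H -> H;
  ca_autP : forall s, star_automorphism M (ca_aut s);
  ca_cocP : forall s t, M (ca_coc s t) /\ unitary_operator (ca_coc s t);
  ca_aut_mul : forall s t T, M T ->
    ca_aut s (ca_aut t T) = Ad (ca_coc s t) (ca_aut (s * t)%g T);
  ca_coc_mul : forall s t r,
    ca_coc s t \o ca_coc (s * t)%g r = ca_aut s (ca_coc t r) \o ca_coc s (t * r)%g;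
  ca_coc1r : forall s, ca_coc s 1%g = id;
  ca_coc1l : forall s, ca_coc 1%g s = id
}.

Definition centrally_ergodic (K : groupType) M (a : cocycle_action K M) :=
  [set T | center M T /\ forall s, ca_aut a s T = T] = scalar_operators.

End operators.
Arguments scalar_operators {R} H.

Section operator_theory.
Context {R : realType} {H : innerProductType R}.
Implicit Types (T U V : H -> H) (M : set (H -> H)).

Lemma inner0l (x : H) : inner 0 x = 0.
Proof.
have := inner_linearl 1 0 0 x; rewrite scale1r addr0 mul1r.
by move=> /eqP; rewrite -subr_eq0 opprD addrA subrr sub0r oppr_eq0 => /eqP.
Qed.

Lemma innerBl (x y z : H) : inner (x - y) z = inner x z - inner y z.
Proof. by rewrite addrC -scaleN1r inner_linearl mulN1r addrC. Qed.

Lemma inner_inj (x y : H) : (forall z, inner x z = inner y z) -> x = y.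
Proof.
by move=> xy; apply/eqP; rewrite -subr_eq0; apply/eqP/inner_eq0;
  rewrite innerBl xy subrr.
Qed.

Lemma adjointP T U : is_adjoint T U -> adjoint T = U.
Proof.
move=> TU; have : is_adjoint T (adjoint T) by exact: (@xgetPex _ (fun=> 0) [set V | is_adjoint T V] (ex_intro _ U TU)).
move=> TA; apply/funext => y; apply: inner_inj => z.
by rewrite innerC -TA TU -innerC.
Qed.

Lemma unitary_isometry T U : linear T -> (forall x y, inner (T x) (T y) = inner x y) ->
  T \o U = id -> U \o T = id ->
  [/\ unitary_operator T, adjoint T = U & bounded_operator T].
Proof.
move=> Tl Tiso TU UT.
have TA : is_adjoint T U.
  by move=> x y; rewrite -[y in LHS](congr1 (@^~ y) TU)/= Tiso.
have Tb : bounded_operator T.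
  by split=> //; exists 1 => x; rewrite /inner_norm Tiso mul1r.
by split=> //; rewrite /unitary_operator !(adjointP TA).
Qed.

Lemma bounded_operator_comp T U :
  bounded_operator T -> bounded_operator U -> bounded_operator (T \o U).
Proof.
move=> [Tl [C TC]] [Ul [D UD]]; split; first by move=> a x y /=; rewrite Ul Tl.
exists (`|C| * `|D|) => x /=; rewrite (le_trans (TC _))//.
rewrite (le_trans (ler_wpM2r (sqrtr_ge0 _) (ler_norm C)))// -mulrA ler_wpM2l//.
by rewrite (le_trans (UD _))// ler_wpM2r ?sqrtr_ge0 ?ler_norm.
Qed.

Lemma bicommutant_sub M : (forall T, M T -> bounded_operator T) ->
  M `<=` bicommutant M.
Proof. by move=> Mb T MT; split; [exact: Mb|move=> U [_ ->]]. Qed.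

Lemma commutantZ M U (c : R[i]) : commutant M U -> forall T, M T ->
  U \o (fun x => c *: T x) = (fun x => c *: T x) \o U.
Proof.
move=> [[Ul _] UM] T MT; apply/funext => x /=.
have U0 : U 0 = 0.
  by have := Ul (-1) 0 0; rewrite scaleN1r oppr0 addr0 scaleN1r addNr.
have -> : U (c *: T x) = c *: U (T x) by have := Ul c (T x) 0; rewrite !addr0 U0 addr0.
by have /= -> := congr1 (@^~ x) (UM _ MT).
Qed.

Lemma bicommutant_conj M U V : bounded_operator U -> bounded_operator V ->
  U \o V = id -> V \o U = id ->
  (forall T, M T -> exists (c : R[i]) T', M T' /\ U \o T \o V = fun x => c *: T' x) ->
  forall T, bicommutant M T -> bicommutant M (U \o T \o V).
Proof.
move=> Ub Vb UV VU UM T [Tb TM]; split.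
  exact: bounded_operator_comp (bounded_operator_comp _ _) _.
move=> X XM.
have UVx x : U (V x) = x by exact: (congr1 (@^~ x) UV).
have VUx x : V (U x) = x by exact: (congr1 (@^~ x) VU).
have VXU : commutant M (V \o X \o U).
  split; first by case: XM => Xb _; do 2 apply: bounded_operator_comp => //.
  move=> A MA; have [c [B [MB UAV]]] := UM _ MA.
  have UA x : U (A x) = c *: B (U x).
    by rewrite -[x in LHS]VUx; exact: (congr1 (@^~ (U x)) UAV).
  have AV x : A (V x) = V (c *: B x).
    by rewrite -(congr1 (@^~ x) UAV) /= VUx.
  apply/funext => x /=; rewrite UA AV; congr V.
  exact: (congr1 (@^~ (U x)) (commutantZ c XM MB)).
apply/funext => x /=.
have /= := congr1 (@^~ (V x)) (TM _ VXU); rewrite UVx => ->.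
by rewrite UVx.
Qed.

End operator_theory.



Section square_integrable.
Context d (T : measurableType d) (R : realType) (mu : {measure set T -> \bar R}).

(* Membership of a complex function in calligraphic L^2: |f|^2 = (Re f)^2 + (Im f)^2. *)
Definition square_integrable (f : T -> R[i]) :=
  (fun t => complex.Re (f t)) \in Lfun mu 2%:E /\
  (fun t => complex.Im (f t)) \in Lfun mu 2%:E.

Let Lfun2_ext (f g : T -> R) : f \in Lfun mu 2%:E -> f =1 g ->
  g \in Lfun mu 2%:E.
Proof. by move=> + /funext <-. Qed.

Let Lfun2_lin (a b : R) (f g : T -> R) :
  f \in Lfun mu 2%:E -> g \in Lfun mu 2%:E ->
  (fun t => a * f t + b * g t) \in Lfun mu 2%:E.
Proof.
move=> fL gL.
have [L0 Llin] := @Lfun_submod_closed _ _ _ mu _ (@lee1n R 2).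
apply: (Lfun2_ext (Llin a _ _ fL (Llin b _ _ gL L0))) => t.
by rewrite !fctE addr0.
Qed.

Lemma square_integrable0 : square_integrable (fun=> 0).
Proof.
by have [L0 _] := @Lfun_submod_closed _ _ _ mu _ (@lee1n R 2); split.
Qed.

Lemma square_integrable_lin (a : R[i]) (f g : T -> R[i]) :
  square_integrable f -> square_integrable g ->
  square_integrable (fun t => a * f t + g t).
Proof.
move=> [fr fi] [gr gi]; split.
- apply: (Lfun2_ext (Lfun2_lin 1 1
    (Lfun2_lin (complex.Re a) (- complex.Im a) fr fi) gr)) => t.
  by case: a (f t) (g t) => [a1 a2] [x1 x2] [y1 y2]/=; rewrite !mul1r mulNr.
- apply: (Lfun2_ext (Lfun2_lin 1 1
    (Lfun2_lin (complex.Re a) (complex.Im a) fi fr) gi)) => t.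
  by case: a (f t) (g t) => [a1 a2] [x1 x2] [y1 y2]/=; rewrite !mul1r.
Qed.

Lemma square_integrable_prod (f g : T -> R[i]) :
  square_integrable f -> square_integrable g ->
  mu.-integrable setT (EFin \o (fun t => complex.Re (f t * (g t)^*))) /\
  mu.-integrable setT (EFin \o (fun t => complex.Im (f t * (g t)^*))).
Proof.
move=> [fr fi] [gr gi].
have P x y : x \in Lfun mu 2%:E -> y \in Lfun mu 2%:E ->
  mu.-integrable setT (EFin \o (x \* y)).
  by move=> xL yL; exact/Lfun1_integrable/Lfun2_mul_Lfun1.
split.
- have := integrableD measurableT (P _ _ fr gr) (P _ _ fi gi).
  apply: eq_integrable => //= t _.
  by case: (f t) (g t) => [x1 x2] [y1 y2]/=; rewrite mulrN opprK.
- have := integrableB measurableT (P _ _ fi gr) (P _ _ fr gi).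
  apply: eq_integrable => //= t _.
  by case: (f t) (g t) => [x1 x2] [y1 y2]/=; rewrite -EFinB mulrN addrC.
Qed.

Lemma Lfun2P (f : T -> R) : f \in Lfun mu 2%:E <->
  measurable_fun setT f /\ mu.-integrable setT (EFin \o (fun t => f t ^+ 2)).
Proof.
split=> [fL|[mf /integrableP[_ fi]]].
  split; last exact: Lfun2_integrable_sqr.
  by move: fL; rewrite inE => /andP[/[!inE]].
rewrite inE; apply/andP; split; rewrite inE//=.
rewrite /finite_norm unlock /= poweR_lty//; apply: le_lt_trans fi.
rewrite le_eqVlt; apply/orP; left; apply/eqP.
apply: eq_integral => t _ /=.
by rewrite powR_mulrn// -normrX.
Qed.

End square_integrable.

Section L2_definition.
Context d (T : measurableType d) (R : realType) (mu : {measure set T -> \bar R}).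

Definition L2fun : Type := [set f : T -> R[i] | square_integrable mu f].
HB.instance Definition _ := SubChoice.on L2fun.

Definition L2_equiv (f g : L2fun) :=
  `[< {ae mu, forall t, val f t = val g t} >].

Lemma L2_equiv_refl : reflexive L2_equiv.
Proof. by move=> f; apply/asboolP; exact: aeW. Qed.

Lemma L2_equiv_sym : symmetric L2_equiv.
Proof.
by move=> f g; apply/asboolP/asboolP; apply: filterS => t ->.
Qed.

Lemma L2_equiv_trans : transitive L2_equiv.
Proof.
move=> g f h /asboolP fg /asboolP gh; apply/asboolP.
by move: fg gh; apply: filterS2 => t -> ->.
Qed.

Canonical L2_equivRel :=
  EquivRel L2_equiv L2_equiv_refl L2_equiv_sym L2_equiv_trans.

Definition L2 : Type := {eq_quot L2_equiv}.
HB.instance Definition _ := Choice.on L2.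
HB.instance Definition _ := EqQuotient.on L2.

Definition L2fun0 : L2fun := SigSub (mem_set (square_integrable0 mu)).

(* The class of f, and the class of 0 when f is not square integrable. *)
Definition L2_of (f : T -> R[i]) : L2 := \pi_L2 (insubd L2fun0 f).

(* A chosen representative. *)
Definition L2_val (x : L2) : T -> R[i] := val (repr x).
Coercion L2_val : L2 >-> Funclass.

Lemma L2_valP (x : L2) : square_integrable mu x.
Proof. exact: (set_mem (valP (repr x))). Qed.

Lemma L2_ofK f : square_integrable mu f -> {ae mu, forall t, L2_of f t = f t}.
Proof.
move=> fP; have : repr (L2_of f) = insubd L2fun0 f %[mod L2] by rewrite reprK.
by move=> /eqmodP/asboolP; rewrite insubdK//; exact: mem_set.
Qed.

Lemma L2_ext (x y : L2) : {ae mu, forall t, x t = y t} -> x = y.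
Proof.
by move=> xy; rewrite -[x]reprK -[y]reprK; apply/eqmodP/asboolP.
Qed.

Lemma L2_of_eq f g : square_integrable mu f -> square_integrable mu g ->
  {ae mu, forall t, f t = g t} -> L2_of f = L2_of g.
Proof.
move=> fP gP fg; apply: L2_ext; move: (L2_ofK fP) (L2_ofK gP) fg.
by apply: filterS3 => t -> -> ->.
Qed.

Lemma L2_valK (x : L2) : L2_of x = x.
Proof. exact/L2_ext/L2_ofK/L2_valP. Qed.

Definition L2_add (x y : L2) : L2 := L2_of (fun t => x t + y t).
Definition L2_opp (x : L2) : L2 := L2_of (fun t => - x t).
Definition L2_scale (a : R[i]) (x : L2) : L2 := L2_of (fun t => a * x t).

Lemma L2_ofE f g : square_integrable mu g -> g =1 f ->
  {ae mu, forall t, L2_of f t = f t}.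
Proof. by move=> gP /funext <-; exact: L2_ofK. Qed.

Let addE (x y : L2) : {ae mu, forall t, L2_add x y t = x t + y t}.
Proof.
apply: L2_ofE (square_integrable_lin 1 (L2_valP x) (L2_valP y)) _ => t.
by rewrite mul1r.
Qed.

Lemma L2_scaleE a (x : L2) : {ae mu, forall t, L2_scale a x t = a * x t}.
Proof.
apply: L2_ofE (square_integrable_lin a (L2_valP x) (square_integrable0 mu)) _.
by move=> t; rewrite addr0.
Qed.

Let oppE (x : L2) : {ae mu, forall t, L2_opp x t = - x t}.
Proof.
apply: L2_ofE (square_integrable_lin (-1) (L2_valP x) (square_integrable0 mu)) _.
by move=> t; rewrite addr0 mulN1r.
Qed.

Let zeroE : {ae mu, forall t, L2_of (fun=> 0) t = 0}.
Proof. exact/L2_ofK/square_integrable0. Qed.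



Let L2_addA : associative L2_add.
Proof.
move=> x y z; apply: L2_ext; near=> t.
have -> : L2_add x (L2_add y z) t = x t + L2_add y z t by near: t; exact: addE.
have -> : L2_add y z t = y t + z t by near: t; exact: addE.
have -> : L2_add (L2_add x y) z t = L2_add x y t + z t by near: t; exact: addE.
have -> : L2_add x y t = x t + y t by near: t; exact: addE.
exact: addrA.
Unshelve. all: by end_near. Qed.

Let L2_addC : commutative L2_add.
Proof.
by move=> x y; congr L2_of; apply/funext => t; rewrite addrC.
Qed.

Let L2_add0 : left_id (L2_of (fun=> 0)) L2_add.
Proof.
move=> x; rewrite -[RHS]L2_valK; apply: L2_ext; near=> t.
have -> : L2_add (L2_of (fun=> 0)) x t = L2_of (fun=> 0) t + x t.
  by near: t; exact: addE.
have -> : L2_of (fun=> 0) t = 0 by near: t; exact: zeroE.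
by rewrite L2_valK add0r.
Unshelve. all: by end_near. Qed.

Let L2_addN : left_inverse (L2_of (fun=> 0)) L2_opp L2_add.
Proof.
move=> x; apply: L2_ext; near=> t.
have -> : L2_add (L2_opp x) x t = L2_opp x t + x t by near: t; exact: addE.
have -> : L2_opp x t = - x t by near: t; exact: oppE.
have -> : L2_of (fun=> 0) t = 0 by near: t; exact: zeroE.
by rewrite addNr.
Unshelve. all: by end_near. Qed.

HB.instance Definition _ := GRing.isZmodule.Build L2
  L2_addA L2_addC L2_add0 L2_addN.

Let L2_scaleA a b (x : L2) : L2_scale a (L2_scale b x) = L2_scale (a * b) x.
Proof.
apply: L2_ext; near=> t.
have -> : L2_scale a (L2_scale b x) t = a * L2_scale b x t.
  by near: t; exact: L2_scaleE.
have -> : L2_scale b x t = b * x t by near: t; exact: L2_scaleE.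
have -> : L2_scale (a * b) x t = a * b * x t by near: t; exact: L2_scaleE.
by rewrite mulrA.
Unshelve. all: by end_near. Qed.

Let L2_scale1 : left_id 1 L2_scale.
Proof.
move=> x; rewrite -[RHS]L2_valK; congr L2_of; apply/funext => t.
by rewrite mul1r.
Qed.

Let L2_scaleDr : right_distributive L2_scale +%R.
Proof.
move=> a x y; apply: L2_ext; near=> t.
have -> : L2_scale a (x + y) t = a * L2_val (x + y) t by near: t; exact: L2_scaleE.
have -> : L2_val (x + y) t = x t + y t by near: t; exact: addE.
have -> : L2_val (L2_scale a x + L2_scale a y) t = L2_scale a x t + L2_scale a y t.
  by near: t; exact: addE.
have -> : L2_scale a x t = a * x t by near: t; exact: L2_scaleE.
have -> : L2_scale a y t = a * y t by near: t; exact: L2_scaleE.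
by rewrite mulrDr.
Unshelve. all: by end_near. Qed.

Let L2_scaleDl x : {morph L2_scale^~ x : a b / a + b}.
Proof.
move=> a b; apply: L2_ext; near=> t.
have -> : L2_scale (a + b) x t = (a + b) * x t by near: t; exact: L2_scaleE.
have -> : L2_val (L2_scale a x + L2_scale b x) t = L2_scale a x t + L2_scale b x t.
  by near: t; exact: addE.
have -> : L2_scale a x t = a * x t by near: t; exact: L2_scaleE.
have -> : L2_scale b x t = b * x t by near: t; exact: L2_scaleE.
by rewrite mulrDl.
Unshelve. all: by end_near. Qed.

HB.instance Definition _ := GRing.Zmodule_isLmodule.Build R[i] L2
  L2_scaleA L2_scale1 L2_scaleDr L2_scaleDl.

Lemma L2_linE a (x y : L2) :
  {ae mu, forall t, L2_val (a *: x + y) t = a * x t + y t}.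
Proof.
near=> t.
have -> : L2_val (a *: x + y) t = L2_val (a *: x) t + y t by near: t; exact: addE.
by congr (_ + _); near: t; exact: L2_scaleE.
Unshelve. all: by end_near. Qed.

Definition L2_inner (x y : L2) : R[i] :=
  (\int[mu]_t complex.Re (x t * (y t)^*)) +i*
  (\int[mu]_t complex.Im (x t * (y t)^*)).

Let L2_inner_int (x y : L2) :
  mu.-integrable setT (EFin \o (fun t => complex.Re (x t * (y t)^*))) /\
  mu.-integrable setT (EFin \o (fun t => complex.Im (x t * (y t)^*))).
Proof. by apply: square_integrable_prod; exact: L2_valP. Qed.

Lemma ae_eq_Rintegral (f g : T -> R) :
  mu.-integrable setT (EFin \o f) -> mu.-integrable setT (EFin \o g) ->
  {ae mu, forall t, f t = g t} -> \int[mu]_t f t = \int[mu]_t g t.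
Proof.
move=> fi gi fg; rewrite /Rintegral; congr fine.
apply: ae_eq_integral => //.
- exact: measurable_int fi.
- exact: measurable_int gi.
- by apply: filterS fg => t /= -> _.
Qed.

Let L2_inner_linearl a (x y z : L2) :
  L2_inner (a *: x + y) z = a * L2_inner x z + L2_inner y z.
Proof.
have [xr xi] := L2_inner_int x z; have [yr yi] := L2_inner_int y z.
have [lr li] := L2_inner_int (a *: x + y) z.
have Z (c : R) (f : T -> R) : mu.-integrable setT (EFin \o f) ->
    mu.-integrable setT (EFin \o (fun t => c * f t)).
  by move=> fi; apply: eq_integrable (integrableZl measurableT c fi).
have D (f g : T -> R) : mu.-integrable setT (EFin \o f) ->
    mu.-integrable setT (EFin \o g) ->
    mu.-integrable setT (EFin \o (fun t => f t + g t)).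
  by move=> fi gi; apply: eq_integrable (integrableD measurableT fi gi).
case: a lr li => a b lr li; rewrite {3}/L2_inner {1}/L2_inner /=.
apply/eqP; rewrite eq_complex /=; apply/andP; split; apply/eqP.
- rewrite -mulNr -(RintegralZl _ measurableT xr) -(RintegralZl _ measurableT xi).
  rewrite -(RintegralD measurableT (Z _ _ xr) (Z _ _ xi)).
  rewrite -(RintegralD measurableT (D _ _ (Z _ _ xr) (Z _ _ xi)) yr).
  apply: ae_eq_Rintegral => //.
    exact: (D _ _ (D _ _ (Z _ _ xr) (Z _ _ xi)) yr).
  apply: filterS (L2_linE (a +i* b) x y) => t ->.
  by case: (x t) (y t) (z t) => [x1 x2] [y1 y2] [z1 z2] /=; ring.
- rewrite -(RintegralZl _ measurableT xr) -(RintegralZl _ measurableT xi).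
  rewrite -(RintegralD measurableT (Z _ _ xi) (Z _ _ xr)).
  rewrite -(RintegralD measurableT (D _ _ (Z _ _ xi) (Z _ _ xr)) yi).
  apply: ae_eq_Rintegral => //.
    exact: (D _ _ (D _ _ (Z _ _ xi) (Z _ _ xr)) yi).
  apply: filterS (L2_linE (a +i* b) x y) => t ->.
  by case: (x t) (y t) (z t) => [x1 x2] [y1 y2] [z1 z2] /=; ring.
Qed.

Let L2_innerC (x y : L2) : L2_inner x y = (L2_inner y x)^*.
Proof.
rewrite /L2_inner /=; congr (_ +i* _).
  by apply: eq_Rintegral => t _; case: (x t) (y t) => [? ?] [? ?] /=; ring.
have [_ yx] := L2_inner_int y x.
rewrite -mulN1r -RintegralZl//.
by apply: eq_Rintegral => t _; case: (x t) (y t) => [? ?] [? ?] /=; ring.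
Qed.

Let L2_inner_im0 (x : L2) : complex.Im (L2_inner x x) = 0.
Proof.
rewrite /L2_inner /=; under eq_Rintegral => t _.
  rewrite (_ : complex.Im _ = 0); last by case: (x t) => ? ? /=; ring.
  over.
by rewrite /Rintegral integral0.
Qed.

Let L2_inner_ge0 (x : L2) : 0 <= L2_inner x x.
Proof.
rewrite lecE L2_inner_im0 eqxx/=; apply: Rintegral_ge0 => t _.
by case: (x t) => a b /=; rewrite mulrN opprK addr_ge0// -expr2 sqr_ge0.
Qed.

Let L2_inner_eq0 (x : L2) : L2_inner x x = 0 -> x = 0.
Proof.
move=> /(congr1 (@complex.Re R)) /=.
have [xi _] := L2_inner_int x x.
pose h t := complex.Re (x t * (x t)^*).
have h0 t : 0 <= h t.
  by rewrite /h; case: (x t) => a b /=; rewrite mulrN opprK addr_ge0// -expr2 sqr_ge0.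
rewrite -/h /Rintegral => e.
have : (\int[mu]_t (h t)%:E = 0)%E.
  rewrite -[LHS]fineK ?e//; exact: integrable_fin_num xi.
move=> e0; apply: L2_ext.
have [h_eq0 _] := ae_eq_integral_abs mu measurableT (measurable_int mu xi).
have /h_eq0 h_ae0 : (\int[mu]_(t in setT) `|(EFin \o h) t| = 0)%E.
  by rewrite -[RHS]e0; apply: eq_integral => t _ /=; rewrite ger0_norm.
have := zeroE; move: h_ae0; apply: filterS2 => t /= /(_ I) [ht] ->.
move: ht; rewrite /h; case: (x t) => a b /= /eqP.
rewrite mulrN opprK -!expr2 paddr_eq0 ?sqr_ge0// !sqrf_eq0.
by move=> /andP[/eqP -> /eqP ->].
Qed.

HB.instance Definition _ := Lmodule_isInnerProduct.Build R L2
  L2_inner_linearl L2_innerC L2_inner_ge0 L2_inner_eq0.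

Lemma L2_innerE (f g : T -> R[i]) (x y : L2) :
  square_integrable mu f -> square_integrable mu g ->
  {ae mu, forall t, x t = f t} -> {ae mu, forall t, y t = g t} ->
  inner x y = (\int[mu]_t complex.Re (f t * (g t)^*)) +i*
              (\int[mu]_t complex.Im (f t * (g t)^*)).
Proof.
move=> fL gL xf yg; rewrite /inner /= /L2_inner.
have [? ?] := L2_inner_int x y.
have [? ?] := square_integrable_prod fL gL.
by congr (_ +i* _); apply: ae_eq_Rintegral => //;
  move: xf yg; apply: filterS2 => t -> ->.
Qed.

End L2_definition.

(* Pointed only because measurable types are. *)
HB.mixin Record isLocallyCompactGroup G
    & PointedTopological G & Group G := {
  mulg_continuous : continuous (fun x : G * G => (x.1 * x.2)%g);
  invg_continuous : continuous (fun x : G => x^-1%g);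
  lcgroup_hausdorff : hausdorff_space G;
  lcgroup_locally_compact : locally_compact [set: G]
}.

#[short(type="lcGroupType")]
HB.structure Definition LocallyCompactGroup :=
  {G of PointedTopological G & Group G & isLocallyCompactGroup G}.

HB.instance Definition _ (X Y : ptopologicalType) := Pointed.on (X * Y)%type.

Notation borelType X := (g_sigma_algebraType (@open X)).

Section borel.
Context {X Y : ptopologicalType}.

Lemma open_borel (U : set X) : open U -> measurable (U : set (borelType X)).
Proof. exact: sub_sigma_algebra. Qed.

Lemma continuous_borel (f : X -> Y) : continuous f ->
  measurable_fun setT (f : borelType X -> borelType Y).
Proof.
move=> /continuousP cf; apply: (@measurability _ _ (borelType X) (borelType Y) setT f (@open Y)) => //.
by move=> _ [U oU <-]; rewrite setTI; apply: sub_sigma_algebra; exact: cf.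
Qed.

End borel.

(* A nonzero left invariant Radon measure on the Borel sets. *)
Record left_haar_measure (R : realType) (G : lcGroupType) := LeftHaarMeasure {
  haar :> {measure set (borelType G) -> \bar R};
  haar_compact : forall K : set G, compact K -> (haar K < +oo)%E;
  haar_outer_regular : forall E : set (borelType G), measurable E ->
    haar E = ereal_inf [set haar U | U in [set U : set G | open U /\ E `<=` U]];
  haar_inner_regular : forall U : set G, open U ->
    haar U = ereal_sup [set haar K | K in [set K : set G | compact K /\ K `<=` U]];
  haar_nonzero : haar [set: G] != 0%E;
  haar_left_invariant : forall (s : G) (E : set (borelType G)), measurable E ->
    haar [set (s * t)%g | t in E] = haar E
}.

(* Determined by its fields, since some Borel set has finite positive measure. *)
Record modular_function (R : realType) (G : lcGroupType)
    (mu : left_haar_measure R G) := ModularFunction {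
  modular :> G -> R;
  modular_gt0 : forall s, 0 < modular s;
  modularE : forall (s : G) (E : set (borelType G)), measurable E ->
    mu [set (t * s)%g | t in E] = ((modular s)%:E * mu E)%E
}.

Section modular_function_theory.
Context {R : realType} {G : lcGroupType} {mu : left_haar_measure R G}.
Variable Delta : modular_function mu.

Lemma lmul_continuous (s : G) : continuous (fun t : G => (s * t)%g).
Proof.
move=> x; apply: (@continuous_comp _ _ _ (fun t => (s, t))
  (fun x : G * G => (x.1 * x.2)%g)); last exact: mulg_continuous.
by apply: cvg_pair; [exact: cvg_cst|exact: cvg_id].
Qed.

Lemma rmul_continuous (s : G) : continuous (fun t : G => (t * s)%g).
Proof.
move=> x; apply: (@continuous_comp _ _ _ (fun t => (t, s))
  (fun x : G * G => (x.1 * x.2)%g)); last exact: mulg_continuous.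
by apply: cvg_pair; [exact: cvg_id|exact: cvg_cst].
Qed.

Lemma lmul_image (s : G) (E : set G) :
  [set (s * t)%g | t in E] = (fun t => (s^-1 * t)%g) @^-1` E.
Proof.
apply/seteqP; split=> [_ [t Et <-]|t Et] /=; first by rewrite mulKg.
by exists (s^-1 * t)%g; rewrite ?mulVKg.
Qed.

Lemma rmul_image (s : G) (E : set G) :
  [set (t * s)%g | t in E] = (fun t => (t * s^-1)%g) @^-1` E.
Proof.
apply/seteqP; split=> [_ [t Et <-]|t Et] /=; first by rewrite mulgK.
by exists (t * s^-1)%g; rewrite ?mulgVK.
Qed.

Lemma measurable_lmul (s : G) :
  measurable_fun setT ((fun t => (s * t)%g) : borelType G -> borelType G).
Proof. exact: (@continuous_borel G G _ (@lmul_continuous s)). Qed.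

Lemma measurable_rmul (s : G) :
  measurable_fun setT ((fun t => (t * s)%g) : borelType G -> borelType G).
Proof. exact: (@continuous_borel G G _ (@rmul_continuous s)). Qed.

Lemma haar_finite_pos : exists E : set (borelType G),
  [/\ measurable E, (0 < mu E)%E & (mu E < +oo)%E].
Proof.
have mu0 : (0 < mu [set: G])%E by rewrite lt0e haar_nonzero/= measure_ge0.
move: mu0; rewrite (haar_inner_regular mu openT) => /ereal_sup_gt.
move=> [_ [K [cK _] <-] K0]; exists K; split=> //.
  rewrite -[K]setCK; apply: measurableC; apply: open_borel.
  by apply: closed_openC; apply: compact_closed => //; exact: lcgroup_hausdorff.
exact: haar_compact.
Qed.

Lemma modularM : {morph Delta : s t / (s * t)%g >-> s * t}.
Proof.
move=> s t; have [E [mE E0 Eoo]] := haar_finite_pos.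
have mEs : measurable ([set (r * s)%g | r in E] : set (borelType G)).
  by rewrite rmul_image -[X in measurable X]setTI; exact: measurable_rmul.
have := modularE Delta (s * t)%g mE.
rewrite (_ : [set (r * (s * t))%g | r in E] =
  [set (r * t)%g | r in [set (r * s)%g | r in E]]); last first.
  by rewrite image_comp; apply: eq_imagel => r _ /=; rewrite mulgA.
rewrite !(modularE Delta)// => /esym.
have /fineK <- : mu E \is a fin_num by rewrite ge0_fin_numE.
rewrite -!EFinM => -[]; rewrite mulrA => /mulIf -> //; first by rewrite mulrC.
by rewrite gt_eqF// fine_gt0// E0.
Qed.

Lemma modular1 : Delta 1%g = 1.
Proof.
have /eqP := modularM 1%g 1%g; rewrite mulg1 -{1}[Delta _]mulr1 => /eqP.
by move/mulfI => <- //; rewrite gt_eqF// modular_gt0.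
Qed.

Lemma modularV s : Delta s^-1%g = (Delta s)^-1.
Proof.
apply: (@mulfI _ (Delta s)); first by rewrite gt_eqF// modular_gt0.
by rewrite -modularM mulgV modular1 mulfV// gt_eqF// modular_gt0.
Qed.

(* The group Delta(G), as a subgroup of the positive reals. *)
Definition modular_image : Type := range Delta.
HB.instance Definition _ := SubChoice.on modular_image.

Implicit Types a b c : modular_image.

Let image_rangeM a b : val a * val b \in range Delta.
Proof.
apply/mem_set; case: a b => a aP [b bP] /=.
have [s _ <-] := set_mem aP; have [t _ <-] := set_mem bP.
by exists (s * t)%g => //; rewrite modularM.
Qed.

Let image_range1 : 1 \in range Delta.
Proof. by apply/mem_set; exists 1%g => //; exact: modular1. Qed.

Let image_rangeV a : (val a)^-1 \in range Delta.
Proof.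
apply/mem_set; case: a => a aP /=.
by have [s _ <-] := set_mem aP; exists s^-1%g => //; rewrite modularV.
Qed.

Definition modular_image_mul a b : modular_image := SigSub (image_rangeM a b).
Definition modular_image_one : modular_image := SigSub image_range1.
Definition modular_image_inv a : modular_image := SigSub (image_rangeV a).

Let val_neq0 a : val a != 0.
Proof.
case: a => a aP /=; have [s _ <-] := set_mem aP.
by rewrite gt_eqF// modular_gt0.
Qed.

Let imageA : associative modular_image_mul.
Proof. by move=> a b c; apply: val_inj; rewrite /= mulrA. Qed.
Let image1x : left_id modular_image_one modular_image_mul.
Proof. by move=> a; apply: val_inj; rewrite /= mul1r. Qed.
Let imagex1 : right_id modular_image_one modular_image_mul.
Proof. by move=> a; apply: val_inj; rewrite /= mulr1. Qed.
Let imageVx : left_inverse modular_image_one modular_image_inv modular_image_mul.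
Proof. by move=> a; apply: val_inj; rewrite /= mulVf// val_neq0. Qed.
Let imagexV : right_inverse modular_image_one modular_image_inv modular_image_mul.
Proof. by move=> a; apply: val_inj; rewrite /= mulfV// val_neq0. Qed.

HB.instance Definition _ := isGroup.Build modular_image
  imageA image1x imagex1 imageVx imagexV.

End modular_function_theory.
Arguments modular_image {R G mu} Delta.
Arguments measurable_lmul {G} s.
Arguments measurable_rmul {G} s.

Record modular_section (R : realType) (G : lcGroupType)
    (mu : left_haar_measure R G) (Delta : modular_function mu) := ModularSection {
  msection :> modular_image Delta -> G;
  msection1 : msection 1%g = 1%g;
  msectionK : forall d, Delta (msection d) = val d
}.

(* A circle-valued map on G x G is Borel iff its real and imaginary parts are;
   G * G carries the Borel sigma-algebra of the product topology. *)
Record cocycle2 (R : realType) (G : lcGroupType) := Cocycle2 {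
  cocycle :> G -> G -> R[i];
  cocycle_norm1 : forall s t, `|cocycle s t| = 1;
  cocycle_Re_measurable : measurable_fun setT
    (fun x : borelType (G * G)%type => complex.Re (cocycle x.1 x.2));
  cocycle_Im_measurable : measurable_fun setT
    (fun x : borelType (G * G)%type => complex.Im (cocycle x.1 x.2));
  cocycleE : forall s t r, cocycle s t * cocycle (s * t)%g r =
                           cocycle t r * cocycle s (t * r)%g
}.

Section haar_integral.
Context {R : realType} {G : lcGroupType} (mu : left_haar_measure R G).

Lemma measurable_comp_lmul d (T : sigmaRingType d) (f : borelType G -> T) (s : G) :
  measurable_fun setT f -> measurable_fun setT (fun t : borelType G => f (s * t)%g).
Proof.
by move=> mf; exact: (measurable_comp measurableT (@subsetT _ _) mf (measurable_lmul s)).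
Qed.

Lemma haar_preimage_lmul (s : G) (E : set (borelType G)) : measurable E ->
  mu ((fun t => (s * t)%g) @^-1` E) = mu E.
Proof.
move=> mE; rewrite -(haar_left_invariant mu s^-1%g mE) lmul_image invgK.
by [].
Qed.

Lemma haar_ae_lmul (s : G) (P : G -> Prop) :
  {ae mu, forall t, P t} -> {ae mu, forall t, P (s * t)%g}.
Proof.
move=> [N [mN N0 PN]]; exists ((fun t => (s * t)%g) @^-1` N); split.
- by rewrite -[X in measurable X]setTI; exact: measurable_lmul.
- by rewrite haar_preimage_lmul.
- by move=> t /= nP; exact: PN.
Qed.

Lemma haar_integrable_lmul (s : G) (f : borelType G -> \bar R) :
  mu.-integrable setT f -> mu.-integrable setT (fun t => f (s * t)%g).
Proof.
move=> fint; move: (fint) => /integrableP[mf fi]; apply/integrableP; split.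
  exact: measurable_comp_lmul.
apply: le_lt_trans fi; rewrite le_eqVlt; apply/orP; left; apply/eqP.
have mabs := measurable_int mu (integrable_abse fint).
have := ge0_integral_pushforward (measurable_lmul s) mu (D := setT)
  (f := abse \o f) measurableT mabs (fun _ _ => abse_ge0 _).
rewrite preimage_setT => <- //.
apply: (eq_measure_integral mu); first exact: (measurable_lmul s). by move=> mp A mA _; exact: haar_preimage_lmul.
Qed.

Lemma haar_Rintegral_lmul (s : G) (f : borelType G -> R) :
  mu.-integrable setT (EFin \o f) ->
  \int[mu]_t f (s * t)%g = \int[mu]_t f t.
Proof.
move=> fi; rewrite /Rintegral; congr fine.
have := integral_pushforward (measurable_lmul s) (mu := mu) (D := setT)
  (measurable_int mu fi) (haar_integrable_lmul s fi) measurableT.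
rewrite preimage_setT => <-.
apply: (eq_measure_integral mu); first exact: (measurable_lmul s). by move=> mp A mA _; exact: haar_preimage_lmul.
Qed.

End haar_integral.

Section twisted_group_von_neumann_algebra.
Context {R : realType} {G : lcGroupType} (mu : left_haar_measure R G)
  (omega : cocycle2 R G).

Definition twisted_translate (s : G) (f : G -> R[i]) : G -> R[i] :=
  fun t => omega t^-1%g s * f (s^-1 * t)%g.

Definition lambda (s : G) (f : L2 mu) : L2 mu := L2_of mu (twisted_translate s f).

Definition twisted_vN (S : set G) : set (L2 mu -> L2 mu) :=
  bicommutant (lambda @` S).

Lemma cocycle_sqr s t :
  complex.Re (omega s t) ^+ 2 + complex.Im (omega s t) ^+ 2 = 1.
Proof.
have := cocycle_norm1 omega s t; rewrite normc_def => -[].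
move=> /(congr1 (fun x => x ^+ 2)); rewrite sqr_sqrtr ?expr1n//.
by rewrite addr_ge0// sqr_ge0.
Qed.

Lemma cocycle_neq0 s t : omega s t != 0.
Proof. by rewrite -normr_eq0 cocycle_norm1 oner_neq0. Qed.

Lemma cocyclex1 s : omega s 1%g = omega 1%g 1%g.
Proof.
have := cocycleE omega s 1%g 1%g; rewrite !mulg1.
by move=> /mulIf; apply; exact: cocycle_neq0.
Qed.

Lemma measurable_cocycle_inv s :
  measurable_fun setT (fun t : borelType G => complex.Re (omega t^-1%g s)) /\
  measurable_fun setT (fun t : borelType G => complex.Im (omega t^-1%g s)).
Proof.
have c : continuous (fun t : G => (t^-1%g : G, s)).
  by move=> t; apply: cvg_pair; [exact: invg_continuous|exact: cvg_cst].
have m := @continuous_borel G [the ptopologicalType of (G * G)%type] _ c.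
split.
  exact: (measurableT_comp (cocycle_Re_measurable omega) m).
exact: (measurableT_comp (cocycle_Im_measurable omega) m).
Qed.

Lemma twisted_translate_L2 s (f : G -> R[i]) :
  square_integrable mu f -> square_integrable mu (twisted_translate s f).
Proof.
move=> [/Lfun2P[mr ir] /Lfun2P[mi ii]].
have [mwr mwi] := measurable_cocycle_inv s.
have mr' := measurable_comp_lmul s^-1%g mr.
have mi' := measurable_comp_lmul s^-1%g mi.
have ir' := haar_integrable_lmul s^-1%g ir.
have ii' := haar_integrable_lmul s^-1%g ii.
have i' := integrableD measurableT ir' ii'.
have mRe : measurable_fun setT
    (fun t : borelType G => complex.Re (twisted_translate s f t)).
  have := measurable_funB (measurable_funM mwr mr') (measurable_funM mwi mi').
  apply: eq_measurable_fun => t _; rewrite /twisted_translate /=.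
  by case: (omega _ _) (f _) => [? ?] [? ?].
have mIm : measurable_fun setT
    (fun t : borelType G => complex.Im (twisted_translate s f t)).
  have := measurable_funD (measurable_funM mwr mi') (measurable_funM mwi mr').
  apply: eq_measurable_fun => t _; rewrite /twisted_translate /=.
  by case: (omega _ _) (f _) => [? ?] [? ?].
have key t : complex.Re (twisted_translate s f t) ^+ 2 +
    complex.Im (twisted_translate s f t) ^+ 2 =
    complex.Re (f (s^-1 * t)%g) ^+ 2 + complex.Im (f (s^-1 * t)%g) ^+ 2.
  rewrite /twisted_translate -[RHS]mul1r -(cocycle_sqr t^-1%g s).
  by case: (omega _ _) (f _) => [? ?] [? ?] /=; ring.
split; apply/Lfun2P; split => //.
  apply: le_integrable i' => //.
    by apply/measurable_EFinP; exact: measurable_funX.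
  move=> t _ /=; rewrite lee_fin.
  rewrite !ger0_norm ?addr_ge0 ?sqr_ge0//.
  by rewrite -key lerDl sqr_ge0.
apply: le_integrable i' => //.
  by apply/measurable_EFinP; exact: measurable_funX.
move=> t _ /=; rewrite lee_fin.
rewrite !ger0_norm ?addr_ge0 ?sqr_ge0//.
by rewrite -key lerDr sqr_ge0.
Qed.

Lemma lambdaE s (x : L2 mu) :
  {ae mu, forall t, lambda s x t = twisted_translate s x t}.
Proof. exact/L2_ofK/twisted_translate_L2/L2_valP. Qed.

Lemma lambda_linear s : linear (lambda s).
Proof.
move=> a x y /=; apply: L2_ext; near=> t.
have -> : L2_val (lambda s (a *: x + y)) t = twisted_translate s (L2_val (a *: x + y)) t.
  by near: t; exact: lambdaE.
have -> : L2_val (a *: lambda s x + lambda s y) t = a * lambda s x t + lambda s y t.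
  by near: t; exact: L2_linE.
have -> : lambda s x t = twisted_translate s (L2_val x) t by near: t; exact: lambdaE.
have -> : lambda s y t = twisted_translate s (L2_val y) t by near: t; exact: lambdaE.
rewrite /twisted_translate.
have -> : L2_val (a *: x + y) (s^-1 * t)%g = a * L2_val x (s^-1 * t)%g + L2_val y (s^-1 * t)%g.
  by near: t; exact: (haar_ae_lmul _ (L2_linE a x y)).
by rewrite mulrDr mulrCA.
Unshelve. all: by end_near. Qed.

Lemma lambda_isometry s (x y : L2 mu) : inner (lambda s x) (lambda s y) = inner x y.
Proof.
have xL := L2_valP x; have yL := L2_valP y.
rewrite (L2_innerE (twisted_translate_L2 s xL) (twisted_translate_L2 s yL)
  (lambdaE s x) (lambdaE s y)).
rewrite (L2_innerE xL yL) //; last 2 first.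
- exact: aeW.
- exact: aeW.
have [ir ii] := square_integrable_prod xL yL.
have key t : twisted_translate s x t * (twisted_translate s y t)^* =
    x (s^-1 * t)%g * (y (s^-1 * t)%g)^*.
  rewrite /twisted_translate -[RHS]mul1r.
  have <- : (complex.Re (omega t^-1%g s) ^+ 2 + complex.Im (omega t^-1%g s) ^+ 2)%:C = 1.
    by rewrite cocycle_sqr.
  by case: (omega _ _) (x _) (y _) => [? ?] [? ?] [? ?];
    apply/eqP; rewrite eq_complex /=; apply/andP; split; apply/eqP; ring.
congr (_ +i* _).
  rewrite -(haar_Rintegral_lmul s^-1%g ir).
  by apply: eq_Rintegral => t _; rewrite key.
rewrite -(haar_Rintegral_lmul s^-1%g ii).
by apply: eq_Rintegral => t _; rewrite key.
Qed.

Lemma lambdaM s t (x : L2 mu) :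
  lambda s (lambda t x) = omega s t *: lambda (s * t)%g x.
Proof.
apply: L2_ext; near=> r.
have -> : lambda s (lambda t x) r = twisted_translate s (lambda t x) r.
  by near: r; exact: lambdaE.
have -> : L2_val (omega s t *: lambda (s * t)%g x) r =
    omega s t * lambda (s * t)%g x r by near: r; exact: L2_scaleE.
have -> : lambda (s * t)%g x r = twisted_translate (s * t)%g x r.
  by near: r; exact: lambdaE.
rewrite /twisted_translate.
have -> : lambda t x (s^-1 * r)%g = twisted_translate t x (s^-1 * r)%g.
  by near: r; exact: (haar_ae_lmul _ (lambdaE t x)).
rewrite /twisted_translate !mulrA; congr (_ * x _); last by rewrite invgM mulgA.
by rewrite invgM invgK cocycleE.
Unshelve. all: by end_near. Qed.

Lemma lambda1 (x : L2 mu) : lambda 1%g x = omega 1%g 1%g *: x.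
Proof.
apply: L2_ext; near=> t.
have -> : lambda 1%g x t = twisted_translate 1%g x t by near: t; exact: lambdaE.
have -> : L2_val (omega 1%g 1%g *: x) t = omega 1%g 1%g * x t.
  by near: t; exact: L2_scaleE.
by rewrite /twisted_translate cocyclex1 invg1 mul1g.
Unshelve. all: by end_near. Qed.

End twisted_group_von_neumann_algebra.
Arguments lambda {R G} mu omega s f.
Arguments twisted_vN {R G} mu omega S.

Section twisted_cocycle_action.
Context {R : realType} {G : lcGroupType} {mu : left_haar_measure R G}.
Variables (Delta : modular_function mu) (sigma : modular_section Delta)
  (omega : cocycle2 R G).

Local Notation lambda := (lambda mu omega).
Local Notation K := (modular_image Delta).

Definition modular_kernel : set G := [set s | Delta s = 1].

Local Notation M := (twisted_vN mu omega modular_kernel).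

(* w 1 is the identity, not lambda 1: omega is not assumed normalized, and
   lambda 1 is multiplication by omega 1 1. *)
Definition implementing_unitary (d : K) : L2 mu -> L2 mu :=
  if d == 1%g then id else lambda (sigma d^-1%g)^-1%g.

Local Notation w := implementing_unitary.

Let phase (r : R) (T : L2 mu -> L2 mu) := exists (c : R[i]) (s : G),
  [/\ `|c| = 1, Delta s = r & T = fun x => c *: lambda s x].

Let lambdaZ s c (x : L2 mu) : lambda s (c *: x) = c *: lambda s x.
Proof.
have l0 : lambda s 0 = 0.
  have := @lambda_linear _ _ mu omega s (-1) 0 0.
  by rewrite scaleN1r oppr0 addr0 scaleN1r addNr.
by have := @lambda_linear _ _ mu omega s c x 0; rewrite l0 !addr0.
Qed.

Let phase_comp r q T U : phase r T -> phase q U -> phase (r * q) (T \o U).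
Proof.
move=> [c [s [c1 <- ->]]] [d [t [d1 <- ->]]].
exists (c * d * omega s t), (s * t)%g; split.
- by rewrite !normrM c1 d1 cocycle_norm1 !mulr1.
- exact: modularM.
- by apply/funext => x /=; rewrite lambdaZ lambdaM !scalerA.
Qed.

Let phase_id : phase 1 id.
Proof.
exists (omega 1%g 1%g)^-1, 1%g; split.
- by rewrite normfV cocycle_norm1 invr1.
- exact: modular1.
- by apply/funext => x; rewrite lambda1 scalerA mulVf ?scale1r// cocycle_neq0.
Qed.

Let phase_rinv r T : phase r T -> exists2 U, phase r^-1 U & T \o U = id.
Proof.
move=> [c [s [c1 <- ->]]].
have c0 : c != 0 by rewrite -normr_eq0 c1 oner_neq0.
exists (fun x => (c * omega s s^-1%g * omega 1%g 1%g)^-1 *: lambda s^-1%g x).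
  exists (c * omega s s^-1%g * omega 1%g 1%g)^-1, s^-1%g; split=> //.
    by rewrite normfV !normrM c1 !cocycle_norm1 !mulr1 invr1.
  exact: modularV.
apply/funext => x /=; rewrite lambdaZ lambdaM mulgV lambda1 !scalerA.
rewrite -[RHS]scale1r; congr (_ *: _).
have := cocycle_neq0 omega s s^-1%g; have := cocycle_neq0 omega 1%g 1%g.
by move=> w1 w2; field; rewrite c0 w1 w2.
Qed.

Let phase_inv r T : phase r T ->
  exists U, [/\ phase r^-1 U, T \o U = id & U \o T = id].
Proof.
move=> /phase_rinv[U pU TU]; exists U; split => //.
have [V _ UV] := phase_rinv pU.
suff -> : T = V by [].
apply/funext => x; rewrite -[x in LHS](congr1 (@^~ x) UV).
exact: (congr1 (@^~ (V x)) TU).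
Qed.

Let phaseP r T : phase r T -> [/\ unitary_operator T, bounded_operator T,
  linear T & phase r^-1 (adjoint T)].
Proof.
move=> pT; have [U [pU TU UT]] := phase_inv pT.
have [c [s [c1 _ Te]]] := pT.
have Tl : linear T.
  by move=> a x y; rewrite Te lambda_linear scalerDr !scalerA mulrC.
have [uT aT bT] : [/\ unitary_operator T, adjoint T = U & bounded_operator T].
  apply: unitary_isometry => // x y; rewrite Te.
  have innerZ (a b : R[i]) (u v : L2 mu) :
      inner (a *: u) (b *: v) = a * b^* * inner u v.
    have Zl (e : R[i]) (p q : L2 mu) : inner (e *: p) q = e * inner p q.
      by have := inner_linearl e p 0 q; rewrite !addr0 inner0l addr0.
    by rewrite Zl innerC Zl rmorphM/= -innerC mulrA.
  rewrite innerZ lambda_isometry.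
  suff -> : c * c^* = 1 by rewrite mul1r.
  have := c1; rewrite normc_def => -[] /(congr1 (fun x => x ^+ 2)).
  rewrite sqr_sqrtr ?expr1n ?addr_ge0 ?sqr_ge0// => h.
  by apply/eqP; case: (c) h => a b /= h; rewrite eq_complex /=; apply/andP; split;
    apply/eqP; [rewrite -h; ring | ring].
by rewrite aT.
Qed.

Let phase_in T : phase 1 T -> M T.
Proof.
move=> pT; have [_ bT _ _] := phaseP pT; split=> // U UM.
have [c [s [_ s1 ->]]] := pT; apply/esym/(commutantZ c UM).
by exists s.
Qed.

Let phase_Ad r U T : phase r U -> M T -> M (Ad U T).
Proof.
move=> pU; have [[_ _ UA AU] bU _ pA] := phaseP pU.
have [_ bA _ _] := phaseP pA.
apply: bicommutant_conj => // _ [s s1 <-].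
have pl : phase 1 (lambda s).
  by exists 1, s; split; rewrite ?normr1//; apply/funext => x; rewrite scale1r.
have [c [t [_ tE ->]]] := phase_comp (phase_comp pU pl) pA.
exists c, (lambda t); split=> //; exists t => //.
rewrite /modular_kernel /= tE mulr1 mulfV//.
by have [_ [q [_ <- _]]] := pU; rewrite gt_eqF// modular_gt0.
Qed.

Let phase_w d : phase (val d) (w d).
Proof.
rewrite /w; case: eqP => [->|_]; first exact: phase_id.
exists 1, (sigma d^-1%g)^-1%g; split; first exact: normr1.
  by rewrite modularV msectionK /= invrK.
by apply/funext => x; rewrite scale1r.
Qed.

Let wK d : cancel (adjoint (w d)) (w d).
Proof.
by have [[_ _ h _] _ _ _] := phaseP (phase_w d) => x; exact: (congr1 (@^~ x) h).
Qed.

Let wVK d : cancel (w d) (adjoint (w d)).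
Proof.
by have [[_ _ _ h] _ _ _] := phaseP (phase_w d) => x; exact: (congr1 (@^~ x) h).
Qed.

Let wA d x y : inner (w d x) y = inner x (adjoint (w d) y).
Proof. by have [[_ h _ _] _ _ _] := phaseP (phase_w d); exact: h. Qed.

Let wVA d x y : inner (adjoint (w d) x) y = inner x (w d y).
Proof. by rewrite innerC -wA -innerC. Qed.

Let adjoint_w d : adjoint (adjoint (w d)) = w d.
Proof. by apply: adjointP => x y; exact: wVA. Qed.

Let w1 : w 1%g = id.
Proof. by rewrite /w eqxx. Qed.

Lemma twisted_autP d : star_automorphism M (Ad (w d)).
Proof.
have [_ _ wl _] := phaseP (phase_w d).
split.
- split.
  + by move=> T; exact: phase_Ad (phase_w d).
  + move=> T U _ _ TU; apply/funext => x.
    have := congr1 (fun f => adjoint (w d) (f (w d x))) TU.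
    by rewrite /Ad /= !wVK.
  + move=> T MT; exists (Ad (adjoint (w d)) T).
      have [_ _ _ pA] := phaseP (phase_w d); exact: phase_Ad pA MT.
    by apply/funext => x; rewrite /Ad /= adjoint_w !wK.
- by move=> c T U _ _; apply/funext => x; rewrite /Ad /= wl.
- by move=> T U _ _; apply/funext => x; rewrite /Ad /= wVK.
- by move=> T U _ _ TU x y; rewrite /Ad /= wA TU wVA.
Qed.

Definition implementing_cocycle (d e : K) : L2 mu -> L2 mu :=
  w d \o w e \o adjoint (w (d * e)%g).

Local Notation u := implementing_cocycle.

Let phase_u d e : phase 1 (u d e).
Proof.
have [_ _ _ pA] := phaseP (phase_w (d * e)%g).
have := phase_comp (phase_comp (phase_w d) (phase_w e)) pA.
rewrite /= mulfV// mulf_neq0//.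
  by have [_ [q [_ <- _]]] := phase_w d; rewrite gt_eqF// modular_gt0.
by have [_ [q [_ <- _]]] := phase_w e; rewrite gt_eqF// modular_gt0.
Qed.

Lemma twisted_cocP d e : M (u d e) /\ unitary_operator (u d e).
Proof.
by split; [exact: phase_in|have [] := phaseP (phase_u d e)].
Qed.

Lemma twisted_aut_mul d e T : M T ->
  Ad (w d) (Ad (w e) T) = Ad (u d e) (Ad (w (d * e)%g) T).
Proof.
move=> _; have -> : Ad (u d e) = fun T => u d e \o T \o
    (w (d * e)%g \o adjoint (w e) \o adjoint (w d)).
  rewrite /Ad (@adjointP _ _ _ (w (d * e)%g \o adjoint (w e) \o adjoint (w d)))//.
  by move=> x y; rewrite /u /= !wA wVA.
by apply/funext => x; rewrite /Ad /u /= !wVK.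
Qed.

Lemma twisted_coc_mul d e f :
  u d e \o u (d * e)%g f = Ad (w d) (u e f) \o u d (e * f)%g.
Proof. by apply/funext => x; rewrite /Ad /u /= !wVK mulgA. Qed.

Lemma twisted_coc1r d : u d 1%g = id.
Proof. by apply/funext => x; rewrite /u w1 mulg1 /= wK. Qed.

Lemma twisted_coc1l d : u 1%g d = id.
Proof. by apply/funext => x; rewrite /u w1 mul1g /= wK. Qed.

Definition twisted_cocycle_action : cocycle_action K M :=
  {| ca_aut := fun d => Ad (w d);
     ca_coc := u;
     ca_autP := twisted_autP;
     ca_cocP := twisted_cocP;
     ca_aut_mul := twisted_aut_mul;
     ca_coc_mul := twisted_coc_mul;
     ca_coc1r := twisted_coc1r;
     ca_coc1l := twisted_coc1l |}.

End twisted_cocycle_action.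

(* Main.v *)
(* Let N be the twisted von Neumann algebra of G and M that of the kernel of
   Delta.  Both conditions speak about the same set once one knows that the
   center of N lies in M; let z be a central element of N.
   - z commutes with the left translations (it lies in N') and with the right
     translations (they lie in N'), whence z (f * g) = f * z g = z f * g for the
     twisted convolution.  The trilinear form (f, g, h) -> int f(a) g(b) h(c)
     over abc = 1 is cyclically invariant up to the value of Delta on supp f, so
     moving z around the three slots multiplies the form by the product of the
     three degrees; it vanishes when this product is not 1.  Hence z commutes
     with the projections p_e onto the functions supported on Delta = e.
   - If T commutes with lambda(ker Delta), then p_1 T p_e extends to the operator
     sum_s lambda(s) p_1 T p_e lambda(s)^-1 of N', s running over representatives
     of G / ker Delta; z commutes with it, hence with p_1 T p_e and with T. *)
From HB Require Import structures.
Require Import Defs.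
From mathcomp Require Import all_boot all_order all_algebra.
From mathcomp Require Import ring lra complex.
From mathcomp Require Import all_classical all_reals all_analysis.
From mathcomp Require Import measurable_realfun.

Set Implicit Arguments.
Unset Strict Implicit.
Unset Printing Implicit Defensive.

Import Order.TTheory GRing.Theory Num.Theory.
Import numFieldNormedType.Exports.

Local Open Scope classical_set_scope.
Local Open Scope complex_scope.
Local Open Scope ring_scope.

(** * Real inner products and the Riesz representation *)

(** That the center of N lies in M is classically a fact about the modular automorphisms of the
    Plancherel weight, which fix the center; the cyclic defect of the trilinear form is the KMS
    condition of that weight in elementary terms. The obstacle is convergence. A function z f is
    merely in L^2, and neither convolution nor inversion is bounded on L^2(G). The form is therefore
    tested on functions that are bounded, supported on a set of finite measure and homogeneous for
    Delta: at every rotation one such function in the first or second slot makes the double integral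
    absolutely convergent, and inversion is harmless on a single fiber of Delta. In the second half,
    a sum of all conjugates of T by left translations has no reason to converge. The corners p_1 T
    p_e are taken because their conjugates have pairwise orthogonal domains and pairwise orthogonal
    ranges, so that their sum obeys the same bound as T. The other corners of T come from
    conjugating T itself. Openness of the kernel makes the fibers of Delta open, and second
    countability makes them countably many, which lets null sets be collected fiber by fiber. *)

Section real_inner_product.
Context {R : realType} {H : innerProductType R}.
Implicit Types x y z : H.

(** The real part still separates points and gives the norm, and it turns each pairing into one real
    integral. *)
Definition rinner x y : R := complex.Re (inner x y).

Lemma rinnerC x y : rinner x y = rinner y x.
Proof. by rewrite /rinner innerC; case: (inner y x). Qed.

Lemma rinnerDl x y z : rinner (x + y) z = rinner x z + rinner y z.
Proof. by rewrite -[x]scale1r /rinner inner_linearl mul1r scale1r raddfD. Qed.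

Lemma rinnerDr x y z : rinner x (y + z) = rinner x y + rinner x z.
Proof. by rewrite !(rinnerC x) rinnerDl. Qed.

Lemma rinnerZl (r : R) x y : rinner (r%:C *: x) y = r * rinner x y.
Proof.
have := inner_linearl r%:C x 0 y; rewrite inner0l !addr0 /rinner => ->.
by case: (inner x y) => a b /=; rewrite mul0r subr0.
Qed.

Lemma rinnerZr (r : R) x y : rinner x (r%:C *: y) = r * rinner x y.
Proof. by rewrite rinnerC rinnerZl rinnerC. Qed.

Lemma rinnerNl x y : rinner (- x) y = - rinner x y.
Proof.
by have := rinnerZl (-1) x y; rewrite mulN1r rmorphN1 scaleN1r.
Qed.

Lemma rinnerNr x y : rinner x (- y) = - rinner x y.
Proof. by rewrite rinnerC rinnerNl rinnerC. Qed.

Lemma rinnerBl x y z : rinner (x - y) z = rinner x z - rinner y z.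
Proof. by rewrite rinnerDl rinnerNl. Qed.

Lemma rinnerBr x y z : rinner x (y - z) = rinner x y - rinner x z.
Proof. by rewrite rinnerDr rinnerNr. Qed.

Lemma inner_rinner x : inner x x = (rinner x x)%:C.
Proof.
by rewrite /rinner; have := inner_ge0 x; case: (inner x x) => a b;
  rewrite lecE /= => /andP[/eqP-> _].
Qed.

Lemma rinner_ge0 x : 0 <= rinner x x.
Proof. by have := inner_ge0 x; rewrite inner_rinner lecR. Qed.

Lemma rinner_eq0 x : rinner x x = 0 -> x = 0.
Proof. by move=> x0; apply: inner_eq0; rewrite inner_rinner x0. Qed.

Lemma sqr_inner_norm x : inner_norm x ^+ 2 = rinner x x.
Proof. by rewrite sqr_sqrtr ?rinner_ge0. Qed.

Lemma rinner_young x y (r : R) : 0 < r ->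
  2 * rinner x y <= r * rinner x x + r^-1 * rinner y y.
Proof.
move=> r0; have := rinner_ge0 (r%:C *: x - y).
rewrite rinnerBl !rinnerBr !rinnerZl !rinnerZr (rinnerC y x) => h.
rewrite -(ler_pM2l r0) mulrDr (mulrA r r^-1) mulfV ?gt_eqF// mul1r.
lra.
Qed.

Lemma rinner_cauchy_schwarz x y : rinner x y ^+ 2 <= rinner x x * rinner y y.
Proof.
have [x0|x0] := eqVneq (rinner x x) 0.
  have := rinner_eq0 x0 => ->; rewrite [rinner 0 y](_ : _ = 0) ?expr0n ?mulr_ge0 ?rinner_ge0//.
  by rewrite /rinner inner0l.
have {}x0 : 0 < rinner x x by rewrite lt_neqAle eq_sym x0 rinner_ge0.
have := rinner_ge0 ((rinner x x)%:C *: y - (rinner x y)%:C *: x).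
rewrite rinnerBl !rinnerBr !rinnerZl !rinnerZr (rinnerC y x) => h.
rewrite -subr_ge0 -(pmulr_rge0 _ x0); move: h; rewrite !expr2; lra.
Qed.

Lemma bounded_operatorP (T : H -> H) : bounded_operator T <->
  linear T /\ exists2 C : R, 0 <= C & forall x, rinner (T x) (T x) <= C * rinner x x.
Proof.
split=> [[Tl [C TC]]|[Tl [C C0 TC]]]; split => //.
  exists (C ^+ 2) => [|x]; first exact: sqr_ge0.
  rewrite -!sqr_inner_norm -exprMn lerXn2r ?nnegrE ?sqrtr_ge0//.
  by rewrite (le_trans (sqrtr_ge0 _) (TC x)).
exists (Num.sqrt C) => x; rewrite /inner_norm -sqrtrM//.
by apply: ler_wsqrtr; exact: TC.
Qed.

Lemma linear0_fun (T : H -> H) : linear T -> T 0 = 0.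
Proof. by move=> Tl; have := Tl (-1) 0 0; rewrite scaleN1r oppr0 addr0 scaleN1r addNr. Qed.

Lemma linearZ_fun (T : H -> H) : linear T -> forall c x, T (c *: x) = c *: T x.
Proof. by move=> Tl c x; have := Tl c x 0; rewrite (linear0_fun Tl) !addr0. Qed.

Lemma linearD_fun (T : H -> H) : linear T -> forall x y, T (x + y) = T x + T y.
Proof. by move=> Tl x y; have := Tl 1 x y; rewrite !scale1r. Qed.

Lemma linearB_fun (T : H -> H) : linear T -> forall x y, T (x - y) = T x - T y.
Proof. by move=> Tl x y; rewrite addrC -scaleN1r Tl scaleN1r addrC. Qed.

(** [H] carries no topology here, so Cauchy sequences and limits are expressed by geometric rates
    for squared norms. Steps of size 8^-n leave room for weights 2^n, at the price of the slower
    rate 2^-n for the limit. *)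
Definition complete_inner := forall x : nat -> H,
  (forall n, rinner (x n.+1 - x n) (x n.+1 - x n) <= 8^-1 ^+ n) ->
  exists y, forall n, rinner (x n - y) (x n - y) <= 8 * 2^-1 ^+ n.

(* The maximiser of [phi x - |x|^2 / 2] represents [phi]; a maximising sequence is
   Cauchy by the parallelogram law. *)
Lemma riesz_representation (phi : H -> R) (C : R) : complete_inner ->
  {morph phi : x y / x + y} -> (forall (r : R) x, phi (r%:C *: x) = r * phi x) ->
  0 <= C -> (forall x, phi x ^+ 2 <= C * rinner x x) ->
  exists y, forall x, phi x = rinner x y.
Proof.
move=> cH phiD phiZ C0 phiC.
have phiN x : phi (- x) = - phi x.
  by have := phiZ (-1) x; rewrite mulN1r rmorphN1 scaleN1r.
pose J x := phi x - rinner x x / 2.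
have JC x : J x <= C / 2.
  rewrite /J; have /= := phiC x; have := rinner_ge0 x; set n := rinner x x; set p := phi x.
  move=> n0 pn; suff : p <= (C + n) / 2 by lra.
  rewrite (le_trans (ler_norm p))// -ler_sqr ?nnegrE ?divr_ge0 ?addr_ge0//.
  rewrite real_normK ?num_real// (le_trans pn)//.
  by have := sqr_ge0 (C - n); rewrite expr_div_n sqrrB sqrrD; lra.
have Jsup : has_sup (range J).
  by split; [exists (J 0), 0|exists (C / 2) => _ [x _ <-]].
set s := sup (range J).
have Js x : J x <= s by apply: ub_le_sup; [exact: Jsup.2|exists x].
(* The exponent is shifted by one so that the factor 4 in [par], applied to two consecutive terms,
   still gives steps below 8^-n. *)
have /choice[x_ Jx] : forall n, exists x, s - 8^-1 ^+ n.+1 < J x.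
  move=> n; have e0 : 0 < (8^-1 : R) ^+ n.+1 by rewrite exprn_gt0.
  by have [_ [x _ <-] ?] := sup_adherent e0 Jsup; exists x.
have par x y : rinner (x - y) (x - y) <= 4 * (2 * s - J x - J y).
  have := Js (2^-1%:C *: (x + y)).
  rewrite /J phiZ phiD rinnerZl rinnerZr rinnerBl !rinnerBr rinnerDl !rinnerDr (rinnerC y x).
  lra.
have [n|y xy] := cH x_.
  apply: le_trans (par _ _) _; have := Jx n; have := Jx n.+1.
  rewrite !exprS; set e := 8^-1 ^+ n.
  have : 0 <= e by rewrite exprn_ge0.
  lra.
exists y => h.
(* A linear term dominated by a quadratic one for every [r] vanishes. The value of [r] used below
   has [n + 1] in its denominator because [h] may be zero. *)
suff key (r : R) : r * (phi h - rinner h y) <= r ^+ 2 * rinner h h.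
  set d := phi h - rinner h y in key; set n := rinner h h in key.
  apply/eqP; rewrite -subr_eq0 -/d; apply/eqP.
  have n0 : 0 <= n by exact: rinner_ge0.
  have k1 := key (d / (2 * (n + 1))).
  have n1 : n + 1 > 0 by rewrite ltr_wpDl.
  have : d ^+ 2 <= 0.
    have : d ^+ 2 / (2 * (n + 1)) <= d ^+ 2 / (2 * (n + 1)) * (n / (2 * (n + 1))).
      have -> : d ^+ 2 / (2 * (n + 1)) * (n / (2 * (n + 1))) = (d / (2 * (n + 1))) ^+ 2 * n.
        by field; rewrite gt_eqF.
      by rewrite (_ : d ^+ 2 / (2 * (n + 1)) = d / (2 * (n + 1)) * d)// expr2 mulrAC.
    set q := d ^+ 2 / (2 * (n + 1)) => hq.
    have q0 : 0 <= q by rewrite divr_ge0 ?sqr_ge0// mulr_ge0// ltW.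
    have : n / (2 * (n + 1)) <= 2^-1.
      rewrite ler_pdivrMr ?mulr_gt0//; lra.
    move=> hn; have : q <= 0 by nra.
    by rewrite /q pmulr_lle0// invr_gt0 mulr_gt0.
  by rewrite real_exprn_even_le0 ?num_real//= => /eqP.
(* The comparison with the supremum is made at [x_ n] instead of the limit [y]. The error 5 is 4,
   half the bound 8 on the squared distance from [x_ n] to [y], plus 1 for the defect of
   [J (x_ n)]. *)
have step n : r * (phi h - rinner h y) <= r ^+ 2 * rinner h h + 5 * 2^-1 ^+ n.
  have e2 : 8^-1 ^+ n.+1 <= (2^-1 : R) ^+ n.
    have e8 : (8^-1 : R) ^+ n <= 2^-1 ^+ n by apply: lerXn2r; rewrite ?nnegrE//; lra.
    have : 0 <= (8^-1 : R) ^+ n by rewrite exprn_ge0.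
    rewrite exprS; lra.
  have := lt_le_trans (Jx n) (Js _); have := Js (x_ n + r%:C *: h).
  have := Jx n; rewrite /J phiD phiZ rinnerDl !rinnerDr !rinnerZl !rinnerZr.
  have := rinner_young (x_ n - y) (r%:C *: h) ltr01; have := xy n.
  rewrite invr1 !rinnerBl !rinnerBr !rinnerZr rinnerZl (rinnerC y) (rinnerC h (x_ n)) (rinnerC h
    y).
  move: e2; set e := 8^-1 ^+ _; set e' := 2^-1 ^+ _.
  have : 0 <= e' by exact: exprn_ge0.
  rewrite !mul1r expr2 => *; lra.
rewrite -subr_le0 leNgt; apply/negP => d0.
have [n _ /(_ n (leqnn n))] := near_infty_natSinv_expn_lt (PosNum (divr_gt0 d0 (ltr0n _ 5))).
rewrite /= ltNge => /negP; apply; have := step n; rewrite div1r exprVn.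
lra.
Qed.
End real_inner_product.

(** * Completeness of L^2 *)

Definition sqmod {R : realType} (z : R[i]) : R := complex.Re z ^+ 2 + complex.Im z ^+ 2.

Lemma sqmod_ge0 {R : realType} (z : R[i]) : 0 <= sqmod z.
Proof. by rewrite addr_ge0 ?sqr_ge0. Qed.

Lemma sqmodM {R : realType} (z w : R[i]) : sqmod (z * w) = sqmod z * sqmod w.
Proof. by case: z w => [a b] [c d]; rewrite /sqmod /=; ring. Qed.

Lemma sqmod_conj {R : realType} (z : R[i]) : sqmod z^* = sqmod z.
Proof. by case: z => a b; rewrite /sqmod /= sqrrN. Qed.

Lemma Re_mul_conj {R : realType} (z : R[i]) : complex.Re (z * z^*) = sqmod z.
Proof. by case: z => a b; rewrite /sqmod /=; ring. Qed.

Lemma sqmod_eq0 {R : realType} (z : R[i]) : sqmod z = 0 -> z = 0.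
Proof.
case: z => a b /eqP; rewrite paddr_eq0 ?sqr_ge0// !sqrf_eq0 /=.
by move=> /andP[/eqP -> /eqP ->].
Qed.

Lemma normr_Re_mul {R : realType} (z w : R[i]) : `|complex.Re (z * w)| <= sqmod z + sqmod w.
Proof.
case: z w => [a b] [c d]; rewrite /sqmod /= ler_norml.
have := sqr_ge0 (a - c); have := sqr_ge0 (b - d); have := sqr_ge0 (a + c);
  have := sqr_ge0 (b + d).
have := sqr_ge0 a; have := sqr_ge0 b; have := sqr_ge0 c; have := sqr_ge0 d.
rewrite !expr2 => *; apply/andP; split; lra.
Qed.

(* The weights [2 ^ k] make Minkowski's inequality unnecessary in the completeness of L^2. *)
Lemma weighted_steps_cvg {R : realType} (u : nat -> R) (g : R) :
  (forall N, \sum_(0 <= k < N) 2 ^+ k * (u k.+1 - u k) ^+ 2 <= g) ->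
  cvgn u /\ forall n, (u n - limn u) ^+ 2 <= 2 * 2^-1 ^+ n * g.
Proof.
move=> ug.
(* Induction on the number of steps: the factor 2 lost in splitting the square of a sum is regained
   exactly by passing from 2^-(n+1) to 2^-n. *)
have tail p n : (u (n + p)%N - u n) ^+ 2 <=
    2 * 2^-1 ^+ n * \sum_(n <= k < n + p) 2 ^+ k * (u k.+1 - u k) ^+ 2.
  elim: p n => [|p IH] n; first by rewrite addn0 subrr big_geq// mulr0 expr0n.
  rewrite big_ltn; last by rewrite addnS ltnS leq_addr.
  have := IH n.+1; rewrite addSnnS; set S := \sum_(_ <= _ < _) _.
  set a := u (n + p.+1)%N; set b := u n.+1; set c := u n => h.
  have : (a - c) ^+ 2 <= 2 * (b - c) ^+ 2 + 2 * (a - b) ^+ 2.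
    by have := sqr_ge0 ((a - b) - (b - c)); rewrite -subr_ge0 => hh; rewrite -subr_ge0;
      move: hh; rewrite !expr2; lra.
  have e : (2^-1 : R) ^+ n * 2 ^+ n = 1 by rewrite -exprMn mulVf// expr1n.
  have -> : 2 * 2^-1 ^+ n * (2 ^+ n * (b - c) ^+ 2 + S) =
     2 * (2^-1 ^+ n * 2 ^+ n) * (b - c) ^+ 2 + 2 * (2 * 2^-1 ^+ n.+1 * S).
    by rewrite (exprS 2^-1 n); move: (2^-1 ^+ n) (2 ^+ n) => i t; field.
  rewrite e; lra.
have g0 : 0 <= g by have := ug 0%N; rewrite big_geq.
have bound p n : (u (n + p)%N - u n) ^+ 2 <= 2 * 2^-1 ^+ n * g.
  rewrite (le_trans (tail p n))// ler_wpM2l ?mulr_ge0 ?exprn_ge0//.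
  rewrite (le_trans _ (ug (n + p)%N))// [leRHS](@big_cat_nat _ _ _ n)//= ?leq_addr//.
  by rewrite lerDr sumr_ge0// => k _; rewrite mulr_ge0 ?sqr_ge0 ?exprn_ge0.
have small (e : R) : 0 < e -> exists n, 2 * 2^-1 ^+ n * g < e.
  move=> e0; have d0 : 0 < e / (2 * (g + 1)) by rewrite divr_gt0// mulr_gt0// ltr_wpDl.
  have [n _ /(_ n (leqnn n))] := near_infty_natSinv_expn_lt (PosNum d0).
  rewrite /= div1r -exprVn ltr_pdivlMr ?mulr_gt0 ?ltr_wpDl// => h; exists n.
  apply: le_lt_trans h; have : 0 <= (2^-1 : R) ^+ n by exact: exprn_ge0.
  set q := 2^-1 ^+ n; nra.
have cu : cvgn u.
  apply/cauchy_cvgP/cauchy_exP => e e0.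
  have [n nh] := small _ (exprn_gt0 2 e0).
  exists (u n); exists n => // m /= nm; rewrite -ball_normE /= distrC.
  rewrite -[ltRHS]ger0_norm ?ltW// -ltr_sqr ?nnegrE// !real_normK ?num_real//.
  by rewrite (le_lt_trans _ nh)// -(subnKC nm).
split=> // n.
have lim : (fun m => (u (n + m)%N - u n) ^+ 2) @ \oo --> (limn u - u n) ^+ 2.
  have c : (fun m => u (n + m)%N - u n) @ \oo --> limn u - u n.
    apply: cvgB; last exact: cvg_cst.
    by under eq_fun do rewrite addnC; apply: (cvg_comp _ _ (@cvg_addnr n) cu).
  by under eq_fun do rewrite expr2; rewrite expr2; exact: cvgM.
rewrite -opprB sqrrN -(cvg_lim _ lim)//; apply: limr_le; first by apply/cvg_ex;
  exists ((limn u - u n) ^+ 2).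
by near=> m; exact: bound.
Unshelve. all: by end_near. Qed.

Section L2_theory.
Context d (T : measurableType d) (R : realType) (mu : {measure set T -> \bar R}).
Implicit Types (f g : T -> R[i]) (x y : L2 mu).

Definition cmeasurable f := measurable_fun setT (fun t => complex.Re (f t)) /\
  measurable_fun setT (fun t => complex.Im (f t)).

Lemma cmeasurableM f g : cmeasurable f -> cmeasurable g -> cmeasurable (fun t => f t * g t).
Proof.
move=> [fr fi] [gr gi]; split.
- apply: eq_measurable_fun (measurable_funB (measurable_funM fr gr) (measurable_funM fi gi)).
  by move=> t _ /=; case: (f t) (g t) => ? ? [].
- apply: eq_measurable_fun (measurable_funD (measurable_funM fr gi) (measurable_funM fi gr)).
  by move=> t _ /=; case: (f t) (g t) => ? ? [].
Qed.

Lemma cmeasurable_conj f : cmeasurable f -> cmeasurable (fun t => (f t)^*).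
Proof.
move=> [fr fi]; split.
- by apply: eq_measurable_fun fr => t _ /=; case: (f t).
- by apply: eq_measurable_fun (measurable_funN fi) => t _ /=; case: (f t).
Qed.

Lemma cmeasurable_cst (c : R[i]) : cmeasurable (fun=> c).
Proof. by split; exact: measurable_cst. Qed.

Lemma cmeasurable_indic (A : set T) : measurable A -> cmeasurable (fun t => (\1_A t)%:C).
Proof. by move=> mA; split; [exact: measurable_indic|exact: measurable_cst]. Qed.

Lemma cmeasurable_sqmod f : cmeasurable f -> measurable_fun setT (fun t => sqmod (f t)).
Proof. by move=> [fr fi]; apply: measurable_funD; exact: measurable_funX. Qed.

Lemma square_integrableP f : square_integrable mu f <->
  cmeasurable f /\ (\int[mu]_t (sqmod (f t))%:E < +oo)%E.
Proof.
split=> [[/Lfun2P[mr ir] /Lfun2P[mi ii]]|[mf fi]].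
  split=> //; have /integrableP[_] := integrableD measurableT ir ii.
  apply: le_lt_trans; rewrite le_eqVlt; apply/orP; left; apply/eqP.
  by apply: eq_integral => t _ /=; rewrite ger0_norm ?sqmod_ge0.
have iq : mu.-integrable setT (fun t => (sqmod (f t))%:E).
  apply/integrableP; split; first exact/measurable_EFinP/cmeasurable_sqmod.
  apply: le_lt_trans fi; rewrite le_eqVlt; apply/orP; left; apply/eqP.
  by apply: eq_integral => t _ /=; rewrite ger0_norm ?sqmod_ge0.
split; apply/Lfun2P; split; [exact: mf.1| |exact: mf.2|].
  apply: le_integrable iq => //.
    by apply/measurable_EFinP/measurable_funX; exact: mf.1.
  by move=> t _ /=; rewrite lee_fin !ger0_norm ?sqmod_ge0 ?sqr_ge0// lerDl sqr_ge0.
apply: le_integrable iq => //.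
  by apply/measurable_EFinP/measurable_funX; exact: mf.2.
by move=> t _ /=; rewrite lee_fin !ger0_norm ?sqmod_ge0 ?sqr_ge0// lerDr sqr_ge0.
Qed.

Lemma square_integrable_norm f : square_integrable mu f ->
  exists2 N : R, 0 <= N & (\int[mu]_t (sqmod (f t))%:E = N%:E)%E.
Proof.
move=> /square_integrableP[_ fi].
have f0 : (0 <= \int[mu]_t (sqmod (f t))%:E)%E.
  by apply: integral_ge0 => t _; rewrite lee_fin sqmod_ge0.
exists (fine (\int[mu]_t (sqmod (f t))%:E)); first exact: fine_ge0.
by rewrite fineK// ge0_fin_numE.
Qed.

Lemma rinner_L2E f g x y : square_integrable mu f -> square_integrable mu g ->
  {ae mu, forall t, x t = f t} -> {ae mu, forall t, y t = g t} ->
  ((rinner x y)%:E = \int[mu]_t (complex.Re (f t * (g t)^*))%:E)%E.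
Proof.
move=> fL gL xf yg; rewrite /rinner (L2_innerE fL gL xf yg) /= /Rintegral fineK//.
by apply: (integrable_fin_num measurableT); exact: (square_integrable_prod fL gL).1.
Qed.

Lemma rinner_sqmod f x : square_integrable mu f -> {ae mu, forall t, x t = f t} ->
  ((rinner x x)%:E = \int[mu]_t (sqmod (f t))%:E)%E.
Proof.
move=> fL xf; rewrite (rinner_L2E fL fL xf xf).
by apply: eq_integral => t _; rewrite Re_mul_conj.
Qed.

Lemma L2_BE x y : {ae mu, forall t, L2_val (x - y) t = x t - y t}.
Proof.
have := L2_linE (-1) y x; rewrite scaleN1r addrC.
by apply: filterS => t ->; rewrite mulN1r addrC.
Qed.

Lemma cmeasurable_L2 x : cmeasurable x.
Proof. by have /square_integrableP[] := L2_valP x. Qed.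

Lemma square_integrableB f g : square_integrable mu f -> square_integrable mu g ->
  square_integrable mu (fun t => f t - g t).
Proof.
move=> fL gL; have := square_integrable_lin (-1) gL fL.
by congr square_integrable; apply/funext => t; rewrite mulN1r addrC.
Qed.

(** The weighted sum [G] of the squared steps has integral at most 2, hence is finite almost
    everywhere. At such points [weighted_steps_cvg] gives a limit together with a bound by a
    multiple of [G t]; integrating this bound gives the rate in norm. *)
Lemma L2_complete : @complete_inner R (L2 mu).
Proof.
rewrite /complete_inner => x'; pose x : nat -> L2 mu := x'; rewrite -/x => x8.
suff : exists y : L2 mu, forall n, rinner (x n - y) (x n - y) <= 8 * 2^-1 ^+ n by [].
pose q n t := 2 ^+ n * sqmod (x n.+1 t - x n t).
have dL n : square_integrable mu (fun t => x n.+1 t - x n t).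
  by apply: square_integrableB; exact: L2_valP.
have mq n : measurable_fun setT (fun t => (q n t)%:E).
  apply/measurable_EFinP; apply: measurable_funM; first exact: measurable_cst.
  by apply: cmeasurable_sqmod; have /square_integrableP[] := dL n.
have q0 n t : (0 <= (q n t)%:E)%E by rewrite lee_fin mulr_ge0 ?exprn_ge0 ?sqmod_ge0.
pose G t := (\sum_(n <oo) (q n t)%:E)%E.
have mG : measurable_fun setT G by apply: ge0_emeasurable_sum.
have G0 t : (0 <= G t)%E by exact: nneseries_ge0.
have iG : (\int[mu]_t G t <= 2%:E)%E.
  rewrite integral_nneseries//.
  apply: le_trans (epsilon_trick0 (fun=> true) (ler0n R 2)).
  apply: lee_nneseries => n _; first by move=> _; exact: integral_ge0.
  under eq_integral => t _ do rewrite /q EFinM.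
  rewrite ge0_integralZl_EFin ?exprn_ge0//; last 2 first.
  - by move=> t _; rewrite lee_fin sqmod_ge0.
  - by apply/measurable_EFinP/cmeasurable_sqmod; have /square_integrableP[] := dL n.
  rewrite -(rinner_sqmod (dL n) (L2_BE _ _)) -EFinM lee_fin.
  rewrite (le_trans (ler_wpM2l _ (x8 n))) ?exprn_ge0// -exprMn.
  have -> : (2 : R) / (2 ^ n.+1)%:R = 2^-1 ^+ n.
    by rewrite natrX exprS invfM mulrA mulfV// mul1r exprVn.
  by apply: lerXn2r; rewrite ?nnegrE//; lra.
have [N [mN N0 GN]] : {ae mu, forall t, G t \is a fin_num}.
  have Gi : mu.-integrable setT G.
    apply/integrableP; split=> //.
    apply: le_lt_trans (le_lt_trans iG (ltry _)).
    by under eq_integral do rewrite gee0_abs//.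
  by apply: filterS (integrable_ae measurableT Gi) => t; exact.
have Gfin t : (~` N) t -> G t = (fine (G t))%:E.
  by move=> nN; rewrite fineK//; apply: contrapT => h; apply: nN; exact: GN.
(* Replacing the sequence by 0 on the null set [N] makes it converge everywhere, so that its limit
   is measurable on the whole space. *)
pose cut (v : T -> R) t := \1_(~` N) t * v t.
have mcut v : measurable_fun setT v -> measurable_fun setT (cut v).
  by move=> mv; apply: measurable_funM => //; apply: measurable_indic; exact: measurableC.
have part (p : R[i] -> R) : (forall z, p z ^+ 2 <= sqmod z) ->
    (forall z w, p (z - w) = p z - p w) ->
    (forall n, measurable_fun setT (fun t => p (x n t))) ->
    exists y : T -> R, measurable_fun setT y /\ forall t, (~` N) t -> forall n,
      (p (x n t) - y t) ^+ 2 <= 2 * 2^-1 ^+ n * fine (G t).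
  move=> pq pB mp.
  have st t : (~` N) t ->
      forall K, \sum_(0 <= k < K) 2 ^+ k * (p (x k.+1 t) - p (x k t)) ^+ 2 <= fine (G t).
    move=> /Gfin Gt K; rewrite -lee_fin -Gt -sumEFin.
    apply: le_trans (nneseries_lim_ge (m := 0) K _) => [|n _ _]; last exact: q0.
    apply: lee_sum => k _; rewrite lee_fin ler_wpM2l ?exprn_ge0// -pB//.
  pose c t n := cut (fun t => p (x n t)) t.
  have cE t : (~` N) t -> c t = fun n => p (x n t).
    by move=> nNt; apply/funext => n; rewrite /c /cut indicE mem_set// mul1r.
  exists (fun t => limn (c t)); split.
    apply: (measurable_fun_cvg (h := fun n => c ^~ n)) => [m|t _]; first exact: mcut.
    rewrite -/(c t); have [Nt|nNt] := pselect (N t).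
      have -> : c t = fun=> 0.
        by apply/funext => n; rewrite /c /cut indicE memNset ?mul0r//; move=> /(_ Nt).
      by rewrite lim_cst//; exact: cvg_cst.
    by rewrite (cE t nNt); have [] := weighted_steps_cvg (st t nNt).
  by move=> t nNt n; rewrite (cE t nNt); have [_ /(_ n)] := weighted_steps_cvg (st t nNt).
have [yr [myr yrP]] : exists y : T -> R, measurable_fun setT y /\ forall t, (~` N) t -> forall n,
      (complex.Re (x n t) - y t) ^+ 2 <= 2 * 2^-1 ^+ n * fine (G t).
  apply: part => [z|z w|n].
  - by rewrite lerDl sqr_ge0.
  - exact: raddfB.
  - by have [] := cmeasurable_L2 (x n).
have [yi [myi yiP]] : exists y : T -> R, measurable_fun setT y /\ forall t, (~` N) t -> forall n,
      (complex.Im (x n t) - y t) ^+ 2 <= 2 * 2^-1 ^+ n * fine (G t).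
  apply: part => [z|z w|n].
  - by rewrite lerDr sqr_ge0.
  - exact: raddfB.
  - by have [] := cmeasurable_L2 (x n).
pose y t : R[i] := yr t +i* yi t.
have my : cmeasurable y by [].
(* The 4 adds the bounds for the real and the imaginary part, and the final 2 bounds the integral of
   [G]. *)
have xyL n : square_integrable mu (fun t => x n t - y t) /\
    (\int[mu]_t (sqmod (x n t - y t))%:E <= (4 * 2^-1 ^+ n * 2)%:E)%E.
  have cxy : cmeasurable (fun t => x n t - y t).
    have [mr mi] := cmeasurable_L2 (x n); split.
      by apply: eq_measurable_fun (measurable_funB mr myr) => t _ /=; case: (x n t).
    by apply: eq_measurable_fun (measurable_funB mi myi) => t _ /=; case: (x n t).
  suff h : (\int[mu]_t (sqmod (x n t - y t))%:E <= (4 * 2^-1 ^+ n * 2)%:E)%E.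
    by split=> //; apply/square_integrableP; split=> //; exact: le_lt_trans h (ltry _).
  apply: (@le_trans _ _ (\int[mu]_t ((4 * 2^-1 ^+ n)%:E * G t))%E).
    apply: ae_ge0_le_integral => //.
    - by move=> t _; rewrite lee_fin sqmod_ge0.
    - exact/measurable_EFinP/cmeasurable_sqmod.
    - by move=> t _; rewrite mule_ge0 ?lee_fin// mulr_ge0 ?exprn_ge0.
    - exact: measurable_funeM.
    exists N; split=> // t /= nle; apply: contrapT => nN; apply: nle => _.
    rewrite (Gfin t nN) -EFinM lee_fin; have := yrP t nN n; have := yiP t nN n.
    rewrite /sqmod /y; case: (x n t) => a b /=; lra.
  rewrite ge0_integralZl_EFin// ?mulr_ge0 ?exprn_ge0// [leRHS]EFinM.
  by rewrite lee_pmul2l ?lte_fin ?mulr_gt0 ?exprn_gt0.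
have [x0y _] := xyL 0%N.
have yL : square_integrable mu y.
  have := square_integrableB (L2_valP (x 0%N)) x0y.
  by congr square_integrable; apply/funext => t; rewrite opprB addrC subrK.
exists (L2_of mu y) => n; rewrite -lee_fin.
rewrite (rinner_sqmod (xyL n).1); last first.
  by apply: filterS2 (L2_BE (x n) (L2_of mu y)) (L2_ofK yL) => t -> ->.
apply: le_trans (xyL n).2 _; rewrite lee_fin; lra.
Qed.

Lemma L2_riesz (phi : L2 mu -> R) (C : R) :
  {morph phi : x y / x + y} -> (forall (r : R) x, phi (r%:C *: x) = r * phi x) ->
  0 <= C -> (forall x, phi x ^+ 2 <= C * rinner x x) ->
  exists y, forall x, phi x = rinner x y.
Proof. exact: riesz_representation L2_complete. Qed.

(** Riesz representation of the functional that pairs [U x] with a fixed [y], bounded by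
    Cauchy-Schwarz. *)
Lemma L2_adjoint (U : L2 mu -> L2 mu) : bounded_operator U ->
  exists V : L2 mu -> L2 mu, forall x y, rinner (U x) y = rinner x (V y).
Proof.
move=> /bounded_operatorP[Ul [C C0 UC]].
suff /choice[V VP] : forall y, exists z, forall x, rinner (U x) y = rinner x z by exists V => x y.
move=> y; have y0 := rinner_ge0 y.
apply: (@L2_riesz (fun x => rinner (U x) y) (C * rinner y y)).
- by move=> x x'; rewrite (linearD_fun Ul) rinnerDl.
- by move=> r x; rewrite (linearZ_fun Ul) rinnerZl.
- exact: mulr_ge0.
move=> x; rewrite mulrAC (le_trans (rinner_cauchy_schwarz _ _))// ler_wpM2r//.
Qed.

End L2_theory.

(** * Integration on the square of a measure space and on the group *)

Lemma ae_imply2 d (T : measurableType d) (R : realType) (mu : {measure set T -> \bar R})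
  (P Q S : T -> Prop) : {ae mu, forall t, P t} -> {ae mu, forall t, Q t} ->
  (forall t, P t -> Q t -> S t) -> {ae mu, forall t, S t}.
Proof. by move=> + + PQS; exact: filterS2. Qed.

Section sigma_finite_square.
Context d (T : measurableType d) (R : realType) (mu : {measure set T -> \bar R})
  (smu : sigma_finite setT mu).

(** An alias on which the sigma-finite structure is declared from [smu]: for a Haar measure
    sigma-finiteness is a theorem, not part of its structure, while Fubini expects the structure. *)
Let m0 : set T -> \bar R := mu.
HB.instance Definition _ := Measure.on m0.
Let smu0 : sigma_finite setT m0. Proof. exact: smu. Qed.
HB.instance Definition _ := Measure_isSigmaFinite.Build _ _ _ m0 smu0.
Let m : {sigma_finite_measure set T -> \bar R} := m0.

Lemma tonelli_sf (f : T * T -> \bar R) : measurable_fun setT f -> (forall z, 0 <= f z)%E ->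
  (\int[mu]_x \int[mu]_y f (x, y) = \int[mu]_y \int[mu]_x f (x, y))%E.
Proof. by move=> mf f0; exact: (@fubini_tonelli _ _ _ _ _ m m f mf f0). Qed.

Lemma fubini_sf (f : T * T -> \bar R) : measurable_fun setT f ->
  (\int[mu]_x \int[mu]_y `|f (x, y)| < +oo)%E ->
  (\int[mu]_x \int[mu]_y f (x, y) = \int[mu]_y \int[mu]_x f (x, y))%E.
Proof.
by move=> mf fi; apply: (@Fubini _ _ _ _ _ m m f); exact/(integrable12ltyP _ _ mf).
Qed.

Lemma fubini_sf_fin_num (f : T * T -> \bar R) : measurable_fun setT f ->
  (\int[mu]_x \int[mu]_y `|f (x, y)| < +oo)%E ->
  (\int[mu]_x \int[mu]_y f (x, y))%E \is a fin_num.
Proof.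
move=> mf /(integrable12ltyP m m mf) fi.
have := @integral12_prod_meas1 _ _ _ _ _ m m f fi; rewrite /fubini_F => ->.
exact: (integrable_fin_num measurableT fi).
Qed.

Lemma integrable_fubini_sf (f : T * T -> \bar R) : measurable_fun setT f ->
  (\int[mu]_x \int[mu]_y `|f (x, y)| < +oo)%E ->
  mu.-integrable setT (fun x => \int[mu]_y f (x, y))%E.
Proof.
by move=> mf /(integrable12ltyP m m mf) fi; exact: (@integrable_fubini_F _ _ _ _ _ m m f fi).
Qed.

Lemma measurable_tonelli_sf (f : T * T -> \bar R) : measurable_fun setT f -> (forall z, 0 <= f
  z)%E ->
  measurable_fun setT (fun x => \int[mu]_y f (x, y))%E.
Proof. by move=> mf f0; exact: (@measurable_fun_fubini_tonelli_F _ _ _ _ _ m f mf f0). Qed.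

(** Rectangles are stable under intersection and generate the product sigma-algebra, so by Dynkin's
    argument the integral of [f] vanishes on all measurable sets and [f] is zero almost everywhere
    for the product measure. Tonelli for [|f|] gives the iterated form. *)
Lemma rectangle_integral0_ae (f : T * T -> R) : measurable_fun setT f ->
  (\int[mu]_x \int[mu]_y (`|f (x, y)|%:E) < +oo)%E ->
  (forall A B : set T, measurable A -> measurable B ->
    \int[mu]_x \int[mu]_y (\1_A x * \1_B y * f (x, y))%:E = 0)%E ->
  {ae mu, forall x, {ae mu, forall y, f (x, y) = 0}}.
Proof.
move=> mf fi f0.
have mf' : measurable_fun setT (EFin \o f) by exact/measurable_EFinP.
have intf : (m \x m)%E.-integrable setT (EFin \o f) by exact/(integrable12ltyP _ _ mf').
have cut (X : set (T * T)) : measurable X ->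
    (\int[m \x m]_(z in X) (f z)%:E = \int[m \x m]_z (\1_X z * f z)%:E)%E.
  move=> mX; rewrite integral_mkcond; apply: eq_integral => z _.
  by rewrite patchE indicE; case: (z \in X); rewrite ?mul1r ?mul0r.
have intX (X : set (T * T)) : measurable X -> (m \x m)%E.-integrable X (EFin \o f).
  by move=> mX; apply: (integrableS measurableT).
have T0 : (\int[m \x m]_z (f z)%:E = 0)%E.
  have := f0 _ _ measurableT measurableT.
  rewrite -(@integral12_prod_meas1 _ _ _ _ _ m m (EFin \o f) intf) => h.
  rewrite -[RHS]h; apply: eq_integral => x _; rewrite /fubini_F.
  by apply: eq_integral => y _; rewrite !indicT !mul1r.
have zero (X : set (T * T)) : measurable X -> (\int[m \x m]_(z in X) (f z)%:E = 0)%E.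
  have gE := measurable_prod_measurableType T T; rewrite gE.
  apply: (@dynkin_induction _ (T * T)%type _
    [set X | (\int[m \x m]_(z in X) (f z)%:E = 0)%E] gE) => /=.
  - move=> _ _ [A1 mA1 [A2 mA2 <-]] [B1 mB1 [B2 mB2 <-]].
    exists (A1 `&` B1); first exact: measurableI.
    exists (A2 `&` B2); first exact: measurableI.
    by rewrite setXI.
  - exact: T0.
  - move=> _ [A mA [B mB <-]]; have mAB : measurable (A `*` B) by exact: measurableX.
    rewrite /= (cut _ mAB) -(f0 A B mA mB).
    rewrite -(@integral12_prod_meas1 _ _ _ _ _ m m (fun z => (\1_(A `*` B) z * f z)%:E));
      last first.
      have := intX _ mAB; rewrite integrable_mkcond//; apply: eq_integrable => // z _.
      by rewrite patchE indicE; case: (z \in _) => /=; rewrite ?mul1r ?mul0r.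
    apply: eq_integral => x _; apply: eq_integral => y _ /=.
    by rewrite !indicE in_setX; case: (x \in A); case: (y \in B);
      rewrite /= ?(mul1r, mul0r, mulr0).
  - move=> Y mY Y0; have := T0; rewrite -(setUv Y) integral_setU//; last 3 first.
    + exact: measurableC.
    + by rewrite setUv.
    + by rewrite disj_set2E setICr.
    by rewrite Y0 add0e.
  - move=> F mF tF F0; rewrite integral_bigcup//; last first.
      by apply: intX; exact: bigcup_measurable.
    by rewrite eseries0// => n _ _; exact: F0.
have fz : ae_eq (m \x m)%E setT (EFin \o f) (cst 0%E).
  apply: integral_ae_eq => // E _ mE; rewrite zero// integral0//.
have : (\int[m \x m]_z `|(EFin \o f) z| = 0)%E.
  by apply/ae_eq_integral_abs.
rewrite (fubini_tonelli1 (fun z => `|(EFin \o f) z|)%E)//; last exact: measurableT_comp.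
rewrite /fubini_F => h.
have mF : measurable_fun setT (fun x => \int[m]_y `|(EFin \o f) (x, y)|)%E.
  by apply: (measurable_tonelli_sf (f := fun z => `|(EFin \o f) z|%E)) => //;
    exact: measurableT_comp.
have /(ae_eq_integral_abs _ measurableT mF) : (\int[m]_x `| \int[m]_y `|(EFin \o f) (x, y)| | =
  0)%E.
  by rewrite -[RHS]h; apply: eq_integral => x _; rewrite gee0_abs// integral_ge0.
apply: filterS => x /(_ I) /= fx.
have mfx : measurable_fun setT (fun y => (f (x, y))%:E).
  exact: (measurable_fun_pair2 (f := EFin \o f)).
have /(ae_eq_integral_abs _ measurableT mfx) := fx.
by apply: filterS => y /(_ I) [].
Qed.
End sigma_finite_square.

(** The base comes with an injection into nat. The union over the fiber of an index [n] is the base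
    set numbered [n], or the empty set when [n] is not a number in use. *)
Lemma second_countable_enum (X : topologicalType) : @second_countable X ->
  exists U : nat -> set X, (forall n, open (U n)) /\
    forall x W, nbhs x W -> exists n, U n x /\ U n `<=` W.
Proof.
move=> [B /countable_injP[e einj] [Bo Bx]].
exists (fun n => \bigcup_(b in [set b | B b /\ e b = n]) b); split=> [n|x W].
  by apply: bigcup_open => b [/Bo].
move=> /Bx[b [Bb bx] bW]; exists (e b); split; first by exists b.
by move=> y [b' [Bb' /einj bb'] b'y]; apply: bW; rewrite -bb' ?inE.
Qed.

(** * Borel sets and Haar measure of a second countable group *)

Section second_countable_group.
Context {R : realType} {G : lcGroupType} (mu : left_haar_measure R G)
  (scG : @second_countable G).

(** The base sets of finite measure already cover the group: each point has a compact neighbourhood,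
    of finite measure, and a base set around the point fits inside it. *)
Lemma haar_sigma_finite : sigma_finite setT mu.
Proof.
have [U [Uo Ux]] := second_countable_enum scG.
pose F n : set (borelType G) := if (mu (U n) < +oo)%E then U n else set0.
exists F; last first.
  move=> n; rewrite /F; case: ifP => [Un|_]; last by rewrite measure0; split.
  by split=> //; exact: open_borel.
apply/seteqP; split=> // x _; have [K + [cK _]] := @lcgroup_locally_compact G x I.
rewrite /within /= => Kx; have {}Kx : nbhs x K by apply: filterS Kx => y; exact.
have [n [Unx UnK]] := Ux _ _ Kx; exists n => //; rewrite /F ifT//.
have mK : measurable (K : set (borelType G)).
  rewrite -[K]setCK; apply: measurableC; apply: open_borel.
  by apply: closed_openC; apply: compact_closed => //; exact: lcgroup_hausdorff.
apply: le_lt_trans (haar_compact mu cK); apply: le_measure => //; rewrite inE//.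
exact: open_borel.
Qed.

(* The Borel sigma-algebra of [G * G] is the product one only thanks to second
   countability. *)
Lemma borel_prod_measurable :
  measurable_fun [set: (borelType G * borelType G)%type]
    (fun z => z : borelType (G * G)%type).
Proof.
have [U [Uo Ux]] := second_countable_enum scG.
apply: (@measurability _ _ _ (borelType (G * G)%type) setT _ (@open (G * G)%type)) => //.
move=> _ [W oW <-]; rewrite setTI.
have -> : W = \bigcup_n \bigcup_m
    (if `[< U n `*` U m `<=` W >] then U n `*` U m else set0).
  apply/seteqP; split=> [[x y] Wxy|z [n _] [m _]]; last by case: asboolP => // h /h.
  have [PQ [/= Px Qy] PQW] : nbhs (x, y) W by exact: open_nbhs_nbhs.
  have [n [Unx UP]] := Ux _ _ Px; have [m [Umy UQ]] := Ux _ _ Qy.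
  have UW : U n `*` U m `<=` W by move=> [a b] [/= /UP Pa /UQ Qb]; exact: PQW.
  by exists n => //; exists m => //; case: asboolP => //= _; split.
apply: bigcup_measurable => n _; apply: bigcup_measurable => m _.
by case: asboolP => // _; apply: measurableX; exact: open_borel.
Qed.

Lemma continuous_prod_measurable (f : G * G -> G) : continuous f ->
  measurable_fun [set: (borelType G * borelType G)%type] (f : _ -> borelType G).
Proof.
move=> cf; exact: (measurableT_comp (@continuous_borel [the ptopologicalType of (G * G)%type] G
  f cf) borel_prod_measurable).
Qed.

Lemma measurable_mul_prod :
  measurable_fun setT (fun z : borelType G * borelType G => (z.1 * z.2)%g : borelType G).
Proof. by apply: continuous_prod_measurable; exact: mulg_continuous. Qed.

Lemma measurable_inv : measurable_fun setT (fun t : borelType G => t^-1%g : borelType G).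
Proof. by apply: (@continuous_borel G G); exact: invg_continuous. Qed.

End second_countable_group.

Section haar_invariance.
Context {R : realType} {G : lcGroupType} (mu : left_haar_measure R G).

Lemma ge0_integral_lmul (s : G) (f : borelType G -> \bar R) :
  measurable_fun setT f -> (forall t, 0 <= f t)%E ->
  (\int[mu]_t f (s * t)%g = \int[mu]_t f t)%E.
Proof.
move=> mf f0; have := ge0_integral_pushforward (measurable_lmul s) mu (D := setT)
  measurableT mf (fun t _ => f0 t).
rewrite preimage_setT => <-.
apply: (eq_measure_integral mu) => [|mp A mA _]; first exact: (measurable_lmul s).
exact: haar_preimage_lmul.
Qed.

Lemma integral_lmul (s : G) (f : borelType G -> \bar R) : measurable_fun setT f ->
  (\int[mu]_t f (s * t)%g = \int[mu]_t f t)%E.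
Proof.
move=> mf; rewrite [LHS]integralE [RHS]integralE; congr (_ - _)%E.
- rewrite -(ge0_integral_lmul s (measurable_funepos mf))//.
  by apply: eq_integral => t _; rewrite !funeposE.
- rewrite -(ge0_integral_lmul s (measurable_funeneg mf))//.
  by apply: eq_integral => t _; rewrite !funenegE.
Qed.

Context (Delta : modular_function mu).

Lemma modular_neq0 s : Delta s != 0.
Proof. by rewrite gt_eqF// modular_gt0. Qed.

Lemma haar_preimage_rmul (s : G) (E : set (borelType G)) : measurable E ->
  mu ((fun t => (t * s)%g) @^-1` E) = ((Delta s)^-1%:E * mu E)%E.
Proof.
by move=> mE; rewrite -modularV -(modularE Delta s^-1%g mE) rmul_image invgK.
Qed.

Lemma ge0_integral_rmul (s : G) (f : borelType G -> \bar R) :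
  measurable_fun setT f -> (forall t, 0 <= f t)%E ->
  (\int[mu]_t f (t * s)%g = (Delta s)^-1%:E * \int[mu]_t f t)%E.
Proof.
move=> mf f0; have := ge0_integral_pushforward (measurable_rmul s) mu (D := setT)
  measurableT mf (fun t _ => f0 t).
have s0 : 0 <= (Delta s)^-1 by rewrite invr_ge0 ltW ?modular_gt0.
rewrite preimage_setT => <-; rewrite -(ge0_integral_mscale mu measurableT (NngNum s0))//.
apply: (eq_measure_integral (mscale (NngNum s0) mu)) => [|mp A mA _];
  first exact: (measurable_rmul s).
exact: haar_preimage_rmul.
Qed.

Lemma integral_rmul (s : G) (f : borelType G -> \bar R) : mu.-integrable setT f ->
  (\int[mu]_t f (t * s)%g = (Delta s)^-1%:E * \int[mu]_t f t)%E.
Proof.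
move=> fi; have mf := measurable_int mu fi.
rewrite [LHS]integralE [X in (_ * X)%E]integralE muleBr ?integrable_add_def//.
congr (_ - _)%E.
- rewrite -(ge0_integral_rmul s (measurable_funepos mf))//.
  by apply: eq_integral => t _; rewrite !funeposE.
- rewrite -(ge0_integral_rmul s (measurable_funeneg mf))//.
  by apply: eq_integral => t _; rewrite !funenegE.
Qed.

Lemma haar_ae_rmul (s : G) (P : G -> Prop) :
  {ae mu, forall t, P t} -> {ae mu, forall t, P (t * s)%g}.
Proof.
move=> [N [mN N0 PN]]; exists ((fun t => (t * s)%g) @^-1` N); split.
- by rewrite -[X in measurable X]setTI; exact: measurable_rmul.
- by rewrite haar_preimage_rmul// N0 mule0.
- by move=> t /= nP; exact: PN.
Qed.

End haar_invariance.

(** * Fibers of the modular function, and inversion on one fiber *)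

Section inversion.
Context {R : realType} {G : lcGroupType} {mu : left_haar_measure R G}
  (Delta : modular_function mu) (kerO : open (modular_kernel Delta))
  (scG : @second_countable G).

(** [Delta] is constant on the cosets of its kernel, and these are open; the preimage of an
    arbitrary set of reals is a union of such cosets. *)
Lemma open_modular_preimage (A : set R) : open (Delta @^-1` A).
Proof.
have -> : Delta @^-1` A = \bigcup_(t in Delta @^-1` A) ((fun x => (t^-1 * x)%g) @^-1`
  modular_kernel Delta).
  apply/seteqP; split=> [t At|x [t At]].
    by exists t => //; rewrite /modular_kernel /= mulVg modular1.
  rewrite /modular_kernel /= modularM modularV => tx.
  suff -> : Delta x = Delta t by [].
  apply: (@mulfI _ (Delta t)^-1); first by rewrite invr_eq0 modular_neq0.
  by rewrite tx mulVf// modular_neq0.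
apply: bigcup_open => t _; apply: open_comp => // x _; exact: lmul_continuous.
Qed.

Lemma measurable_modular_preimage (A : set R) : measurable (Delta @^-1` A : set (borelType G)).
Proof. by apply: open_borel; exact: open_modular_preimage. Qed.

Lemma measurable_modular : measurable_fun [set: borelType G] Delta.
Proof. by move=> _ A _; rewrite setTI; exact: measurable_modular_preimage. Qed.

(** Countability of Delta(G): a nonempty fiber is open, hence contains a nonempty base set, and the
    number of that base set determines the value of [Delta]. *)
Lemma modular_index : exists idx : R -> nat,
  forall s t, idx (Delta s) = idx (Delta t) -> Delta s = Delta t.
Proof.
have [U [Uo Ux]] := second_countable_enum scG.
have h r : exists n, range Delta r -> U n !=set0 /\ U n `<=` Delta @^-1` [set r].
  have [[t _ <-]|nr] := pselect (range Delta r); last by exists 0%N.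
  have : nbhs t (Delta @^-1` [set Delta t]).
    by apply: open_nbhs_nbhs; split=> //; exact: open_modular_preimage.
  by move=> /Ux[n [Ut Un]]; exists n => _; split=> //; exists t.
have [idx idxP] := choice h; exists idx => s t st.
have [[x Ux'] /(_ x)] := idxP (Delta s) (ex_intro2 _ _ s I erefl).
have [_ /(_ x)] := idxP (Delta t) (ex_intro2 _ _ t I erefl).
by rewrite -st => /(_ Ux') <- /(_ Ux').
Qed.

(** For [E] of finite positive measure, integrate F(s^-1) 1_E(t s) in both orders. Integrating over
    t first produces mu(E) and the modular weight. In the other order, replacing s by t^-1 s gives
    F(s^-1 t) 1_E(s), whose integral is mu(E) times that of F. Then cancel mu(E). *)
Lemma ge0_integral_inv (F : borelType G -> \bar R) : measurable_fun setT F ->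
  (forall t, 0 <= F t)%E ->
  (\int[mu]_s (F (s^-1)%g * (Delta s)^-1%:E) = \int[mu]_s F s)%E.
Proof.
move=> mF F0; have [E [mE E0 Eoo]] := @haar_finite_pos R G mu.
have mFV : measurable_fun setT (fun s : borelType G => F (s^-1)%g).
  exact: (measurableT_comp mF (@measurable_inv G)).
have mDV : measurable_fun setT (fun s : borelType G => (Delta s)^-1%:E).
  apply/measurable_EFinP.
  have := measurableT_comp measurable_modular (@measurable_inv G).
  by apply: eq_measurable_fun => t _ /=; rewrite modularV.
have D0 s : (0 <= (Delta s)^-1%:E)%E by rewrite lee_fin invr_ge0 ltW ?modular_gt0.
have m1E : measurable_fun setT (fun t : borelType G => (\1_E t : R)%:E).
  by apply/measurable_EFinP; exact: measurable_indic.
have e0 t : (0 <= (\1_E t : R)%:E)%E by rewrite lee_fin.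
have i1E : (\int[mu]_t (\1_E t)%:E = mu E)%E by rewrite integral_indic// setIT.
pose K1 (z : borelType G * borelType G) := (F (z.1^-1)%g * (\1_E (z.2 * z.1)%g)%:E)%E.
pose K2 (z : borelType G * borelType G) := (F (z.2^-1 * z.1)%g * (\1_E z.2)%:E)%E.
have swap : continuous (fun z : G * G => (z.2 * z.1)%g).
  move=> z; apply: (@continuous_comp _ _ _ (fun z => (z.2, z.1)) (fun z : G * G => (z.1 *
    z.2)%g)).
    by apply: cvg_pair; [exact: cvg_snd|exact: cvg_fst].
  exact: mulg_continuous.
have swapV : continuous (fun z : G * G => (z.2^-1 * z.1)%g).
  move=> z; apply: (@continuous_comp _ _ _ (fun z => (z.2^-1%g, z.1)) (fun z : G * G => (z.1 *
    z.2)%g)).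
    apply: cvg_pair; last exact: cvg_fst.
    by apply: (@continuous_comp _ _ _ snd (fun x : G => x^-1%g));
      [exact: cvg_snd|exact: invg_continuous].
  exact: mulg_continuous.
have mK1 : measurable_fun setT K1.
  apply: emeasurable_funM; first exact: (measurableT_comp mFV measurable_fst).
  exact: (measurableT_comp m1E (continuous_prod_measurable scG swap)).
have mK2 : measurable_fun setT K2.
  apply: emeasurable_funM; first exact: (measurableT_comp mF (continuous_prod_measurable scG
    swapV)).
  exact: (measurableT_comp m1E measurable_snd).
have sf := haar_sigma_finite mu scG.
have E' : (mu E * \int[mu]_s (F (s^-1)%g * (Delta s)^-1%:E) = mu E * \int[mu]_s F s)%E.
  rewrite -ge0_integralZl//; last 2 first.
  - exact: emeasurable_funM.
  - by move=> t _; exact: mule_ge0.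
  transitivity (\int[mu]_s \int[mu]_t K1 (s, t))%E.
    apply: eq_integral => s _; rewrite /K1 /= ge0_integralZl//; last first.
      exact: (measurableT_comp m1E (measurable_rmul s)).
    by rewrite (ge0_integral_rmul Delta s m1E e0) i1E muleCA (muleC (mu E)).
  rewrite (tonelli_sf sf)//; last by move=> z; exact: mule_ge0.
  transitivity (\int[mu]_t \int[mu]_s K2 (t, s))%E.
    apply: eq_integral => t _.
    have mk : measurable_fun setT (fun s : borelType G => K1 (s, t)) by exact:
      measurable_fun_pair1.
    rewrite -(ge0_integral_lmul mu t^-1%g mk) => [|s]; last exact: mule_ge0.
    by apply: eq_integral => s _; rewrite /K1 /K2 /= mulVKg invgM invgK.
  rewrite (tonelli_sf sf)//; last by move=> z; exact: mule_ge0.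
  rewrite muleC -i1E -ge0_integralZl//; last exact: integral_ge0.
  apply: eq_integral => s _; rewrite /K2 /= ge0_integralZr//; last first.
    exact: (measurable_comp_lmul s^-1%g mF).
  by rewrite (ge0_integral_lmul mu s^-1%g mF F0).
have Ef : mu E \is a fin_num by rewrite ge0_fin_numE// ltW.
by apply/eqP; rewrite eq_le; apply/andP; split; rewrite -(lee_pmul2l Ef E0) E'.
Qed.

(** Where F(s^-1) is not zero, the weight (Delta s)^-1 equals Delta(s^-1) = k, so it is a constant
    and leaves the integral. If k is not positive, F is zero. *)
Lemma ge0_integral_inv_fiber (F : borelType G -> \bar R) (k : R) : measurable_fun setT F ->
  (forall t, 0 <= F t)%E -> (forall t, Delta t <> k -> F t = 0%E) ->
  (\int[mu]_s F s = k%:E * \int[mu]_s F (s^-1)%g)%E.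
Proof.
move=> mF F0 Fk; have [k0|k0] := ltP 0 k; last first.
  have F00 t : F t = 0%E.
    by apply: Fk => e; have := modular_gt0 Delta t; rewrite e ltNge k0.
  under eq_integral do rewrite F00; under [in RHS]eq_integral do rewrite F00.
  by rewrite integral0 mule0.
rewrite -(ge0_integral_inv mF F0) -ge0_integralZl_EFin ?ltW//; last first.
  exact: (measurableT_comp mF (@measurable_inv G)).
apply: eq_integral => s _; rewrite muleC.
have [e|/Fk ->] := pselect (Delta s^-1%g = k); last by rewrite !mule0.
by rewrite -e modularV.
Qed.

Lemma integral_inv_fiber (F : borelType G -> \bar R) (k : R) : mu.-integrable setT F ->
  (forall t, Delta t <> k -> F t = 0%E) ->
  (\int[mu]_s F s = k%:E * \int[mu]_s F (s^-1)%g)%E.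
Proof.
move=> iF Fk; have mF := measurable_int mu iF.
have pk t : Delta t <> k -> F^\+%E t = 0%E by move=> /Fk; rewrite funeposE => ->; rewrite maxxx.
have nk t : Delta t <> k -> F^\-%E t = 0%E by move=> /Fk; rewrite funenegE => ->;
  rewrite oppe0 maxxx.
have e1 := ge0_integral_inv_fiber (measurable_funepos mF) (fun t => funepos_ge0 F t) pk.
have e2 := ge0_integral_inv_fiber (measurable_funeneg mF) (fun t => funeneg_ge0 F t) nk.
have [k0|k0] := eqVneq k 0.
  have F00 t : F t = 0%E by apply: Fk; rewrite k0; apply/eqP/modular_neq0.
  by under eq_integral do rewrite F00; rewrite integral0 k0 mul0e.
have iFV : mu.-integrable setT (fun s : borelType G => F (s^-1)%g).
  apply/integrableP; split; first exact: (measurableT_comp mF (@measurable_inv G)).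
  have ak t : Delta t <> k -> `|F t|%E = 0%E by move=> /Fk ->; rewrite abse0.
  have mA : measurable_fun setT (fun t => `|F t|%E) by exact: measurableT_comp.
  have := ge0_integral_inv_fiber mA (fun t => abse_ge0 _) ak.
  have /integrableP[_] := iF => /[swap] -> h.
  rewrite ltey; apply/eqP => e; move: h; rewrite e.
  have [kp|kp] := ltP 0 k; first by rewrite gt0_muley.
  have F00 t : F t = 0%E.
    by apply: Fk => e'; have := modular_gt0 Delta t; rewrite e' ltNge kp.
  by move: e; under eq_integral do rewrite F00 abse0; rewrite integral0.
rewrite [in RHS]integralE muleBr ?integrable_add_def// [LHS]integralE e1 e2.
by congr (_ * _ - _ * _)%E; apply: eq_integral => s _; rewrite !(funeposE, funenegE).
Qed.

End inversion.

(** * The twisted convolution form *)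

Lemma cmeasurable_comp d d' (T : measurableType d) (U : measurableType d') (R : realType)
  (f : U -> R[i]) (phi : T -> U) : measurable_fun setT phi -> cmeasurable f ->
  cmeasurable (fun t => f (phi t)).
Proof. by move=> mphi [mr mi]; split; [exact: (measurableT_comp mr mphi)|exact:
  (measurableT_comp mi mphi)]. Qed.

Lemma square_integrable_bdM d (T : measurableType d) (R : realType)
  (mu : {measure set T -> \bar R}) (p f : T -> R[i]) (M : R) :
  cmeasurable p -> (forall t, sqmod (p t) <= M) -> square_integrable mu f ->
  square_integrable mu (fun t => p t * f t).
Proof.
move=> mp pM /square_integrableP[mf fi]; apply/square_integrableP; split.
  exact: cmeasurableM.
have [M0|M0] := leP 0 M; last first.
  rewrite [X in (X < _)%E](_ : _ = 0%E) ?ltry// -[RHS](integral0 mu setT).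
  by apply: eq_integral => t _; have := sqmod_ge0 (p t); rewrite leNgt (le_lt_trans (pM t) M0).
apply: (@le_lt_trans _ _ (\int[mu]_t (M%:E * (sqmod (f t))%:E))%E).
  apply: ge0_le_integral => //.
  - by move=> t _; rewrite lee_fin sqmod_ge0.
  - by apply/measurable_EFinP/cmeasurable_sqmod/cmeasurableM.
  - by apply: emeasurable_funM => //; exact/measurable_EFinP/cmeasurable_sqmod.
  - by move=> t _; rewrite sqmodM -EFinM lee_fin ler_wpM2r ?sqmod_ge0.
rewrite ge0_integralZl_EFin//; last 2 first.
- by move=> t _; rewrite lee_fin sqmod_ge0.
- exact/measurable_EFinP/cmeasurable_sqmod.
by rewrite lte_mul_pinfty// lee_fin.
Qed.

(** * Phases of the twisted convolution *)

Section twisted_kernel.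
Context {R : realType} {G : lcGroupType} (omega : cocycle2 R G).

Lemma sqmod_cocycle s t : sqmod (omega s t) = 1.
Proof. exact: cocycle_sqr. Qed.

Lemma cocycle_mulC s t : omega s t * (omega s t)^* = 1.
Proof.
have := sqmod_cocycle s t; rewrite /sqmod; case: (omega s t) => a b /= h.
by apply/eqP; rewrite eq_complex /=; apply/andP; split; apply/eqP; [rewrite -h; ring|ring].
Qed.

Lemma cocycle1x s : omega 1%g s = omega 1%g 1%g.
Proof.
have := cocycleE omega 1%g 1%g s; rewrite !mul1g => /esym.
by move=> /mulIf; apply; exact: cocycle_neq0.
Qed.

(** The phase in lambda(s^-1) lambda(s) = vphase(s) lambda(1). *)
Definition vphase (s : G) : R[i] := omega s^-1%g s.

Lemma vphase_mulC s : vphase s * (vphase s)^* = 1.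
Proof. exact: cocycle_mulC. Qed.

Lemma vphaseV s : vphase s^-1%g = vphase s.
Proof.
rewrite /vphase invgK; have := cocycleE omega s s^-1%g s.
rewrite mulgV mulVg cocycle1x cocyclex1.
by move=> /mulIf; apply; exact: cocycle_neq0.
Qed.

Lemma cocyclexV s : omega s s^-1%g = vphase s.
Proof. by rewrite -vphaseV /vphase invgK. Qed.

(* For abc = 1, [chi a b] is the phase of the trilinear form in (f, g, h); it is
   invariant under the cyclic shift (a, b, c) -> (b, c, a).  [theta] is the phase
   when the third function is replaced by its [flip]. *)
Definition chi (a b : G) : R[i] := omega a b * (vphase a)^* * (vphase b)^*.
Definition theta (a b : G) : R[i] := omega (a * b)^-1%g a * (vphase a)^*.

Let cancel_conj (x y z : R[i]) : y * y^* = 1 -> x * y = z -> x = z * y^*.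
Proof. by move=> yy <-; rewrite -mulrA yy mulr1. Qed.

(** The cocycle identity at (a, b, c) with c = (ab)^-1 expresses omega(b, c) through omega(a, b) and
    values of [vphase]. *)
Lemma chi_rot a b : chi b (a * b)^-1%g = chi a b.
Proof.
rewrite /chi vphaseV; have := cocycleE omega a b (a * b)^-1%g.
have -> : (b * (a * b)^-1)%g = a^-1%g by rewrite invgM mulVKg.
rewrite !cocyclexV => h.
have -> : omega b (a * b)^-1%g = omega a b * vphase (a * b)%g * (vphase a)^*.
  by apply: cancel_conj; rewrite ?vphase_mulC.
by rewrite -[RHS]mul1r -(vphase_mulC (a * b)%g); ring.
Qed.

Lemma theta_chi a b : theta a b = vphase (a * b)%g * chi a b.
Proof.
rewrite /theta /chi; have := cocycleE omega (a * b)^-1%g a b.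
have -> : ((a * b)^-1 * a)%g = b^-1%g by rewrite invgM mulgVK.
rewrite -!/(vphase _) => h.
have -> : omega (a * b)^-1%g a = omega a b * vphase (a * b)%g * (vphase b)^*.
  by apply: cancel_conj; rewrite ?vphase_mulC.
by ring.
Qed.

Lemma sqmod_vphase s : sqmod (vphase s) = 1. Proof. exact: sqmod_cocycle. Qed.

Lemma sqmod_theta a b : sqmod (theta a b) = 1.
Proof. by rewrite sqmodM sqmod_conj sqmod_cocycle sqmod_vphase mulr1. Qed.

Lemma cmeasurable_omega : cmeasurable (fun z : borelType (G * G)%type => omega z.1 z.2).
Proof. by split; [exact: cocycle_Re_measurable|exact: cocycle_Im_measurable]. Qed.

Lemma cmeasurable_omega_cont (p q : G -> G) : continuous p -> continuous q ->
  cmeasurable (fun t : borelType G => omega (p t) (q t)).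
Proof.
move=> cp cq.
have c : continuous (fun t : G => (p t, q t)) by move=> t; apply: cvg_pair; [exact: cp|exact: cq].
exact: (cmeasurable_comp (@continuous_borel G [the ptopologicalType of (G * G)%type] _ c)
  cmeasurable_omega).
Qed.

Lemma cmeasurable_vphase : cmeasurable (fun t : borelType G => vphase t).
Proof. by apply: cmeasurable_omega_cont; [exact: invg_continuous|move=> t; exact: cvg_id]. Qed.

Lemma cmeasurable_theta1 b : cmeasurable (fun a : borelType G => theta a b).
Proof.
apply: cmeasurableM; last exact: cmeasurable_conj cmeasurable_vphase.
apply: cmeasurable_omega_cont; last by move=> t; exact: cvg_id.
move=> t; apply: (@continuous_comp _ _ _ (fun a : G => (a * b)%g) (fun x : G => x^-1%g));
  last exact: invg_continuous.
exact: rmul_continuous.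
Qed.

Lemma cmeasurable_theta (scG : @second_countable G) :
  cmeasurable (fun z : borelType G * borelType G => theta z.1 z.2).
Proof.
apply: cmeasurableM.
  have c : continuous (fun z : G * G => ((z.1 * z.2)^-1%g, z.1)).
    move=> z; apply: cvg_pair; last exact: cvg_fst.
    apply: (@continuous_comp _ _ _ (fun z : G * G => (z.1 * z.2)%g) (fun x : G => x^-1%g)).
      exact: mulg_continuous.
    exact: invg_continuous.
  have m := measurableT_comp (@continuous_borel [the ptopologicalType of (G * G)%type] [the
    ptopologicalType of (G * G)%type] _ c)
    (borel_prod_measurable scG).
  exact: (cmeasurable_comp m cmeasurable_omega).
apply: cmeasurable_conj.
exact: (cmeasurable_comp measurable_fst cmeasurable_vphase).
Qed.

End twisted_kernel.

(** * Right translations *)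

Section right_translation.
Context {R : realType} {G : lcGroupType} {mu : left_haar_measure R G}
  (Delta : modular_function mu) (omega : cocycle2 R G).
Local Notation lambda := (lambda mu omega).
Local Notation theta := (theta omega).
Local Notation vphase := (vphase omega).

Lemma square_integrable_rmul (f : G -> R[i]) (s : G) : square_integrable mu f ->
  square_integrable mu (fun t => f (t * s)%g).
Proof.
move=> /square_integrableP[mf fi]; apply/square_integrableP; split.
  exact: (cmeasurable_comp (measurable_rmul s) mf).
have mq : measurable_fun setT (fun t : borelType G => (sqmod (f t))%:E).
  exact/measurable_EFinP/cmeasurable_sqmod.
rewrite (ge0_integral_rmul Delta s mq) => [|t]; last by rewrite lee_fin sqmod_ge0.
by rewrite lte_mul_pinfty// lee_fin invr_ge0 ltW// modular_gt0.
Qed.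

(* Without the factor [Delta b ^ (-1/2)], hence bounded but not unitary. *)
Definition right_translate (b : G) (f : G -> R[i]) : G -> R[i] :=
  fun t => theta (t * b^-1)%g b * f (t * b^-1)%g.

Definition rho (b : G) (x : L2 mu) : L2 mu := L2_of mu (right_translate b x).

Lemma right_translate_L2 b f : square_integrable mu f ->
  square_integrable mu (right_translate b f).
Proof.
move=> fL; apply: (@square_integrable_bdM _ _ _ _ _ _ 1).
- exact: (cmeasurable_comp (measurable_rmul b^-1%g) (cmeasurable_theta1 omega b)).
- by move=> t; rewrite sqmod_theta.
- exact: square_integrable_rmul.
Qed.

Lemma rhoE b (x : L2 mu) (f : G -> R[i]) : square_integrable mu f ->
  {ae mu, forall t, x t = f t} ->
  {ae mu, forall t, rho b x t = right_translate b f t}.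
Proof.
move=> fL xf; have := L2_ofK (right_translate_L2 b (L2_valP x)).
move: (haar_ae_rmul Delta b^-1%g xf) => /=; set P := fun t => _ => e h.
near=> t.
have -> : rho b x t = right_translate b x t by near: t.
by rewrite /right_translate; congr (_ * _); near: t.
Unshelve. all: by end_near.
Qed.

Lemma rho_linear b : linear (rho b).
Proof.
move=> a x y; apply: L2_ext.
have e1 := rhoE b (L2_valP (a *: x + y)) (aeW _ (fun t => erefl)).
have e2 := rhoE b (L2_valP x) (aeW _ (fun t => erefl)).
have e3 := rhoE b (L2_valP y) (aeW _ (fun t => erefl)).
have e4 := L2_linE a (rho b x) (rho b y).
have e5 := haar_ae_rmul Delta b^-1%g (L2_linE a x y).
near=> t.
have -> : L2_val (rho b (a *: x + y)) t = right_translate b (L2_val (a *: x + y)) t by near: t.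
have -> : L2_val (a *: rho b x + rho b y) t = a * rho b x t + rho b y t by near: t.
have -> : rho b x t = right_translate b (L2_val x) t by near: t.
have -> : rho b y t = right_translate b (L2_val y) t by near: t.
rewrite /right_translate.
have -> : L2_val (a *: x + y) (t * b^-1)%g = a * L2_val x (t * b^-1)%g + L2_val y (t * b^-1)%g
  by near: t.
by rewrite mulrDr mulrCA.
Unshelve. all: by end_near. Qed.

Lemma rho_norm b (x : L2 mu) : rinner (rho b x) (rho b x) = Delta b * rinner x x.
Proof.
have xL := L2_valP x; have x0 : {ae mu, forall t, x t = x t} by exact: aeW.
have mq : measurable_fun setT (fun t : borelType G => (sqmod (x t))%:E).
  by apply/measurable_EFinP/cmeasurable_sqmod; exact: cmeasurable_L2.
apply: EFin_inj; rewrite EFinM (rinner_sqmod (right_translate_L2 b xL) (rhoE b xL x0)).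
rewrite (rinner_sqmod xL x0).
have q0 t : (0 <= (sqmod (x t))%:E)%E by rewrite lee_fin sqmod_ge0.
have := ge0_integral_rmul Delta b^-1%g mq q0; rewrite modularV invrK => <-.
by apply: eq_integral => t _; rewrite /right_translate sqmodM sqmod_theta mul1r.
Qed.

Lemma rho_bounded b : bounded_operator (rho b).
Proof.
apply/bounded_operatorP; split; first exact: rho_linear.
by exists (Delta b) => [|x]; [rewrite ltW// modular_gt0|rewrite rho_norm].
Qed.

(** This puts [rho b] in the commutant of the left translations. With y = t b^-1 the phases agree at
    t by the cocycle identity at (t^-1, s, s^-1 y) and at (y^-1, s, s^-1 y). *)
Lemma rho_lambda b s (x : L2 mu) : rho b (lambda s x) = lambda s (rho b x).
Proof.
apply: L2_ext.
have e1 := rhoE b (twisted_translate_L2 omega s (L2_valP x)) (lambdaE omega s x).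
have e2 := lambdaE omega s (rho b x).
have e3 := haar_ae_lmul s^-1%g (rhoE b (L2_valP x) (aeW _ (fun t => erefl))).
near=> t.
have -> : rho b (lambda s x) t = right_translate b (twisted_translate omega s x) t by near: t.
have -> : lambda s (rho b x) t = twisted_translate omega s (rho b x) t by near: t.
rewrite /right_translate /twisted_translate.
have -> : rho b x (s^-1 * t)%g = right_translate b x (s^-1 * t)%g by near: t.
rewrite /right_translate !mulrA -(mulgA s^-1%g); set y := (t * b^-1)%g.
congr (_ * x _); rewrite /theta.
have yt : (y * b)%g = t by rewrite /y mulgVK.
have -> : ((s^-1 * y * b)^-1 = t^-1 * s)%g by rewrite -mulgA yt invgM invgK.
have c1 := cocycleE omega t^-1%g s (s^-1 * y)%g; rewrite mulVKg in c1.
have c2 := cocycleE omega y^-1%g s (s^-1 * y)%g.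
have e : (y^-1 * s = (s^-1 * y)^-1)%g by rewrite [RHS]invgM invgK.
rewrite mulVKg e -!/(vphase _) in c2.
have {}c2 : omega y^-1%g s = omega s (s^-1 * y)%g * vphase y * (vphase (s^-1 * y)%g)^*.
  by rewrite -c2 -mulrA vphase_mulC mulr1.
rewrite yt c1 c2 -[RHS]mul1r -(vphase_mulC omega y); ring.
Unshelve. all: by end_near. Qed.
End right_translation.

(** * The trilinear form: convergence and cyclic symmetry *)

Section trilinear_form.
Context {R : realType} {G : lcGroupType} {mu : left_haar_measure R G}
  (Delta : modular_function mu) (omega : cocycle2 R G)
  (kerO : open (modular_kernel Delta)) (scG : @second_countable G).
Local Notation lambda := (lambda mu omega).
Local Notation theta := (theta omega).
Local Notation vphase := (vphase omega).
Local Notation chi := (chi omega).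
Local Notation rho := (rho omega).
Implicit Types f g h k : G -> R[i].

(** Integrated over [a] and [b] this is the real part of <f * g, k> for the twisted convolution,
    which is itself never formed as a function. *)
Definition triform f g k (a b : G) : R := complex.Re (f a * g b * (k (a * b)%g)^* * theta a b).

Lemma cmeasurable_form f g k : cmeasurable (f : borelType G -> _) ->
  cmeasurable (g : borelType G -> _) -> cmeasurable (k : borelType G -> _) ->
  cmeasurable (fun z : borelType G * borelType G => f z.1 * g z.2 * (k (z.1 * z.2)%g)^* * theta
    z.1 z.2).
Proof.
move=> mf mg mk; apply: cmeasurableM; last exact: cmeasurable_theta.
apply: cmeasurableM.
  apply: cmeasurableM; first exact: (cmeasurable_comp measurable_fst mf).
  exact: (cmeasurable_comp measurable_snd mg).
apply: cmeasurable_conj.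
exact: (cmeasurable_comp (measurable_mul_prod scG) mk).
Qed.

Lemma measurable_form f g k : cmeasurable (f : borelType G -> _) ->
  cmeasurable (g : borelType G -> _) -> cmeasurable (k : borelType G -> _) ->
  measurable_fun setT (fun z : borelType G * borelType G => (triform f g k z.1 z.2)%:E).
Proof. by move=> mf mg mk; apply/measurable_EFinP; have [] := cmeasurable_form mf mg mk. Qed.

(** Integrating out [b] presents the convolution as a superposition of left translates of [g]; an
    operator commuting with [lambda] then acts on [g] alone. *)
Lemma form_integral_left f g k (x y : L2 mu) (a : G) :
  square_integrable mu g -> square_integrable mu k ->
  {ae mu, forall t, x t = g t} -> {ae mu, forall t, y t = k t} ->
  (\int[mu]_b (triform f g k a b)%:E = (rinner ((f a * (vphase a)^*) *: lambda a x) y)%:E)%E.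
Proof.
move=> gL kL xg yk; set c := f a * (vphase a)^*.
have cL : square_integrable mu (fun t => c * twisted_translate omega a g t).
  apply: (@square_integrable_bdM _ _ _ _ _ _ (sqmod c)) => //.
  exact: twisted_translate_L2.
have ce : {ae mu, forall t, L2_val (c *: lambda a x) t = c * twisted_translate omega a g t}.
  have e1 := lambdaE omega a x; have e2 := haar_ae_lmul a^-1%g xg.
  have e3 := L2_scaleE c (lambda a x).
  near=> t.
  have -> : L2_val (c *: lambda a x) t = c * lambda a x t by near: t.
  have -> : lambda a x t = twisted_translate omega a x t by near: t.
  by rewrite /twisted_translate; congr (_ * (_ * _)); near: t.
rewrite (rinner_L2E cL kL ce yk).
have mF := measurable_int mu (square_integrable_prod cL kL).1.
rewrite -(integral_lmul mu a mF); apply: eq_integral => b _ /=; congr (complex.Re _)%:E.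
by rewrite /twisted_translate mulKg /c /theta; ring.
Unshelve. all: by end_near. Qed.

(** The dual presentation by right translates of [f]; [(Delta b)^-1] is the Jacobian of right
    translation by [b]. *)
Lemma form_integral_right f g k (x y : L2 mu) (b : G) :
  square_integrable mu f -> square_integrable mu k ->
  {ae mu, forall t, x t = f t} -> {ae mu, forall t, y t = k t} ->
  (\int[mu]_a (triform f g k a b)%:E = ((Delta b)^-1 * rinner (g b *: rho b x) y)%:E)%E.
Proof.
move=> fL kL xf yk; set c := g b.
have cL : square_integrable mu (fun t => c * right_translate omega b f t).
  apply: (@square_integrable_bdM _ _ _ _ _ _ (sqmod c)) => //.
  exact: (right_translate_L2 Delta).
have ce : {ae mu, forall t, L2_val (c *: rho b x) t = c * right_translate omega b f t}.
  have e1 := rhoE Delta omega b fL xf.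
  have e3 := L2_scaleE c (rho b x).
  near=> t.
  have -> : L2_val (c *: rho b x) t = c * rho b x t by near: t.
  by congr (_ * _); near: t.
rewrite EFinM (rinner_L2E cL kL ce yk).
have iF := (square_integrable_prod cL kL).1.
rewrite -(integral_rmul Delta b iF); apply: eq_integral => a _ /=; congr (complex.Re _)%:E.
by rewrite /right_translate mulgK /c; ring.
Unshelve. all: by end_near. Qed.

(** Test functions of degree [e]. Boundedness and finite measure of the support make the form
    absolutely convergent against two arbitrary L^2 functions when a test function occupies the
    first or second slot; homogeneity controls inversion. When [e] is not a value of [Delta], [f] is
    zero. *)
Definition nice (e : R) f := [/\ cmeasurable (f : borelType G -> R[i]),
  exists M, forall t, sqmod (f t) <= M, (mu [set t | f t != 0%R] < +oo)%E &
  forall t, f t != 0 -> Delta t = e].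

Lemma measurable_support f : cmeasurable (f : borelType G -> _) ->
  measurable ([set t | f t != 0] : set (borelType G)).
Proof.
move=> /cmeasurable_sqmod mf.
have -> : [set t | f t != 0] = (fun t => sqmod (f t)) @^-1` (~` [set 0]).
  apply/seteqP; split=> t /=; first by move=> ft /sqmod_eq0 /eqP; exact/negP.
  by move=> ft; apply/eqP => e; apply: ft; rewrite e /sqmod expr0n addr0.
by rewrite -[X in measurable X]setTI; apply: mf => //; exact: measurableC.
Qed.

Let sq_lt0 f t : f t = 0 -> sqmod (f t) = 0.
Proof. by move=> ->; rewrite /sqmod expr0n addr0. Qed.

Lemma nice_L2 e f : nice e f -> square_integrable mu f.
Proof.
move=> [mf [M fM] fS fe]; apply/square_integrableP; split=> //.
have mS := measurable_support mf; set S := [set t | _] in mS fS.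
apply: (@le_lt_trans _ _ (\int[mu]_t (M%:E * (\1_S t)%:E))%E).
  have M0 : 0 <= M by rewrite (le_trans _ (fM 1%g))// sqmod_ge0.
  apply: ge0_le_integral => //.
  - by move=> t _; rewrite lee_fin sqmod_ge0.
  - exact/measurable_EFinP/cmeasurable_sqmod.
  - by apply: emeasurable_funM => //; apply/measurable_EFinP; exact: measurable_indic.
  move=> t _; rewrite -EFinM lee_fin indicE.
  have [/= h|h] := boolP (t \in S); first by rewrite mulr1.
  by rewrite sq_lt0 ?mulr0//; apply/eqP; move: h; rewrite notin_setE /S /= => /negP;
    rewrite negbK.
have M0 : 0 <= M by rewrite (le_trans _ (fM 1%g))// sqmod_ge0.
rewrite ge0_integralZl_EFin//; last by apply/measurable_EFinP; exact: measurable_indic.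
by rewrite integral_indic// setIT lte_mul_pinfty// lee_fin.
Qed.

Lemma form_bound f g k a b :
  `|triform f g k a b| <= sqmod (f a) * sqmod (g b) + sqmod (k (a * b)%g).
Proof.
rewrite /triform -mulrA (le_trans (normr_Re_mul _ _))//.
by rewrite (sqmodM (f a)) (sqmodM _ (theta a b)) sqmod_conj sqmod_theta mulr1.
Qed.

Let sqm (p : G -> R[i]) : cmeasurable (p : borelType G -> _) ->
  measurable_fun setT (fun t : borelType G => (sqmod (p t))%:E).
Proof. by move=> mp; exact/measurable_EFinP/cmeasurable_sqmod. Qed.

Let sq0 (p : G -> R[i]) t : (0 <= (sqmod (p t))%:E)%E.
Proof. by rewrite lee_fin sqmod_ge0. Qed.

(** The inner integral is at most M |g|^2 + |k|^2, uniformly in [a], and [a] ranges over the support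
    of [f], of finite measure. *)
Lemma integrable_form_left e f g k : nice e f -> square_integrable mu g ->
  square_integrable mu k -> (\int[mu]_a \int[mu]_b `|(triform f g k a b)%:E| < +oo)%E.
Proof.
move=> fn gL kL; have [/square_integrableP[mg _] /square_integrableP[mk _]] := (gL, kL).
have [mf [M fM] fS fe] := fn; have mS := measurable_support mf; set S := [set t | _] in mS fS.
have M0 : 0 <= M by rewrite (le_trans _ (fM 1%g))// sqmod_ge0.
have [Ng Ng0 gE] := square_integrable_norm gL; have [Nk Nk0 kE] := square_integrable_norm kL.
have mF := measurable_form mf mg mk.
apply: (@le_lt_trans _ _ (\int[mu]_a ((M * Ng + Nk)%:E * (\1_S a)%:E))%E).
  apply: ge0_le_integral => //.
  - by move=> a _; exact: integral_ge0.
  - apply: (measurable_tonelli_sf (haar_sigma_finite mu scG)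
      (f := fun z => `|(triform f g k z.1 z.2)%:E|%E)) => //.
    exact: measurableT_comp mF.
  - by apply: emeasurable_funM => //; apply/measurable_EFinP; exact: measurable_indic.
  move=> a _; rewrite -EFinM indicE.
  have [h|h] := boolP (a \in S); last first.
    have fa : f a = 0 by apply/eqP; move: h; rewrite notin_setE /S /= => /negP; rewrite negbK.
    under eq_integral do rewrite /triform fa !mul0r /= normr0.
    by rewrite integral0 mulr0.
  rewrite mulr1 EFinD EFinM -gE -kE -(ge0_integral_lmul mu a (sqm mk))//.
  rewrite -ge0_integralZl_EFin//; last exact: sqm.
  have mka : measurable_fun setT (fun t : borelType G => (sqmod (k (a * t)%g))%:E).
    exact: (measurable_comp_lmul a (sqm mk)).
  rewrite -ge0_integralD//; last 2 first.
  - by move=> t _; rewrite mule_ge0.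
  - by apply: emeasurable_funM => //; exact: sqm.
  apply: ge0_le_integral => //.
  - have mFa : measurable_fun setT (fun b : borelType G => (triform f g k a b)%:E).
      exact: (measurableT_comp mF (pair1_measurable a)).
    exact: measurableT_comp mFa.
  - by apply: emeasurable_funD => //; apply: emeasurable_funM => //; exact: sqm.
  move=> b _; rewrite -EFinM -EFinD lee_fin (le_trans (form_bound _ _ _ _ _))//.
  by rewrite lerD2r ler_wpM2r ?sqmod_ge0.
rewrite ge0_integralZl_EFin ?addr_ge0 ?mulr_ge0//; last by apply/measurable_EFinP;
  exact: measurable_indic.
by rewrite integral_indic// setIT lte_mul_pinfty// lee_fin addr_ge0 ?mulr_ge0.
Qed.

Lemma integrable_form_right e f g k : nice e g -> square_integrable mu f ->
  square_integrable mu k -> (\int[mu]_a \int[mu]_b `|(triform f g k a b)%:E| < +oo)%E.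
Proof.
move=> gn fL kL; have [/square_integrableP[mf _] /square_integrableP[mk _]] := (fL, kL).
have [mg [M gM] gS ge] := gn; have mS := measurable_support mg; set S := [set t | _] in mS gS.
have M0 : 0 <= M by rewrite (le_trans _ (gM 1%g))// sqmod_ge0.
have [Nf Nf0 fE] := square_integrable_norm fL; have [Nk Nk0 kE] := square_integrable_norm kL.
have mF := measurable_form mf mg mk.
have sf := haar_sigma_finite mu scG.
rewrite (tonelli_sf sf (f := fun z => `|(triform f g k z.1 z.2)%:E|%E)) //; last first.
  exact: measurableT_comp mF.
(* On the support of [g], right translation scales the integral of [sqmod k] by e^-1. The absolute
   value keeps the constant nonnegative when [e] is not a value of [Delta]. *)
apply: (@le_lt_trans _ _ (\int[mu]_b ((M * Nf + `|e|^-1 * Nk)%:E * (\1_S b)%:E))%E).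
  apply: ge0_le_integral => //.
  - by move=> a _; exact: integral_ge0.
  - have swp : measurable_fun setT (fun z : borelType G * borelType G => (z.2, z.1)).
      by apply: measurable_fun_pair.
    apply: (measurable_tonelli_sf sf
      (f := fun z => `|(triform f g k z.2 z.1)%:E|%E)) => //.
    exact: measurableT_comp (measurableT_comp mF swp).
  - by apply: emeasurable_funM => //; apply/measurable_EFinP; exact: measurable_indic.
  move=> b _; rewrite -EFinM indicE.
  have [h|h] := boolP (b \in S); last first.
    have gb : g b = 0 by apply/eqP; move: h; rewrite notin_setE /S /= => /negP; rewrite negbK.
    under eq_integral do rewrite /triform gb mulr0 !mul0r /= normr0.
    by rewrite integral0 mulr0.
  have Db : Delta b = e by apply: ge; move: h; rewrite inE.
  have e0 : 0 < e by rewrite -Db modular_gt0.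
  rewrite mulr1 EFinD !EFinM -fE -kE (gtr0_norm e0) -Db -(ge0_integral_rmul Delta b (sqm mk))//.
  rewrite -ge0_integralZl_EFin//; last exact: sqm.
  have mkb : measurable_fun setT (fun t : borelType G => (sqmod (k (t * b)%g))%:E).
    exact: (measurableT_comp (sqm mk) (measurable_rmul b)).
  rewrite -ge0_integralD//; last 2 first.
  - by move=> t _; rewrite mule_ge0.
  - by apply: emeasurable_funM => //; exact: sqm.
  apply: ge0_le_integral => //.
  - have mFb : measurable_fun setT (fun a : borelType G => (triform f g k a b)%:E).
      exact: (measurableT_comp mF (pair2_measurable b)).
    exact: measurableT_comp mFb.
  - by apply: emeasurable_funD => //; apply: emeasurable_funM => //; exact: sqm.
  move=> a _; rewrite -EFinM -EFinD lee_fin (le_trans (form_bound _ _ _ _ _))//.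
  by rewrite lerD2r mulrC ler_wpM2r ?sqmod_ge0.
have C0 : 0 <= M * Nf + `|e|^-1 * Nk by rewrite addr_ge0// mulr_ge0// invr_ge0.
rewrite ge0_integralZl_EFin//; last by apply/measurable_EFinP; exact: measurable_indic.
by rewrite integral_indic// setIT lte_mul_pinfty// lee_fin.
Qed.

(** The twisted involution without its modular factor. Taking k = flip h brings the form to the
    symmetric shape with f(a) g(b) h((ab)^-1) chi(a, b). *)
Definition flip h : G -> R[i] := fun t => (h t^-1%g)^* * vphase t.

Lemma cmeasurable_flip h : cmeasurable (h : borelType G -> _) ->
  cmeasurable (flip h : borelType G -> _).
Proof.
move=> mh; apply: cmeasurableM; last exact: cmeasurable_vphase.
by apply: cmeasurable_conj; exact: (cmeasurable_comp (@measurable_inv G) mh).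
Qed.

(** Inversion need not preserve L^2, but on the single fiber supporting [f] it multiplies the
    integral by a constant. *)
Lemma flip_L2 e f : nice e f -> square_integrable mu (flip f).
Proof.
move=> fn; have /square_integrableP[mf fi] := nice_L2 fn; have [_ _ _ fe] := fn.
apply/square_integrableP; split; first exact: cmeasurable_flip.
have fk t : Delta t <> e -> (sqmod (f t))%:E = 0%E.
  by move=> te; rewrite sq_lt0//; apply: contrapT => /eqP/fe.
have E := ge0_integral_inv_fiber kerO scG (sqm mf) (@sq0 f) fk.
rewrite [X in (X < _)%E](_ : _ = (\int[mu]_s (sqmod (f s^-1%g))%:E)%E); last first.
  by apply: eq_integral => t _; rewrite /flip sqmodM sqmod_conj sqmod_vphase mulr1.
have [e0|e0] := ltP 0 e.
  rewrite ltey; apply/eqP => h; move: fi; rewrite E h gt0_muley ?lte_fin//.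
rewrite [X in (X < _)%E](_ : _ = 0%E) ?ltry// -[RHS](integral0 mu setT).
by apply: eq_integral => t _; apply: fk => te; move: e0; rewrite -te leNgt modular_gt0.
Qed.

Lemma form_flip f g h a b : triform f g (flip h) a b = complex.Re (f a * g b * h (a * b)^-1%g *
  chi a b).
Proof.
rewrite /triform /flip theta_chi rmorphM/= conjCK.
congr complex.Re; rewrite -!mulrA; congr (_ * (_ * (_ * _))).
by rewrite mulrA (mulrC _^*) vphase_mulC mul1r.
Qed.

(** Substitute a = (b c)^-1. The inversion contributes the degree [e] of [f], the left translation
    contributes nothing, and [chi] is invariant under the shift. *)
Lemma form_rotate e f g h b : nice e f -> square_integrable mu (flip h) ->
  cmeasurable (g : borelType G -> _) -> cmeasurable (h : borelType G -> _) ->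
  (\int[mu]_a (triform f g (flip h) a b)%:E = e%:E * \int[mu]_c (triform g h (flip f) b c)%:E)%E.
Proof.
move=> fn hL mg mh; have fL := nice_L2 fn; have [mf _ _ fe] := fn.
have hbL := square_integrable_rmul Delta b hL.
have cL : square_integrable mu (fun a => ((g b)^* * (theta a b)^*) * flip h (a * b)%g).
  apply: (@square_integrable_bdM _ _ _ _ _ _ (sqmod (g b))) => //.
    apply: cmeasurableM => //; apply: cmeasurable_conj; exact: cmeasurable_theta1.
  by move=> t; rewrite sqmodM !sqmod_conj sqmod_theta mulr1.
have iF : mu.-integrable setT (fun a : borelType G => (triform f g (flip h) a b)%:E).
  have [+ _] := square_integrable_prod fL cL; apply: eq_integrable => // a _ /=.
  congr (complex.Re _)%:E; move: (flip h (a * b)%g) (theta a b) => x y.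
  by rewrite !rmorphM/= !conjCK; ring.
rewrite (integral_inv_fiber kerO scG (k := e) iF); last first.
  by move=> t te; rewrite /triform (_ : f t = 0) ?mul0r//; apply: contrapT => /eqP/fe.
have mk : measurable_fun setT (fun c : borelType G => (triform g h (flip f) b c)%:E).
  have mF := measurable_form mg mh (cmeasurable_flip mf).
  exact: (measurableT_comp mF (pair1_measurable (b : borelType G))).
congr (_ * _)%E; rewrite -[RHS](integral_lmul mu b^-1%g mk).
apply: eq_integral => c _; rewrite !form_flip mulVKg.
rewrite -(chi_rot _ c^-1%g b) [(c^-1 * b)^-1%g]invgM invgK.
by congr (complex.Re _)%:E; ring.
Qed.

(** * Moving a central operator around the three slots *)

Section central.
Variables (z zt : L2 mu -> L2 mu).
Hypotheses (zl : linear z) (zadj : forall x y, rinner (z x) y = rinner x (zt y))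
  (zlambda : forall s x, z (lambda s x) = lambda s (z x))
  (zrho : forall b x, z (rho b x) = rho b (z x)).
Local Notation "f ^" := (L2_of mu f) (at level 2, format "f ^").

(* [(z f) * g = z (f * g) = f * (z g)], the convolution being an integral of right
   translates of [f] as well as of left translates of [g]. *)
Lemma form_central_move e e' f g k : nice e f -> nice e' g -> square_integrable mu k ->
  (\int[mu]_b \int[mu]_a (triform (z f^) g k a b)%:E =
   \int[mu]_a \int[mu]_b (triform f (z g^) k a b)%:E)%E.
Proof.
move=> fn gn kL; have fL := nice_L2 fn; have gL := nice_L2 gn.
have fe := L2_ofK fL; have ge := L2_ofK gL; have ke := L2_ofK kL.
have aeid (x : L2 mu) : {ae mu, forall t, x t = x t} by exact: aeW.
transitivity (\int[mu]_b \int[mu]_a (triform f g (zt k^) a b)%:E)%E.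
  apply: eq_integral => b _.
  rewrite (form_integral_right g b (L2_valP (z f^)) kL (aeid _) ke).
  rewrite (form_integral_right g b fL (L2_valP (zt k^)) fe (aeid _)).
  by rewrite -zrho -(linearZ_fun zl) zadj.
have sf := haar_sigma_finite mu scG.
rewrite -(fubini_sf sf (f := fun w => (triform f g (zt k^) w.1 w.2)%:E)); last 2 first.
- have /square_integrableP[mg _] := gL; have [mf _ _ _] := fn.
  by apply: measurable_form => //; exact: cmeasurable_L2.
- exact: integrable_form_left fn gL (L2_valP _).
apply: eq_integral => a _.
rewrite (form_integral_left f a gL (L2_valP (zt k^)) ge (aeid _)).
rewrite (form_integral_left f a (L2_valP (z g^)) kL (aeid _) ke).
by rewrite -zlambda -(linearZ_fun zl) zadj.
Qed.

(** Move [z] from [f] to [g], then rotate for each fixed [b]. The first exchange of integrals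
    converges thanks to [f], the second thanks to [h], while [z g] is only in L^2. *)
Lemma form_central_rotate e f g h e' e'' : nice e f -> nice e' g -> nice e'' h ->
  (\int[mu]_b \int[mu]_a (triform (z f^) g (flip h) a b)%:E =
   e%:E * \int[mu]_b \int[mu]_a (triform (z g^) h (flip f) a b)%:E)%E.
Proof.
move=> fn gn hn; have hL := flip_L2 hn; have fL := flip_L2 fn.
have zgL := L2_valP (z g^); have mzg := cmeasurable_L2 (z g^).
have [mf _ _ _] := fn; have [mh _ _ _] := hn.
have sf := haar_sigma_finite mu scG.
rewrite (form_central_move fn gn hL).
have i1 := integrable_form_left fn zgL hL.
have m1 := measurable_form mf mzg (cmeasurable_flip mh).
rewrite (fubini_sf sf (f := fun w => (triform f (z g^) (flip h) w.1 w.2)%:E) m1 i1) /=.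
have i2 := integrable_form_right hn zgL fL.
have m2 := measurable_form mzg mh (cmeasurable_flip mf).
rewrite -(fubini_sf sf (f := fun w => (triform (z g^) h (flip f) w.1 w.2)%:E) m2 i2) /=.
rewrite -integralZl//; last first.
  exact: (integrable_fubini_sf sf (f := fun w => (triform (z g^) h (flip f) w.1 w.2)%:E) m2 i2).
by apply: eq_integral => b _; exact: form_rotate fn hL mzg mh.
Qed.

(** Three rotations return the form, with [z] on [f], to itself times the product of the degrees.
    The value is finite by absolute convergence, hence zero. *)
Lemma form_central_eq0 e f g h e' e'' : nice e f -> nice e' g -> nice e'' h ->
  e * e' * e'' != 1 ->
  (\int[mu]_a \int[mu]_b (triform f g (zt (flip h)^) a b)%:E = 0)%E.
Proof.
move=> fn gn hn ne.
have fL := nice_L2 fn; have gL := nice_L2 gn; have hL := flip_L2 hn.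
have aeid (x : L2 mu) : {ae mu, forall t, x t = x t} by exact: aeW.
have sf := haar_sigma_finite mu scG.
have [mf _ _ _] := fn; have [mg _ _ _] := gn.
have m1 := measurable_form mf mg (cmeasurable_L2 (zt (flip h)^)).
have i1 := integrable_form_left fn gL (L2_valP (zt (flip h)^)).
have fin := fubini_sf_fin_num sf (f := fun w => (triform f g (zt (flip h)^) w.1 w.2)%:E) m1 i1.
have E : (\int[mu]_a \int[mu]_b (triform f g (zt (flip h)^) a b)%:E =
  \int[mu]_b \int[mu]_a (triform (z f^) g (flip h) a b)%:E)%E.
  rewrite (fubini_sf sf (f := fun w => (triform f g (zt (flip h)^) w.1 w.2)%:E) m1 i1) /=.
  apply: eq_integral => b _.
  rewrite (form_integral_right g b fL (L2_valP (zt (flip h)^)) (L2_ofK fL) (aeid _)).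
  rewrite (form_integral_right g b (L2_valP (z f^)) hL (aeid _) (L2_ofK hL)).
  by rewrite -zrho -(linearZ_fun zl) zadj.
move: fin; rewrite /= E.
have := form_central_rotate fn gn hn; rewrite (form_central_rotate gn hn fn).
rewrite (form_central_rotate hn fn gn).
set X := (\int[mu]_b _)%E => XE /fineK Xf; move: XE; rewrite -Xf -!EFinM => -[].
move: (fine X) => x; rewrite !mulrA => /eqP; rewrite eq_sym -subr_eq0 -[X in _ - X == _]mul1r
  -mulrBl.
by rewrite mulf_eq0 subr_eq0 (negbTE ne) /= => /eqP ->.
Qed.

End central.

End trilinear_form.

(** * Central elements preserve the degree *)

Section modular_grading.
Context {R : realType} {G : lcGroupType} {mu : left_haar_measure R G}
  (Delta : modular_function mu) (omega : cocycle2 R G)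
  (kerO : open (modular_kernel Delta)) (scG : @second_countable G).
Local Notation flip := (flip omega).
Local Notation nice := (nice Delta).
Local Notation "f ^" := (L2_of mu f) (at level 2, format "f ^").
Implicit Types f g h k : G -> R[i].

Lemma flipK f : flip (flip f) = f.
Proof.
apply/funext => t; rewrite /flip invgK rmorphM/= conjCK vphaseV -mulrA.
by rewrite (mulrC _^*) vphase_mulC mulr1.
Qed.

Lemma nice_flip e f : nice e f -> nice e^-1 (flip f).
Proof.
move=> [mf [M fM] fS fe].
have suppE t : (flip f t != 0) = (f t^-1%g != 0).
  by rewrite mulf_eq0 conjC_eq0 (negbTE (cocycle_neq0 _ _ _)) orbF.
split; first exact: cmeasurable_flip.
- by exists M => t; rewrite /flip sqmodM sqmod_conj sqmod_vphase mulr1.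
- have mS := measurable_support mf; set S := [set t | _] in mS fS.
  have [e0|e0] := ltP 0 e; last first.
    rewrite (_ : [set t | _] = set0) ?measure0 ?ltry//.
    apply/seteqP; split=> // t /=; rewrite suppE => /fe h.
    by move: e0; rewrite -h leNgt modular_gt0.
  have m1 : measurable_fun setT (fun t : borelType G => (\1_S t : R)%:E).
    by apply/measurable_EFinP; exact: measurable_indic.
  have E : (mu S = e%:E * \int[mu]_s (\1_S (s^-1)%g)%:E)%E.
    rewrite -(ge0_integral_inv_fiber kerO scG (k := e) m1).
    - by rewrite integral_indic// setIT.
    - by move=> t; rewrite lee_fin.
    - by move=> t te; rewrite indicE memNset// => /fe.
  have -> : mu [set t | flip f t != 0] = (\int[mu]_s (\1_S (s^-1)%g)%:E)%E.
    rewrite -(setIT [set t | flip f t != 0]) -integral_indic//.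
      by apply: eq_integral => t _; rewrite !indicE; congr ((_ : bool)%:R%:E); apply/idP/idP;
        rewrite !inE /S /= suppE.
    by apply: measurable_support; exact: cmeasurable_flip.
  by rewrite ltey; apply/eqP => h; move: fS; rewrite E h gt0_muley ?lte_fin.
by move=> t; rewrite suppE => /fe; rewrite modularV => <-; rewrite invrK.
Qed.

Lemma nice_indic (e : R) (c : R[i]) (A : set (borelType G)) : measurable A -> (mu A < +oo)%E ->
  A `<=` Delta @^-1` [set e] -> nice e (fun t => c * (\1_A t)%:C).
Proof.
move=> mA Aoo Ae; have supp t : c * (\1_A t)%:C != 0 -> A t.
  by apply: contra_neqP => nA; rewrite indicE memNset// mulr0.
split.
- by apply: cmeasurableM; [exact: cmeasurable_cst|exact: cmeasurable_indic].
- exists (sqmod c) => t; rewrite sqmodM indicE; case: (t \in A) => /=.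
    by rewrite /sqmod /= expr1n expr0n addr0 mulr1.
  by rewrite {2}/sqmod /= !expr0n addr0 mulr0 sqmod_ge0.
- apply: le_lt_trans Aoo; apply: le_measure; rewrite ?inE//.
  apply: measurable_support.
  by apply: cmeasurableM; [exact: cmeasurable_cst|exact: cmeasurable_indic].
- by move=> t /supp /Ae.
Qed.

(** The projection p_e on functions, indexed by all reals; it is zero when [e] is not a value of
    [Delta]. *)
Definition degree_fun (e : R) f : G -> R[i] := fun t => (\1_(Delta @^-1` [set e]) t)%:C * f t.
Definition degree_part (e : R) (x : L2 mu) : L2 mu := L2_of mu (degree_fun e x).

Lemma degree_fun_L2 e f : square_integrable mu f -> square_integrable mu (degree_fun e f).
Proof.
apply: (@square_integrable_bdM _ _ _ _ _ _ 1).
  by apply: cmeasurable_indic; exact: measurable_modular_preimage.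
by move=> t; rewrite indicE; case: (_ \in _); rewrite /sqmod /= ?expr1n ?expr0n ?addr0.
Qed.

Lemma degree_partE e (x : L2 mu) : {ae mu, forall t, degree_part e x t = degree_fun e x t}.
Proof. exact/L2_ofK/degree_fun_L2/L2_valP. Qed.

Lemma degree_fun_id e f t : Delta t = e -> degree_fun e f t = f t.
Proof. by move=> te; rewrite /degree_fun indicE mem_set ?mul1r. Qed.

Lemma degree_fun0 e f t : Delta t <> e -> degree_fun e f t = 0.
Proof. by move=> te; rewrite /degree_fun indicE memNset ?mul0r. Qed.

Lemma rinner_degree_part e (x y : L2 mu) : rinner (degree_part e x) y = rinner x (degree_part e
  y).
Proof.
have xL := L2_valP x; have yL := L2_valP y.
have aeid (u : L2 mu) : {ae mu, forall t, u t = u t} by exact: aeW.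
apply: EFin_inj; rewrite (rinner_L2E (degree_fun_L2 e xL) yL (degree_partE e x) (aeid y)).
rewrite (rinner_L2E xL (degree_fun_L2 e yL) (aeid x) (degree_partE e y)).
apply: eq_integral => t _; congr (complex.Re _)%:E.
rewrite /degree_fun rmorphM/= -mulrA mulrCA; congr (_ * (_ * _)).
exact/esym/conjc_real.
Qed.

(** Uncountably many [e] are allowed, but only countably many fibers are nonempty and
    [modular_index] numbers them, so the exceptional null sets have a null union. *)
Lemma ae_fibers (P : G -> Prop) :
  (forall e, {ae mu, forall t, Delta t = e -> P t}) -> {ae mu, forall t, P t}.
Proof.
move=> Pe; have [idx idxP] := modular_index kerO scG.
have : {ae mu, forall t, forall n, idx (Delta t) = n -> P t}.
  apply: ae_foralln => n.
  have [[t0 t0n]|no] := pselect (exists t0, idx (Delta t0) = n); last first.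
    by apply: aeW => t tn; case: no; exists t.
  have := Pe (Delta t0); move=> [N [mN N0 PN]]; exists N; split=> // t /= h; apply: PN => h2.
  by apply: h => tn; apply: h2; apply: idxP; rewrite tn.
by move=> [N [mN N0 PN]]; exists N; split=> // t /= nP; apply: PN => h; apply: nP; exact: h.
Qed.

(** Cut by the size of [x], by a cover with sets of finite measure, and by the fibers of [Delta];
    the triples of indices are encoded as one natural number. *)
Lemma nice_truncate (x : L2 mu) : exists S : nat -> set (borelType G),
  (forall t, exists n, S n t) /\
  forall n, measurable (S n) /\ exists e, nice e (fun t => (\1_(S n) t)%:C * x t).
Proof.
have [F FT Fo] := haar_sigma_finite mu scG; have [idx idxP] := modular_index kerO scG.
have mx := cmeasurable_L2 x.
pose S (m l p : nat) : set (borelType G) :=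
  [set t | sqmod (x t) <= m%:R] `&` F l `&` [set t | idx (Delta t) = p].
have mS m l p : measurable (S m l p).
  apply: measurableI; last exact: (measurable_modular_preimage kerO (idx @^-1` [set p])).
  apply: measurableI; last by have [] := Fo l.
  rewrite -[X in measurable X]setTI.
  by apply: measurable_fun_le => //; exact: cmeasurable_sqmod.
exists (fun n => let w := unpickle n in
  if w is Some (m, l, p) then S m l p else set0); split=> [t|n].
  have [l _ Ft] : (\bigcup_i F i) t by rewrite -FT.
  exists (pickle ((Num.truncn (sqmod (x t))).+1, l, idx (Delta t))).
  rewrite pickleK; split=> //; split=> //=.
  by rewrite ltW// truncnS_gt.
case: (@unpickle (nat * nat * nat)%type n) => [[[m l] p]|]; last first.
  split; first exact: measurable0.
  exists 0; split.
  - by apply: cmeasurableM; [apply: cmeasurable_indic; exact: measurable0|exact: mx].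
  - by exists 0 => t; rewrite indicE in_set0 mul0r /sqmod /= expr0n addr0.
  - by rewrite (_ : [set t | _] = set0) ?measure0 ?ltry//; apply/seteqP; split=> // t /=;
    rewrite indicE in_set0 mul0r eqxx.
  - by move=> t; rewrite indicE in_set0 mul0r eqxx.
split; first exact: mS.
have supp t : (\1_(S m l p) t)%:C * x t != 0 -> S m l p t.
  by apply: contra_neqP => nA; rewrite indicE memNset// mul0r.
have mf : cmeasurable (fun t : borelType G => (\1_(S m l p) t)%:C * x t).
  by apply: cmeasurableM; [apply: cmeasurable_indic; exact: mS|exact: mx].
have suppF : (mu [set t | ((\1_(S m l p) t)%:C * x t != 0)%R] < +oo)%E.
  apply: le_lt_trans (Fo l).2; apply: le_measure; rewrite ?inE//.
  - exact: measurable_support.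
  - by have [] := Fo l.
  - by move=> t /= /supp[[]].
have bd : exists M, forall t, sqmod ((\1_(S m l p) t)%:C * x t) <= M.
  exists m%:R => t; rewrite indicE; have [h|h] := boolP (t \in S m l p).
    by move: h; rewrite inE => -[[]]; rewrite mul1r.
  by rewrite mul0r /sqmod /= expr0n addr0.
have [[t0 t0S]|no] := pselect (exists t0, S m l p t0).
  exists (Delta t0); split=> // t /supp[_ /= tp]; apply: idxP.
  by rewrite tp; case: t0S.
by exists 0; split=> // t /supp St; case: no; exists t.
Qed.

(** Pairing [x] with its own truncations shows that the integral of [sqmod x] vanishes on each set
    of a countable cover. *)
Lemma nice_separates (x : L2 mu) :
  (forall e k, nice e k -> rinner x k^ = 0) -> x = 0.
Proof.
move=> h; apply: rinner_eq0; have [S [ScT Sn]] := nice_truncate x.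
have xL := L2_valP x; have aeid : {ae mu, forall t, x t = x t} by exact: aeW.
have : {ae mu, forall t, forall n, S n t -> x t = 0}.
  apply: ae_foralln => n; have [mS [e en]] := Sn n.
  have nL := nice_L2 en; have E := rinner_L2E xL nL aeid (L2_ofK nL).
  have {}E : (\int[mu]_t (complex.Re (x t * ((\1_(S n) t)%:C * x t)^*))%:E = 0)%E.
    by rewrite -E (h _ _ en).
  have E2 : (\int[mu]_t `|(\1_(S n) t * sqmod (x t))%:E| = 0)%E.
    rewrite -[RHS]E; apply: eq_integral => t _; rewrite indicE; case: (t \in S n) => /=.
      by rewrite !mul1r Re_mul_conj ger0_norm ?sqmod_ge0.
    by rewrite !mul0r rmorph0 mulr0 normr0.
  have mq : measurable_fun setT (fun t : borelType G => (\1_(S n) t * sqmod (x t))%:E).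
    apply/measurable_EFinP; apply: measurable_funM; first exact: measurable_indic.
    by apply: cmeasurable_sqmod; exact: cmeasurable_L2.
  have /(ae_eq_integral_abs mu measurableT mq) [N [mN N0 PN]] := E2.
  exists N; split=> // t /= hx; apply: PN => h0; apply: hx => St; have [] := h0 I.
  by rewrite indicE mem_set// mul1r => /sqmod_eq0.
move=> [N [mN N0 PN]]; apply: EFin_inj; rewrite (rinner_sqmod xL aeid).
have mq : measurable_fun setT (fun t : borelType G => (sqmod (x t))%:E).
  by apply/measurable_EFinP/cmeasurable_sqmod; exact: cmeasurable_L2.
rewrite -[RHS](integral0 mu setT); apply: ae_eq_integral => //.
exists N; split=> // t /= hx; apply: PN => h0; apply: hx => _.
by have [n Snt] := ScT t; rewrite (h0 n Snt) /sqmod /= expr0n addr0.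
Qed.

End modular_grading.

Section central_degree.
Context {R : realType} {G : lcGroupType} {mu : left_haar_measure R G}
  (Delta : modular_function mu) (omega : cocycle2 R G)
  (kerO : open (modular_kernel Delta)) (scG : @second_countable G).
Local Notation lambda := (lambda mu omega).
Local Notation theta := (theta omega).
Local Notation rho := (rho omega).
Local Notation triform := (triform omega).
Local Notation nice := (nice Delta).
Local Notation degree_part := (degree_part Delta).
Local Notation "f ^" := (L2_of mu f) (at level 2, format "f ^").
Implicit Types f g h k : G -> R[i].

Variables (z zt : L2 mu -> L2 mu).
Hypotheses (zl : linear z) (zadj : forall x y, rinner (z x) y = rinner x (zt y))
  (zlambda : forall s x, z (lambda s x) = lambda s (z x))
  (zrho : forall b x, z (rho b x) = rho b (z x)).

(** [form_central_eq0] applied to indicators of subsets of [A] and [B], of degrees [e] and 1, and to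
    [flip k], of degree d^-1. The form then vanishes on all rectangles, hence almost everywhere. *)
Lemma adjoint_degree_box d e k (A B : set (borelType G)) : nice d k -> e != d ->
  measurable A -> (mu A < +oo)%E -> A `<=` Delta @^-1` [set e] ->
  measurable B -> (mu B < +oo)%E -> B `<=` Delta @^-1` [set 1] ->
  {ae mu, forall a, {ae mu, forall b, A a -> B b -> zt k^ (a * b)%g = 0}}.
Proof.
move=> kn ed mA Aoo Ae mB Boo B1.
(* [k] may be zero, so [d = 0] can occur; then [d^-1] is 0 and the product is 0. *)
have ne : e * 1 * d^-1 != 1.
  apply: contra ed; rewrite mulr1; have [->|d0] := eqVneq d 0.
    by rewrite invr0 mulr0 eq_sym oner_eq0.
  by rewrite (can2_eq (divfK d0) (mulfK d0)) mul1r.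
(* The form sees real parts only; taking the scalar [c] to be 1 and then i recovers both parts of
   the value. *)
pose u : R[i] -> G * G -> R := fun c w => triform (fun a => c * (\1_A a)%:C) (fun b => 1 * (\1_B
  b)%:C) (zt k^) w.1 w.2.
have part c : {ae mu, forall a, {ae mu, forall b, u c (a, b) = 0}}.
  have An := nice_indic c mA Aoo Ae; have Bn := nice_indic 1 mB Boo B1.
  have [mAf _ _ _] := An; have [mBf _ _ _] := Bn.
  have sf := haar_sigma_finite mu scG.
  apply: (rectangle_integral0_ae sf (f := u c)).
  - have [+ _] := cmeasurable_form omega scG mAf mBf (cmeasurable_L2 (zt k^)). exact.
  - have := integrable_form_left omega scG An (nice_L2 Bn) (L2_valP (zt k^)); exact.
  move=> A' B' mA' mB'.
  have An' : nice e (fun a => c * (\1_(A `&` A') a)%:C).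
    apply: nice_indic; first exact: measurableI.
      by apply: le_lt_trans Aoo; apply: le_measure; rewrite ?inE//; exact: measurableI.
    by move=> a [/Ae].
  have Bn' : nice 1 (fun a => 1 * (\1_(B `&` B') a)%:C).
    apply: nice_indic; first exact: measurableI.
      by apply: le_lt_trans Boo; apply: le_measure; rewrite ?inE//; exact: measurableI.
    by move=> a [/B1].
  have := form_central_eq0 kerO scG zl zadj zlambda zrho An' Bn' (nice_flip omega kerO scG kn) ne.
  rewrite flipK => <-; apply: eq_integral => a _; apply: eq_integral => b _.
  congr (_%:E); rewrite /u /triform !indicE !in_setI /=.
  by case: (a \in A); case: (b \in B); case: (a \in A'); case: (b \in B');
    rewrite /= ?(mulr0, mul0r, mul1r, mulr1).
have [U1 Ui] := (part 1, part (0 +i* 1)).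
apply: (ae_imply2 U1 Ui) => a u1a uia; apply: (ae_imply2 u1a uia) => b u1 ui Aa Bb.
have uE c : u c (a, b) = complex.Re (c * ((zt k^ (a * b)%g)^* * theta a b)).
  rewrite /u /triform /= !indicE !mem_set//.
  have -> : ((1%:R : R)%:C : R[i]) = 1 by [].
  by congr complex.Re; ring.
apply: sqmod_eq0; rewrite -[LHS]mulr1 -(sqmod_theta omega a b) -sqmod_conj -sqmodM.
move: u1 ui; rewrite !uE; case: (_ * theta a b) => x y /=.
rewrite mul1r mul0r subr0 => -> /eqP; rewrite mul0r mul1r sub0r oppr_eq0 => /eqP ->.
by rewrite /sqmod /= expr0n addr0.
Qed.

(** Countably many boxes cover the fiber of [e] times the kernel. Unless that fiber is null, some
    [a] in it is good for all of them; left translation by [a] carries the kernel onto the fiber and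
    preserves null sets. *)
Lemma adjoint_degree d e k : nice d k -> e != d ->
  {ae mu, forall t, Delta t = e -> zt k^ t = 0}.
Proof.
move=> kn ed; have [F FT Fo] := haar_sigma_finite mu scG.
pose D r : set (borelType G) := Delta @^-1` [set r].
have mD r : measurable (D r) by exact: measurable_modular_preimage.
have oo r n : (mu (F n `&` D r) < +oo)%E.
  apply: le_lt_trans (Fo n).2; apply: le_measure; rewrite ?inE//; last exact: (Fo n).1.
  by apply: measurableI; first exact: (Fo n).1.
have box n m := adjoint_degree_box kn ed (measurableI _ _ (Fo n).1 (mD e)) (oo e n)
  (@subIsetr _ _ _) (measurableI _ _ (Fo m).1 (mD 1)) (oo 1 m) (@subIsetr _ _ _).
have all_box : {ae mu, forall a, forall n, forall m, {ae mu, forall b, (F n `&` D e) a -> (F m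
  `&` D 1) b ->
    zt k^ (a * b)%g = 0}}.
  by apply: ae_foralln => n; apply: ae_foralln => m; exact: box.
have [null|/eqP pos] := eqVneq (mu (D e)) 0%E.
  exists (D e); split=> // t /= h; apply: contrapT => nt; apply: h => te; exfalso; exact: (nt te).
have [a Da aP] : exists2 a, D e a & forall n m, {ae mu, forall b, (F n `&` D e) a -> (F m `&` D
  1) b ->
    zt k^ (a * b)%g = 0}.
  apply: contrapT => no; apply: pos; have [N [mN N0 NP]] := all_box.
  apply: (subset_measure0 (mD e) mN _ N0) => t Dt; apply: NP => h.
  by apply: no; exists t => // n m; exact: h.
have [n _ Fa] : (\bigcup_i F i) a by rewrite -FT.
have ab : {ae mu, forall b, Delta b = 1 -> zt k^ (a * b)%g = 0}.
  have := ae_foralln (fun m => aP n m).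
  move=> [N [mN N0 NP]]; exists N; split=> // b /= hb; apply: NP => h; apply: hb => b1.
  have [m _ Fb] : (\bigcup_i F i) b by rewrite -FT.
  exact: (h m).
have [N [mN N0 NP]] := haar_ae_lmul a^-1%g ab; exists N; split=> // t /= ht; apply: NP => h;
  apply: ht => te.
have := h; rewrite /= modularM modularV te (_ : Delta a = e)// mulVf;
  last by rewrite -te modular_neq0.
by move=> /(_ erefl); rewrite mulVKg.
Qed.

Lemma degree_part_adjoint d e k : nice d k ->
  degree_part e (zt k^) = if e == d then zt k^ else 0.
Proof.
move=> kn; apply: L2_ext; have [->|ed] := eqVneq e d.
  have : {ae mu, forall t, Delta t <> d -> zt k^ t = 0}.
    apply: (ae_fibers kerO scG) => r; have [->|rd] := eqVneq r d;
      first by apply: aeW => t td /(_ td).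
    have [N [mN N0 NP]] := adjoint_degree kn rd.
    by exists N; split=> // t /= ht; apply: NP => h; apply: ht => tr _; exact: h.
  move=> h; apply: (ae_imply2 (degree_partE kerO d (zt k^)) h) => t -> zt0.
  have [td|td] := pselect (Delta t = d); first by rewrite degree_fun_id.
  by rewrite degree_fun0// zt0.
have zeroE : {ae mu, forall t, L2_val (0 : L2 mu) t = 0} by exact/L2_ofK/square_integrable0.
have := ae_imply2 (degree_partE kerO e (zt k^)) (adjoint_degree kn ed) => c.
have {}c : {ae mu, forall t, degree_part e (zt k^) t = 0}.
  apply: c => t -> zt0.
  have [td|td] := pselect (Delta t = e); first by rewrite degree_fun_id// zt0.
  by rewrite degree_fun0.
by apply: (ae_imply2 c zeroE) => t -> ->.
Qed.

Lemma degree_part_nice d e k : nice d k -> degree_part e k^ = if e == d then k^ else 0.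
Proof.
move=> kn; have kL := nice_L2 kn; have [_ _ _ kd] := kn.
have zeroE : {ae mu, forall t, L2_val (0 : L2 mu) t = 0} by exact/L2_ofK/square_integrable0.
have ke := ae_imply2 (degree_partE kerO e k^) (L2_ofK kL).
apply: L2_ext; have [->|ed] := eqVneq e d.
  apply: (ae_imply2 (degree_partE kerO d k^) (L2_ofK kL)) => t -> kt.
  have [td|td] := pselect (Delta t = d); first by rewrite degree_fun_id.
  by rewrite degree_fun0// kt; apply/esym/eqP; apply: contrapT => /negP/kd.
have {}ke : {ae mu, forall t, degree_part e k^ t = 0}.
  apply: ke => t -> kt.
  have [td|td] := pselect (Delta t = e); last by rewrite degree_fun0.
  rewrite degree_fun_id// kt; apply/eqP; apply: contrapT => /negP/kd h.
  by move: ed; rewrite -td h eqxx.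
by apply: (ae_imply2 ke zeroE) => t -> ->.
Qed.

(** Tested against [k] of degree [d], both sides become the pairing of [x] with [zt k] if [e = d],
    and 0 otherwise. *)
Lemma central_degree_part e x : z (degree_part e x) = degree_part e (z x).
Proof.
apply/eqP; rewrite -subr_eq0; apply/eqP.
apply: (nice_separates kerO scG) => d k kn.
rewrite rinnerBl zadj (rinner_degree_part kerO) (degree_part_adjoint e kn) [rinner (degree_part
  _ _) _](rinner_degree_part kerO) (degree_part_nice e kn).
case: ifP => _; first by rewrite zadj subrr.
have r0 (y : L2 mu) : rinner y 0 = 0 by rewrite rinnerC /rinner inner0l.
by rewrite !r0 subrr.
Qed.

End central_degree.

(** * Central elements lie in the algebra of the kernel *)

Section lambda_group.
Context {R : realType} {G : lcGroupType} {mu : left_haar_measure R G}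
  (omega : cocycle2 R G).
Local Notation lambda := (lambda mu omega).

Lemma lambdaZ s c x : lambda s (c *: x) = c *: lambda s x.
Proof. exact: (linearZ_fun (@lambda_linear R G mu omega s)). Qed.

(** lambda(s^-1) inverts lambda(s) only up to two phases: the cocycle value of the product, and
    omega(1, 1), by which lambda(1) multiplies. *)
Definition lambda_inv (s : G) (x : L2 mu) : L2 mu :=
  (omega s s^-1%g * omega 1%g 1%g)^-1 *: lambda s^-1%g x.

Lemma lambda_invK s : cancel (lambda_inv s) (lambda s).
Proof.
move=> x; rewrite /lambda_inv lambdaZ lambdaM mulgV lambda1 !scalerA mulVf ?scale1r//.
by rewrite mulf_neq0 ?cocycle_neq0.
Qed.

Lemma lambdaK s : cancel (lambda s) (lambda_inv s).
Proof.
move=> x; rewrite /lambda_inv lambdaM mulVg lambda1 !scalerA.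
have -> : omega s^-1%g s = omega s s^-1%g by exact/esym/cocyclexV.
by rewrite mulVf ?scale1r// mulf_neq0 ?cocycle_neq0.
Qed.

Lemma lambda_exchange (s t s' t' : G) : (s * t = s' * t')%g ->
  exists c : R[i], forall x, lambda s (lambda t x) = c *: lambda s' (lambda t' x).
Proof.
move=> e; exists (omega s t / omega s' t') => x.
by rewrite !lambdaM e scalerA mulfVK ?cocycle_neq0.
Qed.

Lemma lambda_bounded s : bounded_operator (lambda s).
Proof.
apply/bounded_operatorP; split; first exact: lambda_linear.
by exists 1 => // x; rewrite mul1r /rinner lambda_isometry.
Qed.

Lemma rinner_lambda s x y : rinner (lambda s x) (lambda s y) = rinner x y.
Proof. by rewrite /rinner lambda_isometry. Qed.

Lemma rinner_lambda_inv s x y : rinner (lambda_inv s x) (lambda_inv s y) = rinner x y.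
Proof. by rewrite -(rinner_lambda s) !lambda_invK. Qed.

Lemma lambda_inv_linear s : linear (lambda_inv s).
Proof.
move=> a x y; rewrite /lambda_inv (@lambda_linear R G mu omega s^-1%g) scalerDr.
move: (lambda _ x) (lambda _ y) (_^-1) => u v c.
by rewrite !scalerA (mulrC a).
Qed.

End lambda_group.

(** * Extension of a corner to the commutant of the left translations *)

Section gluing.
Context {R : realType} {G : lcGroupType} {mu : left_haar_measure R G}
  (Delta : modular_function mu) (omega : cocycle2 R G)
  (kerO : open (modular_kernel Delta)) (scG : @second_countable G).
Local Notation lambda := (lambda mu omega).
Local Notation lambda_inv := (@lambda_inv R G mu omega).
Local Notation degree_part := (degree_part Delta).

Lemma lambda_degree_part r e x :
  lambda r (degree_part e x) = degree_part (Delta r * e) (lambda r x).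
Proof.
apply: L2_ext.
have e1 := lambdaE omega r (degree_part e x).
have e2 := haar_ae_lmul r^-1%g (degree_partE kerO e x).
have e3 := degree_partE kerO (Delta r * e) (lambda r x).
have e4 := lambdaE omega r x.
near=> t.
have -> : lambda r (degree_part e x) t = twisted_translate omega r (degree_part e x) t by near: t.
have -> : degree_part (Delta r * e) (lambda r x) t = degree_fun Delta (Delta r * e) (lambda r x)
  t by near: t.
rewrite /twisted_translate.
have -> : degree_part e x (r^-1 * t)%g = degree_fun Delta e x (r^-1 * t)%g by near: t.
have [te|te] := pselect (Delta t = Delta r * e).
  rewrite degree_fun_id; last by rewrite modularM modularV te mulKf ?modular_neq0.
  rewrite degree_fun_id//.
  have -> : lambda r x t = twisted_translate omega r x t by near: t.
  by [].
rewrite degree_fun0 ?mulr0; last first.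
  by move=> h; apply: te; rewrite -h modularM modularV mulVKf ?modular_neq0.
by rewrite degree_fun0.
Unshelve. all: by end_near. Qed.

Lemma degree_part_linear e : linear (degree_part e).
Proof.
move=> a x y; apply: L2_ext.
have e1 := degree_partE kerO e (a *: x + y).
have e2 := degree_partE kerO e x; have e3 := degree_partE kerO e y.
have e4 := L2_linE a x y; have e5 := L2_linE a (degree_part e x) (degree_part e y).
near=> t.
have -> : L2_val (degree_part e (a *: x + y)) t = degree_fun Delta e (L2_val (a *: x + y)) t by
  near: t.
have -> : L2_val (a *: degree_part e x + degree_part e y) t = a * degree_part e x t +
  degree_part e y t by near: t.
have -> : degree_part e x t = degree_fun Delta e (L2_val x) t by near: t.
have -> : degree_part e y t = degree_fun Delta e (L2_val y) t by near: t.
rewrite /degree_fun.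
have -> : L2_val (a *: x + y) t = a * L2_val x t + L2_val y t by near: t.
by rewrite mulrDr mulrCA.
Unshelve. all: by end_near. Qed.

Lemma rinner_degree_part_self e x :
  ((rinner (degree_part e x) (degree_part e x))%:E =
   \int[mu]_(t in Delta @^-1` [set e]) (sqmod (x t))%:E)%E.
Proof.
rewrite (rinner_sqmod (degree_fun_L2 kerO e (L2_valP x)) (degree_partE kerO e x)).
rewrite [RHS]integral_mkcond; apply: eq_integral => t _; rewrite patchE /degree_fun indicE.
by case: ifP => _; rewrite ?mul1r// mul0r /sqmod /= expr0n addr0.
Qed.

Variables (T : L2 mu -> L2 mu) (Tb : bounded_operator T)
  (Tker : forall k x, Delta k = 1 -> T (lambda k x) = lambda k (T x)).
Variables (e : R) (e0 : e != 0).

Let Tl : linear T. Proof. by case: Tb. Qed.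

(** Compressed on the right only: the projection onto the target fiber is made by [glue_fun], which
    reads each conjugate on its own fiber. *)
Definition compressed x := T (degree_part e x).

Let Sl : linear compressed.
Proof. by move=> a x y; rewrite /compressed degree_part_linear Tl. Qed.

Let Sker k x : Delta k = 1 -> compressed (lambda k x) = lambda k (compressed x).
Proof. by move=> k1; rewrite /compressed -Tker// lambda_degree_part k1 mul1r. Qed.

Definition conjugated (s : G) x := lambda s (compressed (lambda_inv s x)).

(** Write r s = s' k with k in the kernel; lambda(k) commutes with [compressed], and the phase
    cancels against the one in [lambda_inv]. With r = 1 it shows that [conjugated s] depends only on
    [Delta s]. *)
Lemma lambda_conjugated r s s' x : Delta s' = Delta r * Delta s ->
  lambda r (conjugated s x) = conjugated s' (lambda r x).
Proof.
move=> D; pose k := (s'^-1 * (r * s))%g.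
have k1 : Delta k = 1 by rewrite !modularM modularV D mulVf// mulf_neq0 ?modular_neq0.
have [c cP] := @lambda_exchange R G mu omega r s s' k ltac:(by rewrite /k mulVKg).
rewrite -{2}(lambda_invK omega s x); set y := lambda_inv s x.
rewrite /conjugated -/y !cP (linearZ_fun (@lambda_inv_linear R G mu omega s')).
rewrite (lambdaK omega s').
rewrite (linearZ_fun Sl).
rewrite [RHS](lambdaZ omega s').
by rewrite (Sker _ k1).
Qed.

Lemma conjugated_fiber s x : Delta s = 1 -> conjugated s x = compressed x.
Proof.
by move=> s1; rewrite /conjugated -Sker// lambda_invK.
Qed.

(** The conjugate by [s] sees only the part of [x] over the fiber of [Delta s * e]. Keeping that
    restriction in the bound is what makes the bounds summable over the fibers. *)
Lemma conjugated_norm : exists2 C : R, 0 <= C & forall s x,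
  ((rinner (conjugated s x) (conjugated s x))%:E <=
   C%:E * \int[mu]_(t in Delta @^-1` [set (Delta s * e)%R]) (sqmod (x t))%:E)%E.
Proof.
have /bounded_operatorP[_ [C C0 TC]] := Tb; exists C => // s x.
rewrite -rinner_degree_part_self -EFinM lee_fin /conjugated rinner_lambda.
have -> : degree_part (Delta s * e) x = lambda s (degree_part e (lambda_inv s x)).
  by rewrite lambda_degree_part lambda_invK.
by rewrite rinner_lambda; exact: TC.
Qed.

Variables (idx : R -> nat) (s_ : nat -> G).
Hypotheses (idxP : forall s t, idx (Delta s) = idx (Delta t) -> Delta s = Delta t)
  (s_idx : forall t, Delta (s_ (idx (Delta t))) = Delta t).

(* The sum over representatives of G / ker Delta in the header: on the fiber
   [Delta t = Delta s] it is given by its term [conjugated s]. *)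
Definition glue_fun x : G -> R[i] := fun t => conjugated (s_ (idx (Delta t))) x t.
Definition glued x : L2 mu := L2_of mu (glue_fun x).

Let D n : set (borelType G) := [set t | idx (Delta t) = n].

Let mD n : measurable (D n).
Proof. exact: (measurable_modular_preimage kerO (idx @^-1` [set n])). Qed.

Let DT : \bigcup_n D n = setT.
Proof. by apply/seteqP; split=> // t _; exists (idx (Delta t)). Qed.

Let trivD : trivIset setT D.
Proof. by apply/trivIsetP => m n _ _ mn; apply/seteqP; split=> // t [/= tm tn]; move/eqP: mn;
  apply; rewrite -tm. Qed.

Let measurable_glue_part (p : R[i] -> R) x :
  (forall y : L2 mu, measurable_fun setT (fun t : borelType G => p (y t))) ->
  measurable_fun setT (fun t : borelType G => p (glue_fun x t)).
Proof.
move=> py; rewrite -DT; apply/measurable_fun_bigcup => // n.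
apply: (@eq_measurable_fun _ _ _ _ _ (fun t : borelType G => p (conjugated (s_ n) x t))).
  by move=> t; rewrite inE /D /= /glue_fun => ->.
exact: measurable_funTS.
Qed.

(** Sum [conjugated_norm] over the target fibers [D n]. The source fibers are again disjoint because
    multiplication by the nonzero [e] is injective, so the constant does not grow. *)
Lemma glue_sqmod : exists2 C : R, 0 <= C & forall x, cmeasurable (glue_fun x : borelType G -> _)
  /\
  (\int[mu]_t (sqmod (glue_fun x t))%:E <= C%:E * \int[mu]_t (sqmod (x t))%:E)%E.
Proof.
have [C C0 CP] := conjugated_norm; exists C => // x.
have mg : cmeasurable (glue_fun x : borelType G -> _).
  by split; apply: measurable_glue_part => y; have [] := cmeasurable_L2 y.
have sq0 (y : G -> R[i]) t : (0 <= (sqmod (y t))%:E)%E by rewrite lee_fin sqmod_ge0.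
have mq (y : L2 mu) : measurable_fun setT (fun t : borelType G => (sqmod (y t))%:E).
  by apply/measurable_EFinP/cmeasurable_sqmod; exact: cmeasurable_L2.
split=> //.
(* The source fiber feeding the target fiber [D n]; it is empty when no value of [Delta] has number
   [n]. *)
pose E n : set (borelType G) := [set t | idx (Delta t / e) = n /\ exists2 u, D n u & Delta t =
  Delta u * e].
have mE n : measurable (E n).
  exact: (measurable_modular_preimage kerO [set r | idx (r / e) = n /\ exists2 u, D n u & r =
    Delta u * e]).
have trivE : trivIset setT E.
  by apply/trivIsetP => m n _ _ mn; apply/seteqP; split=> // t [/= [h1 _] [h2 _]]; move/eqP: mn;
    apply; rewrite -h1.
rewrite -{1}DT ge0_integral_bigcup//; last by rewrite DT;
  exact/measurable_EFinP/cmeasurable_sqmod.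
apply: (@le_trans _ _ (\sum_(n <oo) C%:E * \int[mu]_(t in E n) (sqmod (x t))%:E)%E).
  apply: lee_nneseries => [n _ _|n _]; first exact: integral_ge0.
  have [[u Du]|no] := pselect (exists u, D n u); last first.
    rewrite (_ : D n = set0) ?integral_set0; first by rewrite mule_ge0 ?integral_ge0.
    by apply/seteqP; split=> // t Dt; case: no; exists t.
  have un : Delta (s_ n) = Delta u by rewrite -Du s_idx.
  apply: (@le_trans _ _ (\int[mu]_(t in D n) (sqmod (conjugated (s_ n) x t))%:E)%E).
    rewrite le_eqVlt; apply/orP; left; apply/eqP; apply: eq_integral => t.
    by rewrite inE /D /= /glue_fun => ->.
  apply: (@le_trans _ _ (\int[mu]_t (sqmod (conjugated (s_ n) x t))%:E)%E).
    by apply: ge0_subset_integral.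
  have aeid (y : L2 mu) : {ae mu, forall t, y t = y t} by exact: aeW.
  rewrite -(rinner_sqmod (L2_valP _) (aeid _)) (le_trans (CP _ _))// un.
  suff -> : Delta @^-1` [set Delta u * e] = E n by [].
  apply/seteqP; split=> t; rewrite /E /=; last by move=> [_ [u' Du' ->]];
    rewrite (idxP (s := u') (t := u)) ?Du ?Du'.
  by move=> ->; split; [rewrite mulfK|exists u].
rewrite nneseriesZl; last by move=> n _; exact: integral_ge0.
rewrite -ge0_integral_bigcup//; last exact: measurable_funTS.
by rewrite lee_wpmul2l ?lee_fin// ge0_subset_integral//; exact: bigcup_measurable.
Qed.

Lemma glue_L2 x : square_integrable mu (glue_fun x).
Proof.
have [C C0 CP] := glue_sqmod; have [mg h] := CP x; apply/square_integrableP; split=> //.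
apply: le_lt_trans h _; rewrite lte_mul_pinfty ?lee_fin//.
by have /square_integrableP[] := L2_valP x.
Qed.

Lemma glueE x : {ae mu, forall t, glued x t = glue_fun x t}.
Proof. exact: L2_ofK (glue_L2 x). Qed.

Lemma glue_bounded : bounded_operator glued.
Proof.
apply/bounded_operatorP; split.
  move=> a x y; have [u uxy] : exists u : L2 mu, u = a *: x + y by exists (a *: x + y).
  rewrite -uxy.
  have uE n t : L2_val (conjugated (s_ n) u) t = L2_val (a *: conjugated (s_ n) x + conjugated
    (s_ n) y) t.
    by congr (L2_val _ t); rewrite uxy /conjugated (@lambda_inv_linear R G mu omega) Sl
      (@lambda_linear R G mu omega).
  have e5 : {ae mu, forall t, forall n, L2_val (conjugated (s_ n) u) t =
      a * L2_val (conjugated (s_ n) x) t + L2_val (conjugated (s_ n) y) t}.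
    apply: ae_foralln => n; have := L2_linE a (conjugated (s_ n) x) (conjugated (s_ n) y).
    by move=> h; apply: (ae_imply2 h h) => t ht _; exact: etrans (uE n t) ht.
  have h1 : {ae mu, forall t, L2_val (glued u) t = a * glue_fun x t + glue_fun y t}.
    by apply: (ae_imply2 (glueE u) e5) => t -> /(_ (idx (Delta t))).
  have h2 : {ae mu, forall t, a * L2_val (glued x) t + L2_val (glued y) t = a * glue_fun x t +
    glue_fun y t}.
    apply: (ae_imply2 (glueE x) (glueE y)) => t p q.
    exact: (congr2 (fun v v' => a * v + v') p q).
  have h3 : {ae mu, forall t, L2_val (glued u) t = a * L2_val (glued x) t + L2_val (glued y) t}.
    by apply: (ae_imply2 h1 h2) => t p q; exact: etrans p (esym q).
  apply: L2_ext; apply: (ae_imply2 h3 (L2_linE a (glued x) (glued y))) => t g1 g2.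
  exact: etrans g1 (esym g2).
have [C C0 CP] := glue_sqmod; exists C => // x.
have aeid : {ae mu, forall t, L2_val x t = L2_val x t} by exact: aeW.
rewrite -lee_fin EFinM (rinner_sqmod (glue_L2 x) (glueE x)) (rinner_sqmod (L2_valP x) aeid).
by have [] := CP x.
Qed.

(** At t, lambda(r) reads the glued function on the fiber of r^-1 t; [lambda_conjugated] turns the
    conjugate used there into the one belonging to the fiber of t. *)
Lemma glue_lambda r x : glued (lambda r x) = lambda r (glued x).
Proof.
apply: L2_ext.
have e1 := glueE (lambda r x); have e2 := haar_ae_lmul r^-1%g (glueE x).
have e3 := lambdaE omega r (glued x).
(* Needed for all [n] outside one null set, since the index used below varies with [t]. *)
have e4 : {ae mu, forall t, forall n, lambda r (conjugated (s_ n) x) t =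
    twisted_translate omega r (conjugated (s_ n) x) t}.
  by apply: ae_foralln => n; exact: lambdaE.
near=> t.
have -> : glued (lambda r x) t = glue_fun (lambda r x) t by near: t.
have -> : lambda r (glued x) t = twisted_translate omega r (glued x) t by near: t.
rewrite /twisted_translate.
have -> : glued x (r^-1 * t)%g = glue_fun x (r^-1 * t)%g by near: t.
rewrite /glue_fun; set n := idx (Delta (r^-1 * t)%g).
transitivity (lambda r (conjugated (s_ n) x) t); last by move: n; near: t.
by rewrite (@lambda_conjugated r (s_ n) (s_ (idx (Delta t))))// !s_idx modularM modularV
  mulVKf// modular_neq0.
Unshelve. all: by end_near. Qed.

Lemma degree_part_glue x : degree_part 1 (glued x) = degree_part 1 (compressed x).
Proof.
apply: L2_ext.
have e1 := degree_partE kerO 1 (glued x); have e2 := degree_partE kerO 1 (compressed x).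
have e3 := glueE x.
near=> t.
have -> : degree_part 1 (glued x) t = degree_fun Delta 1 (glued x) t by near: t.
have -> : degree_part 1 (compressed x) t = degree_fun Delta 1 (compressed x) t by near: t.
have [t1|t1] := pselect (Delta t = 1); last by rewrite !degree_fun0.
rewrite !degree_fun_id//.
have -> : glued x t = glue_fun x t by near: t.
by rewrite /glue_fun conjugated_fiber// s_idx.
Unshelve. all: by end_near. Qed.

End gluing.

(** * The center of N inside M, and the fixed points of the action *)

Section center_in_kernel.
Context {R : realType} {G : lcGroupType} {mu : left_haar_measure R G}
  (Delta : modular_function mu) (omega : cocycle2 R G)
  (kerO : open (modular_kernel Delta)) (scG : @second_countable G).
Local Notation lambda := (lambda mu omega).
Local Notation lambda_inv := (@lambda_inv R G mu omega).
Local Notation degree_part := (degree_part Delta).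

Lemma degree_parts_eq0 (w : L2 mu) : (forall t, degree_part (Delta t) w = 0) -> w = 0.
Proof.
move=> h; apply: L2_ext.
have zeroE : {ae mu, forall t, L2_val (0 : L2 mu) t = 0} by exact/L2_ofK/square_integrable0.
suff w0 : {ae mu, forall t, w t = 0} by apply: (ae_imply2 w0 zeroE) => t -> ->.
apply: (ae_fibers kerO scG) => e; have [[t0 t0e]|no] := pselect (exists t, Delta t = e);
  last first.
  by apply: aeW => t te; case: no; exists t.
have wE := degree_partE kerO e w; have w0 : degree_part e w = 0 by rewrite -t0e h.
apply: (ae_imply2 wE zeroE) => t wt zt te.
by rewrite -(degree_fun_id w te) -wt w0.
Qed.

Section commuting.
Variables (z zt : L2 mu -> L2 mu).
Hypotheses (zb : bounded_operator z) (zadj : forall x y, rinner (z x) y = rinner x (zt y))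
  (zN : forall U, bounded_operator U -> (forall s x, U (lambda s x) = lambda s (U x)) ->
     forall x, z (U x) = U (z x))
  (zlambda : forall s x, z (lambda s x) = lambda s (z x)).

Let zl : linear z. Proof. by case: zb. Qed.

Let zdeg e x : z (degree_part e x) = degree_part e (z x).
Proof.
apply: (central_degree_part kerO scG zl zadj zlambda) => b x'.
by apply: zN; [exact: rho_bounded Delta _ _|move=> s y; exact: rho_lambda Delta _ _ _ _].
Qed.

(** Gluing settles the corners p_1 T p_e one at a time; what remains is to pass from the degree
    parts of [x] to [x] itself. *)
Lemma commute_degree1 (T : L2 mu -> L2 mu) : bounded_operator T ->
  (forall k x, Delta k = 1 -> T (lambda k x) = lambda k (T x)) ->
  forall x, degree_part 1 (z (T x)) = degree_part 1 (T (z x)).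
Proof.
move=> Tb Tker; have [Tt Tadj] := L2_adjoint Tb; have [Tl _] := Tb.
have [idx idxP] := modular_index kerO scG.
have /choice[s_ sP] : forall n, exists s, forall t, idx (Delta t) = n -> Delta s = Delta t.
  move=> n; have [[t tn]|no] := pselect (exists t, idx (Delta t) = n).
    by exists t => t' t'n; apply: idxP; rewrite tn.
  by exists 1%g => t tn; case: no; exists t.
have s_idx t : Delta (s_ (idx (Delta t))) = Delta t by exact: sP.
(* [z] commutes with both projections and with the glued operator, which agrees with [T] on this
   corner. *)
have step u x : degree_part 1 (z (T (degree_part (Delta u) x))) = degree_part 1 (T (z
  (degree_part (Delta u) x))).
  have u0 : Delta u != 0 by exact: modular_neq0.
  have gE := degree_part_glue kerO Tb Tker u0 idxP s_idx.
  have gN : z (glued Delta omega T (Delta u) idx s_ x) = glued Delta omega T (Delta u) idx s_ (z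
    x).
    apply: (zN (U := glued Delta omega T (Delta u) idx s_));
      first exact (glue_bounded omega kerO Tb u0 idxP s_idx).
    by move=> s y; exact (glue_lambda kerO Tb Tker u0 idxP s_idx s y).
  have := gE x; have := gE (z x); rewrite /compressed -gN => h1 h2.
  by rewrite -zdeg -h2 zdeg h1 -zdeg.
move=> x; apply/eqP; rewrite -subr_eq0; apply/eqP.
(* An infinite sum over degrees is avoided by moving the commutator to the other side of the
   pairing: it becomes the vector [w], all of whose degree parts vanish by [step]. *)
set W := _ - _; apply: rinner_eq0.
pose y1 := degree_part 1 W; pose w := Tt (zt y1) - zt (Tt y1).
have adj x' : rinner (degree_part 1 (z (T x')) - degree_part 1 (T (z x'))) W = rinner x' w.
  rewrite rinnerBl !(rinner_degree_part kerO 1) -/y1 /w rinnerBr.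
  by rewrite zadj Tadj Tadj zadj.
have -> : rinner W W = rinner x w by exact: adj.
suff -> : w = 0 by rewrite rinnerC /rinner inner0l.
apply: degree_parts_eq0 => t; apply: rinner_eq0.
rewrite -(rinner_degree_part kerO) -adj step subrr.
by rewrite /rinner inner0l.
Qed.

(** The kernel is normal, so conjugating [T] by lambda(s) keeps it commuting with the translations
    by the kernel. This moves the target degree from 1 to [Delta s], while [z] commutes with
    lambda(s). *)
Lemma commute_kernel_commutant (T : L2 mu -> L2 mu) : bounded_operator T ->
  (forall k x, Delta k = 1 -> T (lambda k x) = lambda k (T x)) ->
  forall x, z (T x) = T (z x).
Proof.
move=> Tb Tker x; apply/eqP; rewrite -subr_eq0; apply/eqP.
have [Tl _] := Tb.
apply: degree_parts_eq0 => s; pose T1 := lambda_inv s \o T \o lambda s.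
have T1b : bounded_operator T1.
  apply: bounded_operator_comp; last exact: lambda_bounded.
  apply: bounded_operator_comp => //.
  apply/bounded_operatorP; split; first exact: lambda_inv_linear.
  by exists 1 => // y; rewrite mul1r rinner_lambda_inv.
have T1ker k y : Delta k = 1 -> T1 (lambda k y) = lambda k (T1 y).
  move=> k1; pose k' := (s * k * s^-1)%g.
  have k'1 : Delta k' = 1 by rewrite !modularM modularV k1 mulr1 mulfV// modular_neq0.
  have [c cP] := @lambda_exchange R G mu omega s k k' s ltac:(by rewrite /k' mulgVK).
  apply: (can_inj (lambdaK omega s)); rewrite cP /T1 /= cP (linearZ_fun Tl) Tker//.
  by rewrite !(lambda_invK omega s).
have h := commute_degree1 T1b T1ker (lambda_inv s x).
have zinv y : z (lambda_inv s y) = lambda_inv s (z y).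
  by apply: (can_inj (lambdaK omega s)); rewrite -zlambda !lambda_invK.
rewrite /T1 /= lambda_invK !zinv lambda_invK in h.
have dB y y' : degree_part (Delta s) (y - y') = degree_part (Delta s) y - degree_part (Delta s)
  y'.
  exact: (linearB_fun (degree_part_linear kerO (Delta s))).
have dE y : degree_part (Delta s) y = lambda s (degree_part 1 (lambda_inv s y)).
  by rewrite (lambda_degree_part omega kerO) mulr1 lambda_invK.
by rewrite dB !dE h subrr.
Qed.

End commuting.

Lemma center_twisted_vN_sub (z : L2 mu -> L2 mu) :
  twisted_vN mu omega [set: G] z -> commutant (lambda @` [set: G]) z ->
  twisted_vN mu omega (modular_kernel Delta) z.
Proof.
move=> [zb zN] [_ zC]; have [zt zadj] := L2_adjoint zb.
split=> // T [Tb Tker]; apply/funext => x /=.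
apply: (commute_kernel_commutant zb zadj) => //.
- move=> U Ub Ul y; apply: (congr1 (@^~ y) (zN U _)); split=> // V [s _ <-].
  by apply/funext => y'; exact: Ul.
- by move=> s y; exact: (congr1 (@^~ y) (zC _ (ex_intro2 _ _ s I erefl))).
- by move=> k y k1; exact: (congr1 (@^~ y) (Tker _ (ex_intro2 _ _ k k1 erefl))).
Qed.

Lemma twisted_vN_lambda (S : set G) s : S s -> twisted_vN mu omega S (lambda s).
Proof.
move=> Ss; apply: bicommutant_sub; last by exists s.
by move=> _ [t _ <-]; exact: lambda_bounded.
Qed.

Lemma twisted_vN_mono (S S' : set G) : S `<=` S' ->
  twisted_vN mu omega S `<=` twisted_vN mu omega S'.
Proof.
move=> SS' T [Tb TC]; split=> // U [Ub UC]; apply: TC; split=> // V [s Ss <-].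
by apply: UC; exists s => //; exact: SS'.
Qed.

(** Commuting with the generators is the same as commuting with their bicommutant. *)
Lemma center_twisted_vNP (z : L2 mu -> L2 mu) : Defs.center (twisted_vN mu omega [set: G]) z <->
  twisted_vN mu omega [set: G] z /\ commutant (lambda @` [set: G]) z.
Proof.
split=> [[zN [zb zC]]|[zN [zb zC]]]; split=> //; split=> // U.
  by move=> [s _ <-]; apply: zC; exact: twisted_vN_lambda.
by move=> [Ub UC]; apply/esym/UC.
Qed.

Lemma adjoint_lambda s : adjoint (lambda s) = lambda_inv s.
Proof.
by apply: adjointP => x y; rewrite -[y in LHS](lambda_invK omega s) lambda_isometry.
Qed.

Lemma Ad_implementing_unitary (sigma : modular_section Delta) (d : modular_image Delta)
  (T : L2 mu -> L2 mu) : (forall s, T \o lambda s = lambda s \o T) ->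
  Ad (implementing_unitary sigma omega d) T = T.
Proof.
move=> Tl; rewrite /Ad /implementing_unitary; case: eqP => _.
  by rewrite (_ : adjoint id = id)//; exact: adjointP.
rewrite adjoint_lambda; apply/funext => x /=.
have /= := congr1 (fun f => f (lambda_inv (sigma d^-1%g)^-1%g x)) (Tl (sigma d^-1%g)^-1%g).
by rewrite lambda_invK => <-.
Qed.

(** Factor s = h k with h the group element defining the unitary of degree [Delta s] and k in the
    kernel; being fixed by that unitary means commuting with lambda(h). Degree 1 is separate because
    its unitary is the identity. *)
Lemma Ad_implementing_unitary_commute (sigma : modular_section Delta) (T : L2 mu -> L2 mu) :
  linear T -> (forall s x, Delta s = 1 -> T (lambda s x) = lambda s (T x)) ->
  (forall d, Ad (implementing_unitary sigma omega d) T = T) ->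
  forall s x, T (lambda s x) = lambda s (T x).
Proof.
move=> Tl Tker Tad s x.
pose d : modular_image Delta := SigSub (mem_set (ex_intro2 _ _ s I erefl : range Delta (Delta
  s))).
have [d1|dN1] := eqVneq d 1%g; first by apply: Tker; exact: (congr1 val d1).
pose h := (sigma d^-1%g)^-1%g.
have hd : Delta h = Delta s by rewrite /h modularV msectionK /= invrK.
have Th y : T (lambda h y) = lambda h (T y).
  have := Tad d; rewrite /Ad /implementing_unitary (negbTE dN1) -/h adjoint_lambda => Te.
  by rewrite -{1}Te /= lambdaK.
have k1 : Delta (h^-1 * s)%g = 1 by rewrite modularM modularV hd mulVf// modular_neq0.
have sE y : lambda s y = (omega h (h^-1 * s)%g)^-1 *: lambda h (lambda (h^-1 * s)%g y).
  by rewrite lambdaM mulVKg scalerA mulVf ?scale1r// cocycle_neq0.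
by rewrite !sE (linearZ_fun Tl) Th Tker.
Qed.

End center_in_kernel.

Theorem corollary3p2 (R : realType) (G : lcGroupType)
    (mu : left_haar_measure R G) (Delta : modular_function mu)
    (omega : cocycle2 R G) (sigma : modular_section Delta)
    (G_second_countable : @second_countable G)
    (G_almost_unimodular : open (modular_kernel Delta)) :
  centrally_ergodic (twisted_cocycle_action sigma omega) <->
  is_factor (twisted_vN mu omega [set: G]).
Proof.
rewrite /centrally_ergodic /is_factor.
set A := [set T | _]; suff -> : A = Defs.center (twisted_vN mu omega [set: G]) by [].
apply/seteqP; split=> T; rewrite /A /=.
  move=> [[TM [Tb TC]] Tad]; apply/center_twisted_vNP.
  split; first exact: (twisted_vN_mono _ TM).
  split=> // _ [s _ <-]; apply/funext => x /=.
  apply: (Ad_implementing_unitary_commute (sigma := sigma)) => //; first by case: Tb.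
  move=> k y k1; exact: (congr1 (@^~ y) (TC _ (twisted_vN_lambda omega (S := modular_kernel
    Delta) k1))).
move=> TZ; have /center_twisted_vNP[TN TC] := TZ; have [_ [Tb TcN]] := TZ.
split.
  split; first exact: center_twisted_vN_sub.
  by split=> // U UM; apply: TcN; exact: (twisted_vN_mono _ UM).
move=> d; apply: Ad_implementing_unitary => s; case: TC => _; apply; exists s => //.
Qed.
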